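(* Assume (A1)–(A5). Fix $x_0\in B_{R^*}$ and let $\lambda_n\downarrow0$ be a sequence such that $T_{\lambda_n}\to T_0$ locally uniformly on $\mathbb{R}$ and $\phi_{\lambda_n}\to v_\phi$, $\psi_{\lambda_n}\to v_\psi$ in $\mathcal{C}^3_{\mathrm{loc}}(\Omega_0)$, where $\Omega_0=\{(y,s):y\in\mathbb{R},\ s<T_0(y)\}$. Then there exists $\alpha\in(-1,1)$ such that $T_0(y)=\alpha y$ for all $y\in\mathbb{R}$, and $v_\phi=V_{\phi,\alpha}$, $v_\psi=V_{\psi,\alpha}$.
   Context: Let $p>1$ and $\mu>0$ with $p<1+2/\mu$, and let $R^*,T^*>0$. Write $B_R=\{x\in\mathbb{R}:|x|<R\}$ and $D_\pm=\partial_t\pm\partial_x$. Consider the system $D_-\phi=2^{-p}|\phi+\psi|^p-\frac{\mu}{1+t}\frac{\phi+\psi}{2}$, $D_+\psi=2^{-p}|\phi+\psi|^p-\frac{\mu}{1+t}\frac{\phi+\psi}{2}$, $\phi(x,0)=f(x)$, $\psi(x,0)=g(x)$. Fix $\gamma_1,\gamma_2>0$ with $\gamma_1+\gamma_2>\max\big(1,(\mu p 2^p)^{1/(p-1)}\big)$ and let $T_1=\frac{1}{(p-1)\mu}\ln\Big(\frac{2^{1-p}/\mu}{2^{1-p}/\mu-(\gamma_1+\gamma_2)^{1-p}}\Big)$. Assumptions: (A1) $T_1<T^*$. (A2) $f\ge\gamma_1$, $g\ge\gamma_2$ on $B_{R^*+T^*}$. (A3) $f,g\in\mathcal{C}^4(\overline{B_{R^*+T^*}})$.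 (A4) There is $\varepsilon_0>0$ with $2^{-p}(\gamma_1+\gamma_2)^p-\frac{\mu}{2}(\gamma_1+\gamma_2)\ge(2+\varepsilon_0)\max_{x\in B_{R^*+T^*}}(|f'(x)|+|g'(x)|)$. (A5) There is $\varepsilon_1\neq-1$ with $2^{-p}(2p-1)\big(1+\frac{\varepsilon_1}{2(1+\varepsilon_1)}\big)\big(1-\frac{1}{2p}\big)-2^{-p+1}p-\mu>0$ such that $2^{-p}(\gamma_1+\gamma_2)^p-\frac{\mu}{2}(\gamma_1+\gamma_2)\ge(2+\varepsilon_1)\max_{x\in B_{R^*+T^*}}(|f'(x)|+|g'(x)|)$. Let $K_{R^*,T^*}=\{(x,t):t>0,\ |x-x_0|<T^*-t\ \text{for some } x_0\in B_{R^*}\}$. Define iterates $\phi_0\equiv\gamma_1$, $\psi_0\equiv\gamma_2$ and, with $\mathcal{N}_n(x,s)=2^{-p}|\phi_n+\psi_n|^p(x,s)-\frac{\mu}{1+s}\frac{(\phi_n+\psi_n)(x,s)}{2}$, $\phi_{n+1}(x,t)=f(x+t)+\int_0^t\mathcal{N}_n(x+t-s,s)\,ds$, $\psi_{n+1}(x,t)=g(x-t)+\int_0^t\mathcal{N}_n(x-t+s,s)\,ds$. Set $\phi=\sup_n\phi_n$, $\psi=\sup_n\psi_n$, $T(x)=\sup\{t\in(0,T^* ):(\phi+\psi)(x,t)<\infty\}$ for $x\in B_{R^*}$, and $\Omega=\{(x,t):x\in B_{R^*},\ 0<t<T(x)\}$. With $q=\frac1{p-1}$ and $\lambda>0$, the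 rescaled functions are $\phi_\lambda(y,s)=\lambda^q\phi(x_0+\lambda y,T(x_0)+\lambda s)$, $\psi_\lambda(y,s)=\lambda^q\psi(x_0+\lambda y,T(x_0)+\lambda s)$, and $T_\lambda(y)=\frac{T(x_0+\lambda y)-T(x_0)}{\lambda}$. For $\alpha\in(-1,1)$, the self-similar profiles are $V_{\phi,\alpha}(y,s)=C_{\phi,\alpha}(\alpha y-s)^{-q}$, $V_{\psi,\alpha}(y,s)=C_{\psi,\alpha}(\alpha y-s)^{-q}$ with $C_{\phi,\alpha}=\frac{1-\alpha}{2}A$, $C_{\psi,\alpha}=\frac{1+\alpha}{2}A$, $A^{p-1}=2^{p-1}q(1-\alpha^2)$. *)

(* Defs.v *)
From Stdlib Require Import Reals.
From Coquelicot Require Import Coquelicot.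
Open Scope R_scope.

Definition rpow (x a : R) : R := if Rlt_dec 0 x then Rpower x a else 0.

Definition Nl (p mu : R) (u s : R) : R :=
  Rpower 2 (- p) * rpow (Rabs u) p - mu / (1 + s) * (u / 2).

Fixpoint iterates (p mu g1 g2 : R) (f g : R -> R) (n : nat)
  : (R -> R -> R) * (R -> R -> R) :=
  match n with
  | O => (fun _ _ => g1, fun _ _ => g2)
  | S m =>
    let '(ph, ps) := iterates p mu g1 g2 f g m in
    (fun x t => f (x + t) +
        RInt (fun s => Nl p mu (ph (x + t - s) s + ps (x + t - s) s) s) 0 t,
     fun x t => g (x - t) +
        RInt (fun s => Nl p mu (ph (x - t + s) s + ps (x - t + s) s) s) 0 t)
  end.

Definition Phi p mu g1 g2 f g (x t : R) : Rbar :=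
  Lub_Rbar (fun r => exists n, r = fst (iterates p mu g1 g2 f g n) x t).
Definition Psi p mu g1 g2 f g (x t : R) : Rbar :=
  Lub_Rbar (fun r => exists n, r = snd (iterates p mu g1 g2 f g n) x t).

Definition Tblow p mu g1 g2 f g (Tst x : R) : R :=
  real (Lub_Rbar (fun t => 0 < t < Tst /\
     Rbar_lt (Rbar_plus (Phi p mu g1 g2 f g x t) (Psi p mu g1 g2 f g x t))
             p_infty)).

Definition phi_resc p mu g1 g2 f g Tst (x0 lam y s : R) : R :=
  Rpower lam (/ (p - 1)) *
  real (Phi p mu g1 g2 f g (x0 + lam * y) (Tblow p mu g1 g2 f g Tst x0 + lam * s)).
Definition psi_resc p mu g1 g2 f g Tst (x0 lam y s : R) : R :=
  Rpower lam (/ (p - 1)) *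
  real (Psi p mu g1 g2 f g (x0 + lam * y) (Tblow p mu g1 g2 f g Tst x0 + lam * s)).
Definition T_resc p mu g1 g2 f g Tst (x0 lam y : R) : R :=
  (Tblow p mu g1 g2 f g Tst (x0 + lam * y) - Tblow p mu g1 g2 f g Tst x0) / lam.

Definition Aconst (p alpha : R) : R :=
  Rpower (Rpower 2 (p - 1) * / (p - 1) * (1 - alpha ^ 2)) (/ (p - 1)).
Definition Vphi (p alpha y s : R) : R :=
  (1 - alpha) / 2 * Aconst p alpha * Rpower (alpha * y - s) (- / (p - 1)).
Definition Vpsi (p alpha y s : R) : R :=
  (1 + alpha) / 2 * Aconst p alpha * Rpower (alpha * y - s) (- / (p - 1)).

Definition T1 (p mu g1 g2 : R) : R :=
  / ((p - 1) * mu) *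
  ln ((Rpower 2 (1 - p) / mu) / (Rpower 2 (1 - p) / mu - Rpower (g1 + g2) (1 - p))).

(* f in C^k of the closed interval: f continuous on [-a,a]; derivatives of
   order <= k exist on (-a,a) and are uniformly continuous there (i.e. extend
   continuously to [-a,a]). *)
Definition Ck_closed (k : nat) (f : R -> R) (a : R) : Prop :=
  (forall x, -a <= x <= a -> forall eps, 0 < eps -> exists del, 0 < del /\
     forall x', -a <= x' <= a -> Rabs (x' - x) < del -> Rabs (f x' - f x) < eps) /\
  (forall j, (j <= k)%nat -> forall x, -a < x < a -> ex_derive_n f j x) /\
  (forall j, (j <= k)%nat -> forall eps, 0 < eps -> exists del, 0 < del /\
     forall x x', -a < x < a -> -a < x' < a -> Rabs (x' - x) < del ->
       Rabs (Derive_n f j x' - Derive_n f j x) < eps).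

Definition maxder (f g : R -> R) (a : R) : R :=
  real (Lub_Rbar (fun r => exists x, -a < x < a /\
                    r = Rabs (Derive f x) + Rabs (Derive g x))).

Definition pd (i j : nat) (F : R -> R -> R) (y s : R) : R :=
  Derive_n (fun y' => Derive_n (fun s' => F y' s') j s) i y.

Definition cont2 (G : R -> R -> R) (y s : R) : Prop :=
  forall eps, 0 < eps -> exists del, 0 < del /\
    forall y' s', Rabs (y' - y) < del -> Rabs (s' - s) < del ->
      Rabs (G y' s' - G y s) < eps.

Definition C3_at (F : R -> R -> R) (y s : R) : Prop :=
  exists del, 0 < del /\ forall y' s', Rabs (y' - y) < del -> Rabs (s' - s) < del ->
    (forall i j, (i + j < 3)%nat ->
        ex_derive (fun y'' => pd i j F y'' s') y') /\
    (forall j, (j < 3)%nat -> ex_derive (fun s'' => pd 0 j F y' s'') s') /\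
    (forall i j, (i + j <= 3)%nat -> cont2 (pd i j F) y' s').

Definition compact2 (K : R -> R -> Prop) : Prop :=
  (exists M, forall y s, K y s -> Rabs y <= M /\ Rabs s <= M) /\
  (forall y s, (forall eps, 0 < eps -> exists y' s', K y' s' /\
                  Rabs (y' - y) < eps /\ Rabs (s' - s) < eps) -> K y s).

Definition conv_C3loc (Fn : nat -> R -> R -> R) (F : R -> R -> R)
  (U : R -> R -> Prop) : Prop :=
  (forall y s, U y s -> C3_at F y s) /\
  (forall K, compact2 K -> (forall y s, K y s -> U y s) ->
     (exists N, forall n, (N <= n)%nat -> forall y s, K y s -> C3_at (Fn n) y s) /\
     (forall eps, 0 < eps -> exists N, forall n, (N <= n)%nat ->
        forall y s, K y s -> forall i j, (i + j <= 3)%nat ->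
          Rabs (pd i j (Fn n) y s - pd i j F y s) < eps)).

Definition conv_locunif (Gn : nat -> R -> R) (G : R -> R) : Prop :=
  forall a eps, 0 < eps -> exists N, forall n, (N <= n)%nat ->
    forall y, Rabs y <= a -> Rabs (Gn n y - G y) < eps.

(* Main.v *)
(* The monotonicity of the nonlinearity and (A4) make every iterate, hence phi and psi, nondecreasing
   in all space-time directions (c, 1) with |c| <= k for some k > 1.  Therefore T is 1/k-Lipschitz,
   and comparison with an ODE and local existence give T <= T1 and a blow-up rate from below.  In the
   limit, with u = v_phi + v_psi, both D_- v_phi and D_+ v_psi equal N(u) = 2^-p u^p, and u^(1-p) is
   comparable to the distance T_0(y) - s.

   Any directional derivative of (v_phi, v_psi) solves the cooperative linear system
   D_- a = D_+ b = N'(u) (a + b), and the derivatives in s and in (c, 1), |c| <= k, are positive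
   solutions.  A scale-invariant Harnack inequality makes two ancient positive solutions with bounded
   ratios proportional.  Hence grad v = (m, 1) d_s v with a constant m, and u^(1-p) is affine, which
   is the claim with alpha = -m. *)
Require Import Defs.
From Stdlib Require Import Reals Lra Lia Classical.
From Coquelicot Require Import Coquelicot.
Open Scope R_scope.

(** * Calculus along curves *)

(** Everything rests on k being strictly larger than the characteristic speed 1. It comes from the
    margin [eps0] in (A4): points differing by h (c, 1) with |c| <= k have characteristics whose
    feet are at most (1 + k) h apart. It makes the time derivative and the source comparable, and it
    lets the backward cone of any fixed point fit, at very negative times, into a region that stays
    well below the graph of T_0.

    The obstacle is that ancient solutions have no initial data from which proportionality could be
    read off. Scaling takes the place of data: within distance of order S of the origin, N'(u) is at
    least of order 1 / S, so a characteristic of length S transfers a fixed fraction of one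
    component to the other, whatever S is. With S tending to infinity this fraction contradicts the
    optimality of the best bounds for the slope.

    The limit equation is obtained from increments along characteristics, which survive pointwise
    limits; the functions phi and psi themselves are never differentiated. *)

Lemma le_of_derive_nonneg (f df : R -> R) (a b : R) :
  a <= b -> (forall x, a <= x <= b -> is_derive f x (df x)) ->
  (forall x, a <= x <= b -> 0 <= df x) -> f a <= f b.
Proof.
intros Hab Hd Hp.
destruct (MVT_gen f a b df) as [c [Hc E]].
- intros x Hx; rewrite Rmin_left, Rmax_right in Hx by lra; apply Hd; lra.
- intros x Hx; rewrite Rmin_left, Rmax_right in Hx by lra.
  apply continuity_pt_filterlim, (ex_derive_continuous f); exists (df x); apply Hd; lra.
- rewrite Rmin_left, Rmax_right in Hc by lra.
  assert (0 <= df c * (b - a)) by (apply Rmult_le_pos; [apply Hp|]; lra); lra.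
Qed.

(** Monotonicity of [f x - RInt g a x]. Only the minorant [g] is integrated, so [df] may be
    arbitrary; the margin [d] allows the integral to be differentiated at both end points. *)
Lemma RInt_le_increment (f df g : R -> R) (a b d : R) :
  a <= b -> 0 < d ->
  (forall x, a <= x <= b -> is_derive f x (df x)) ->
  (forall x, a - d < x < b + d -> continuous g x) ->
  (forall x, a <= x <= b -> g x <= df x) ->
  RInt g a b <= f b - f a.
Proof.
intros Hab Hd Hf Hg Hle.
assert (H : f a - RInt g a a <= f b - RInt g a b).
{ apply (le_of_derive_nonneg (fun x => f x - RInt g a x) (fun x => df x - g x)); auto.
  - intros x Hx. apply (is_derive_minus f (fun x => RInt g a x)). apply Hf; lra.
    apply (is_derive_RInt g (fun x => RInt g a x) a).
    + assert (Hdd : 0 < d / 2) by lra. exists (mkposreal _ Hdd). intros z Hz.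
      unfold ball in Hz; simpl in Hz; unfold AbsRing_ball, abs, minus, plus, opp in Hz; simpl in Hz.
      apply Rabs_def2 in Hz.
      apply (RInt_correct g), (ex_RInt_continuous g). intros w Hw. apply Hg.
      assert (a - d / 2 <= Rmin a z) by (apply Rmin_glb; lra).
      assert (Rmax a z <= b + d / 2) by (apply Rmax_lub; lra). lra.
    + apply Hg; lra.
  - intros x Hx. generalize (Hle x Hx); lra. }
rewrite RInt_point in H. unfold zero in H; simpl in H. lra.
Qed.

Lemma derive_ge_of_increments (f : R -> R) (x l m d : R) :
  is_derive f x l -> 0 < d ->
  (forall h, 0 < h < d -> m * h <= f (x + h) - f x) -> m <= l.
Proof.
intros Hf Hd H. apply is_derive_Reals in Hf.
destruct (Rle_or_lt m l) as [|Hlt]; auto. exfalso.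
destruct (Hf (m - l)) as [del Hdel]; [lra|].
set (h := Rmin (del / 2) (d / 2)).
assert (0 < h) by (apply Rmin_glb_lt; [generalize (cond_pos del)|]; lra).
assert (h <= del / 2) by apply Rmin_l. assert (h <= d / 2) by apply Rmin_r.
assert (Rabs ((f (x + h) - f x) / h - l) < m - l).
{ apply Hdel; [lra|]. rewrite Rabs_pos_eq; generalize (cond_pos del); lra. }
apply Rabs_def2 in H3. assert (m <= (f (x + h) - f x) / h); [|lra].
apply Rle_div_r; auto. apply H; lra.
Qed.

Lemma derive_le_of_increments (f : R -> R) (x l m d : R) :
  is_derive f x l -> 0 < d ->
  (forall h, 0 < h < d -> f x - f (x - h) <= m * h) -> l <= m.
Proof.
intros Hf Hd H.
assert (Hg : is_derive (fun t => f (x - t)) 0 (- l)).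
{ evar_last. apply (is_derive_comp f (fun t => x - t)). 2: auto_derive; auto; reflexivity.
  rewrite Rminus_0_r. apply Hf. unfold scal; simpl; unfold mult; simpl; ring. }
cut (- m <= - l); [lra|].
apply (derive_ge_of_increments _ _ _ _ _ Hg Hd).
intros h Hh. rewrite Rminus_0_r, Rplus_0_l. specialize (H h Hh). lra.
Qed.

Lemma pow_half_limit_nonneg (a K : R) : (forall n, - (K / 2 ^ n) <= a) -> 0 <= a.
Proof.
intros H.
assert (L : is_lim_seq (fun n => - (K * (/ 2) ^ n)) (- (K * 0))).
{ apply (proj1 (is_lim_seq_opp _ (Finite (K * 0)))). apply is_lim_seq_mult'. apply is_lim_seq_const.
  apply is_lim_seq_geom. rewrite Rabs_pos_eq; lra. }
rewrite Rmult_0_r, Ropp_0 in L.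
apply (is_lim_seq_le (fun n => - (K * (/ 2) ^ n)) (fun _ => a) 0 a); auto using is_lim_seq_const.
intros n. rewrite pow_inv. apply H.
Qed.

(** The partial derivatives are explicit functions rather than values of [Derive], so that sums and
    compositions produce theirs as terms ready for rewriting. *)
Definition C1_on (U : R -> R -> Prop) (F Fy Fs : R -> R -> R) : Prop :=
  forall y s, U y s ->
    is_derive (fun y' => F y' s) y (Fy y s) /\ is_derive (fun s' => F y s') s (Fs y s) /\
    continuity_2d_pt Fy y s /\ continuity_2d_pt Fs y s.

Definition open2 (U : R -> R -> Prop) : Prop := forall y s, U y s -> locally_2d U y s.

Section C1Calculus.
Variable U : R -> R -> Prop.
Hypothesis openU : open2 U.

Lemma C1_differentiable F Fy Fs y s :
  C1_on U F Fy Fs -> U y s -> differentiable_pt_lim F y s (Fy y s) (Fs y s).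
Proof.
intros HF Hu. apply filterdiff_differentiable_pt_lim.
eapply filterdiff_ext_lin. apply is_derive_filterdiff with (dfx := Fy).
- generalize (proj1 (locally_2d_locally _ _ _) (openU _ _ Hu)).
  apply filter_imp. intros [a b] Hab. simpl in *. apply (HF a b Hab).
- apply (HF y s Hu).
- apply continuity_2d_pt_filterlim. apply (HF y s Hu).
- intros [a b]; simpl. reflexivity.
Qed.

Lemma C1_continuity F Fy Fs y s :
  C1_on U F Fy Fs -> U y s -> continuity_2d_pt F y s.
Proof.
intros HF Hu. apply differentiable_continuity_pt.
exists (Fy y s), (Fs y s). apply C1_differentiable; auto.
Qed.

Lemma C1_along F Fy Fs y s a b r :
  C1_on U F Fy Fs -> U (y + a * r) (s + b * r) ->
  is_derive (fun r => F (y + a * r) (s + b * r)) r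
    (a * Fy (y + a * r) (s + b * r) + b * Fs (y + a * r) (s + b * r)).
Proof.
intros HF Hu. apply is_derive_Reals.
replace (a * Fy (y + a * r) (s + b * r) + b * Fs (y + a * r) (s + b * r))
  with (Fy (y + a * r) (s + b * r) * a + Fs (y + a * r) (s + b * r) * b) by ring.
apply (derivable_pt_lim_comp_2d F (fun r => y + a * r) (fun r => s + b * r)).
- apply C1_differentiable; auto.
- apply is_derive_Reals; auto_derive; auto; ring.
- apply is_derive_Reals; auto_derive; auto; ring.
Qed.

Lemma C1_lincomb F Fy Fs H Hy Hs c d :
  C1_on U F Fy Fs -> C1_on U H Hy Hs ->
  C1_on U (fun y s => c * F y s + d * H y s) (fun y s => c * Fy y s + d * Hy y s)
    (fun y s => c * Fs y s + d * Hs y s).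
Proof.
intros HF HH y s Hu. destruct (HF y s Hu) as (F1 & F2 & F3 & F4).
destruct (HH y s Hu) as (H1 & H2 & H3 & H4).
split; [|split; [|split]].
- apply (is_derive_plus (fun y' => c * F y' s) (fun y' => d * H y' s)).
  apply (is_derive_scal (fun y' => F y' s)); auto.
  apply (is_derive_scal (fun y' => H y' s)); auto.
- apply (is_derive_plus (fun y' => c * F y y') (fun y' => d * H y y')).
  apply (is_derive_scal (fun y' => F y y')); auto.
  apply (is_derive_scal (fun y' => H y y')); auto.
- apply continuity_2d_pt_plus; apply continuity_2d_pt_mult; auto using continuity_2d_pt_const.
- apply continuity_2d_pt_plus; apply continuity_2d_pt_mult; auto using continuity_2d_pt_const.
Qed.

Lemma C1_comp F Fy Fs (N dN : R -> R) :
  C1_on U F Fy Fs ->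
  (forall y s, U y s -> is_derive N (F y s) (dN (F y s)) /\ continuous dN (F y s)) ->
  C1_on U (fun y s => N (F y s)) (fun y s => dN (F y s) * Fy y s)
    (fun y s => dN (F y s) * Fs y s).
Proof.
intros HF HN y s Hu. destruct (HF y s Hu) as (F1 & F2 & F3 & F4).
destruct (HN y s Hu) as (N1 & N2).
assert (cN : continuity_2d_pt (fun y s => dN (F y s)) y s).
{ apply (continuity_1d_2d_pt_comp dN F). apply continuity_pt_filterlim; auto.
  apply C1_continuity with Fy Fs; auto. }
split; [|split; [|split]].
- evar_last. apply (is_derive_comp N (fun y' => F y' s)); eauto.
  unfold scal; simpl; unfold mult; simpl; ring.
- evar_last. apply (is_derive_comp N (fun y' => F y y')); eauto.
  unfold scal; simpl; unfold mult; simpl; ring.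
- apply continuity_2d_pt_mult; auto.
- apply continuity_2d_pt_mult; auto.
Qed.

Lemma C1_ext F G Fy Fs :
  (forall y s, U y s -> F y s = G y s) -> C1_on U F Fy Fs -> C1_on U G Fy Fs.
Proof.
intros E HF y s Hu. destruct (HF y s Hu) as (F1 & F2 & F3 & F4).
generalize (openU _ _ Hu); intros [d Hd].
split; [|split; [|split]]; auto.
- eapply is_derive_ext_loc; [|apply F1]. exists d. intros z Hz. apply E, Hd; auto.
  rewrite Rminus_diag, Rabs_R0. apply cond_pos.
- eapply is_derive_ext_loc; [|apply F2]. exists d. intros z Hz. apply E, Hd; auto.
  rewrite Rminus_diag, Rabs_R0. apply cond_pos.
Qed.

End C1Calculus.

Lemma cont2_continuity_2d (G : R -> R -> R) y s : cont2 G y s -> continuity_2d_pt G y s.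
Proof.
intros H eps. destruct (H eps (cond_pos eps)) as (d & Hd & H').
exists (mkposreal d Hd). intros u v Hu Hv. apply H'; auto.
Qed.

(* [dir b] is the speed of the characteristics of phi ([b = false]) and of psi ([b = true]). *)
Definition dir (b : bool) : R := if b then 1 else -1.

Lemma dir_sqr b : dir b * dir b = 1.
Proof. destruct b; simpl; ring. Qed.

Lemma Rabs_dir b x : Rabs (dir b * x) = Rabs x.
Proof. destruct b; simpl; rewrite ?Rmult_1_l, ?Rabs_mult; auto.
rewrite Rabs_left by lra; lra. Qed.

(** Instead of a first-touching argument, a lower bound is halved repeatedly. If both components are
    above -2 Z exp(4 L (s - sg)), the right-hand side is at least -4 L Z exp(4 L (s - sg)), which
    the derivative of Z exp(4 L (s - sg)) compensates, so the bound holds with Z. The crude bound -X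
    starts the process; unit speed keeps the characteristics inside the cone. *)
Lemma linear_comparison (A : bool -> R -> R -> R) (c : R -> R -> R) (y0 s0 sg L X : R) :
  let cone y s := sg <= s /\ Rabs (y - y0) <= s0 - s in
  0 < L -> 0 <= X ->
  (forall y s, cone y s -> 0 <= c y s <= L) ->
  (forall b y s r, cone (y + dir b * r) (s + 1 * r) ->
     is_derive (fun r => A b (y + dir b * r) (s + 1 * r)) r
       (c (y + dir b * r) (s + 1 * r) *
         (A false (y + dir b * r) (s + 1 * r) + A true (y + dir b * r) (s + 1 * r)))) ->
  (forall b y s, cone y s -> - X <= A b y s) ->
  (forall b y, cone y sg -> 0 <= A b y sg) ->
  forall b y s, cone y s -> 0 <= A b y s.
Proof.
intros cone HL HX Hc HD Hlow H0.
assert (E : forall n b y s, cone y s -> - (X / 2 ^ n) * exp (4 * L * (s - sg)) <= A b y s).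
{ induction n as [|n IH]; intros b y s Hys.
  - assert (1 <= exp (4 * L * (s - sg))).
    { destruct Hys. generalize (exp_ineq1_le (4 * L * (s - sg))). nra. }
    generalize (Hlow b y s Hys). simpl. intros. unfold Rdiv. rewrite Rinv_1. nra.
  - destruct Hys as [Hs Hy].
    set (y1 := y - dir b * (s - sg)).
    assert (Hy1 : Rabs (y1 - y0) <= s0 - sg).
    { unfold y1. replace (y - dir b * (s - sg) - y0) with ((y - y0) + - (dir b * (s - sg))) by ring.
      eapply Rle_trans. apply Rabs_triang. rewrite Rabs_Ropp, Rabs_dir, (Rabs_pos_eq (s - sg)) by lra. lra. }
    assert (Hr : forall r, 0 <= r <= s - sg -> cone (y1 + dir b * r) (sg + 1 * r)).
    { intros r Hr. split. lra. unfold y1.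
      replace (y - dir b * (s - sg) + dir b * r - y0) with ((y - y0) + - (dir b * (s - sg - r))) by ring.
      eapply Rle_trans. apply Rabs_triang. rewrite Rabs_Ropp, Rabs_dir, (Rabs_pos_eq (s - sg - r)) by lra. lra. }
    set (Z := X / 2 ^ S n).
    assert (HZ : 0 <= Z).
    { unfold Z. apply Rmult_le_pos; auto. left. apply Rinv_0_lt_compat, pow_lt; lra. }
    assert (HZ2 : X / 2 ^ n = 2 * Z).
    { unfold Z. simpl. field. apply pow_nonzero; lra. }
    assert (M := le_of_derive_nonneg
      (fun r => A b (y1 + dir b * r) (sg + 1 * r) + Z * exp (4 * L * r))
      (fun r => c (y1 + dir b * r) (sg + 1 * r) *
         (A false (y1 + dir b * r) (sg + 1 * r) + A true (y1 + dir b * r) (sg + 1 * r))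
         + Z * (4 * L * exp (4 * L * r))) 0 (s - sg)).
    cbv beta in M.
    replace (y1 + dir b * (s - sg)) with y in M by (unfold y1; ring).
    replace (sg + 1 * (s - sg)) with s in M by ring.
    replace (y1 + dir b * 0) with y1 in M by ring.
    replace (sg + 1 * 0) with sg in M by ring.
    rewrite Rmult_0_r, exp_0 in M.
    assert (B := H0 b y1 (conj (Rle_refl sg) Hy1)).
    cut (A b y1 sg + Z * 1 <= A b y s + Z * exp (4 * L * (s - sg))). { intros; nra. }
    apply M. lra.
    + intros r Hr'. apply (is_derive_plus (fun r => A b (y1 + dir b * r) (sg + 1 * r))
        (fun r => Z * exp (4 * L * r)) r).
      apply HD; auto. auto_derive; auto. ring.
    + intros r Hr'. specialize (Hr r Hr'). specialize (Hc _ _ Hr).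
      assert (I1 := IH false _ _ Hr). assert (I2 := IH true _ _ Hr).
      rewrite HZ2 in I1, I2. replace (sg + 1 * r - sg) with r in I1, I2 by ring.
      set (ex := exp (4 * L * r)) in *. assert (0 < ex) by apply exp_pos.
      set (a1 := A false _ _) in *. set (a2 := A true _ _) in *. set (cc := c _ _) in *.
      assert (0 <= cc * (a1 + a2 + 4 * Z * ex)) by (apply Rmult_le_pos; lra).
      assert (0 <= (L - cc) * (4 * Z * ex)).
      { apply Rmult_le_pos; [lra|]. apply Rmult_le_pos; lra. }
      nra. }
intros b y s Hys. apply pow_half_limit_nonneg with (X * exp (4 * L * (s - sg))).
intros n. generalize (E n b y s Hys). intros.
replace (X * exp (4 * L * (s - sg)) / 2 ^ n) with (X / 2 ^ n * exp (4 * L * (s - sg))).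
lra. field. apply pow_nonzero; lra.
Qed.

(** * Rigidity of blow-up limits *)

Lemma Rpower_pos x a : 0 < Rpower x a.
Proof. apply exp_pos. Qed.

Lemma is_derive_Rpower x a : 0 < x -> is_derive (fun x => Rpower x a) x (a * Rpower x (a - 1)).
Proof. intros. apply is_derive_Reals, derivable_pt_lim_power; auto. Qed.

Lemma continuous_Rpower x a : 0 < x -> continuous (fun x => Rpower x a) x.
Proof. intros. apply (ex_derive_continuous (fun x => Rpower x a)). eexists. apply is_derive_Rpower; auto. Qed.

Lemma Rpower_antitone a b c : c <= 0 -> 0 < a <= b -> Rpower b c <= Rpower a c.
Proof.
intros Hc Hab. replace c with (- - c) by ring. rewrite !(Rpower_Ropp _ (- c)).
apply Rinv_le_contravar. apply Rpower_pos. apply Rle_Rpower_l; lra.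
Qed.

Lemma Rpower_inv_exp x a : 0 < x -> a <> 0 -> Rpower (Rpower x a) (/ a) = x.
Proof. intros. rewrite Rpower_mult, Rinv_r, Rpower_1; auto. Qed.

(** The nonlinearity that survives the rescaling: the damping acquires a factor lambda and
    disappears in the limit. *)
Definition src (p u : R) : R := Rpower 2 (- p) * Rpower u p.
Definition dsrc (p u : R) : R := Rpower 2 (- p) * (p * Rpower u (p - 1)).

(* [v false] and [v true] are the limits of the rescaled phi and psi; [bl_char] is the differential
   equation along the characteristics, in difference form. *)
Record blowup_limit (p k C : R) (T0 : R -> R) (v : bool -> R -> R -> R) : Prop := {
  bl_p : 1 < p;
  bl_k : 1 < k <= 2;
  bl_C : 0 < C;
  bl_T0 : T0 0 = 0;
  bl_lip : forall y y', k * (T0 y' - T0 y) <= Rabs (y' - y);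
  bl_reg : forall b y s, s < T0 y -> C3_at (v b) y s;
  bl_pos : forall b y s, s < T0 y -> 0 <= v b y s;
  bl_mono : forall b y s y' s', s < T0 y -> s' < T0 y' ->
    Rabs (y' - y) <= k * (s' - s) -> v b y s <= v b y' s';
  bl_char : forall b y s h, 0 <= h -> s < T0 y -> s + h < T0 (y + dir b * h) ->
    src p (v false y s + v true y s) * h <= v b (y + dir b * h) (s + h) - v b y s /\
    v b (y + dir b * h) (s + h) - v b y s <=
      src p (v false (y + dir b * h) (s + h) + v true (y + dir b * h) (s + h)) * h;
  bl_low : forall y s, s < T0 y ->
    Rpower (C * (T0 y - s)) (- / (p - 1)) <= v false y s + v true y s }.

Section BlowupLimit.
Variables (p k C : R) (T0 : R -> R) (v : bool -> R -> R -> R).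
Hypothesis HB : blowup_limit p k C T0 v.

Let U y s := s < T0 y.
Let u y s := v false y s + v true y s.
Let vy b y s := pd 1 0 (v b) y s.
Let vs b y s := pd 0 1 (v b) y s.

(** * Geometry of the domain and the limit equation *)

Lemma bl_open : open2 U.
Proof.
intros y s Hu. unfold U in *. destruct (bl_k _ _ _ _ _ HB) as [Hk _].
assert (Hd : 0 < (T0 y - s) / 4) by lra. exists (mkposreal _ Hd). simpl. intros a b Ha Hb.
generalize (bl_lip _ _ _ _ _ HB a y). rewrite Rabs_minus_sym. intros.
apply Rabs_def2 in Hb. nra.
Qed.

(** T0 is 1/k-Lipschitz, so backward cones of slope k, wider than the characteristic ones, never
    leave the domain. *)
Lemma bl_backward y s y' s' :
  U y s -> Rabs (y - y') <= k * (s - s') -> U y' s'.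
Proof.
unfold U; intros. destruct (bl_k _ _ _ _ _ HB) as [Hk _].
generalize (bl_lip _ _ _ _ _ HB y' y). intros. nra.
Qed.

Lemma bl_below y s : Rabs y < k * (- s) -> U y s.
Proof.
unfold U; intros. destruct (bl_k _ _ _ _ _ HB) as [Hk _].
generalize (bl_lip _ _ _ _ _ HB y 0). rewrite (bl_T0 _ _ _ _ _ HB), Rabs_minus_sym, Rminus_0_r. nra.
Qed.

Lemma bl_u_pos y s : U y s -> 0 < u y s.
Proof. intros H. eapply Rlt_le_trans; [apply Rpower_pos | apply (bl_low _ _ _ _ _ HB y s H)]. Qed.

Lemma bl_C1 b : C1_on U (v b) (vy b) (vs b).
Proof.
intros y s H. destruct (bl_reg _ _ _ _ _ HB b y s H) as (d & Hd & D).
destruct (D y s) as (D1 & D2 & D3); try (rewrite Rminus_diag, Rabs_R0; auto).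
split; [|split; [|split]].
- apply (Derive_correct (fun y' => v b y' s)). apply (D1 0%nat 0%nat); lia.
- apply (Derive_correct (fun y' => v b y y')). apply (D2 0%nat); lia.
- apply cont2_continuity_2d, (D3 1%nat 0%nat); lia.
- apply cont2_continuity_2d, (D3 0%nat 1%nat); lia.
Qed.

Lemma bl_C1_vs b : C1_on U (vs b) (pd 1 1 (v b)) (pd 0 2 (v b)).
Proof.
intros y s H. destruct (bl_reg _ _ _ _ _ HB b y s H) as (d & Hd & D).
destruct (D y s) as (D1 & D2 & D3); try (rewrite Rminus_diag, Rabs_R0; auto).
split; [|split; [|split]].
- apply (Derive_correct (fun y' => vs b y' s)). apply (D1 0%nat 1%nat); lia.
- apply (Derive_correct (fun y' => vs b y y')). apply (D2 1%nat); lia.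
- apply cont2_continuity_2d, (D3 1%nat 1%nat); lia.
- apply cont2_continuity_2d, (D3 0%nat 2%nat); lia.
Qed.

Lemma bl_C1_u : C1_on U u (fun y s => vy false y s + vy true y s) (fun y s => vs false y s + vs true y s).
Proof.
intros y s H. destruct (C1_lincomb _ _ _ _ _ _ _ 1 1 (bl_C1 false) (bl_C1 true) y s H) as (A1 & A2 & A3 & A4).
unfold u. split; [|split; [|split]].
- evar_last. eapply is_derive_ext; [|apply A1]. intros; simpl; ring. simpl; ring.
- evar_last. eapply is_derive_ext; [|apply A2]. intros; simpl; ring. simpl; ring.
- eapply continuity_2d_pt_ext; [|apply A3]. intros; simpl; ring.
- eapply continuity_2d_pt_ext; [|apply A4]. intros; simpl; ring.
Qed.

Lemma bl_along b y s a c r :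
  U (y + a * r) (s + c * r) ->
  is_derive (fun r => v b (y + a * r) (s + c * r)) r
    (a * vy b (y + a * r) (s + c * r) + c * vs b (y + a * r) (s + c * r)).
Proof. apply (C1_along U bl_open), bl_C1. Qed.

Lemma U_near y s a c : U y s -> exists d, 0 < d /\ forall h, Rabs h < d -> U (y + a * h) (s + c * h).
Proof.
intros H. destruct (bl_open y s H) as [d Hd].
assert (Ha := Rabs_pos a). assert (Hc := Rabs_pos c).
exists (d / (1 + Rabs a + Rabs c)). split.
- apply Rdiv_lt_0_compat; [apply cond_pos | lra].
- intros h Hh. assert (E : Rabs h * (1 + Rabs a + Rabs c) < d) by (apply Rlt_div_r; lra).
  assert (Hh' := Rabs_pos h).
  apply Hd; [replace (y + a * h - y) with (a * h) by ring|replace (s + c * h - s) with (c * h) by ring];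
  rewrite Rabs_mult; nra.
Qed.

Lemma bl_along0 b y s a c :
  U y s -> is_derive (fun r => v b (y + a * r) (s + c * r)) 0 (a * vy b y s + c * vs b y s).
Proof.
intros H. assert (D := bl_along b y s a c 0).
rewrite !Rmult_0_r, !Rplus_0_r in D. auto.
Qed.

(** A forward increment is bounded below by the source at its starting point, a backward increment
    above by the source at its end point. Both points are (y, s), so the two bounds meet without any
    limit of the source. *)
Lemma bl_pde b y s : U y s -> vs b y s + dir b * vy b y s = src p (u y s).
Proof.
intros H. assert (D := bl_along0 b y s (dir b) 1 H).
destruct (U_near y s (dir b) 1 H) as (d & Hd & Hn).
assert (E1 : src p (u y s) <= dir b * vy b y s + 1 * vs b y s).
{ apply (derive_ge_of_increments _ _ _ _ _ D Hd). intros h Hh.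
  assert (Hh' : U (y + dir b * h) (s + 1 * h)) by (apply Hn; rewrite Rabs_pos_eq; lra).
  rewrite Rmult_1_l in Hh'.
  assert (B := bl_char _ _ _ _ _ HB b y s h (Rlt_le _ _ (proj1 Hh)) H Hh').
  rewrite Rplus_0_l, !Rmult_0_r, !Rplus_0_r, Rmult_1_l. apply B. }
assert (E2 : dir b * vy b y s + 1 * vs b y s <= src p (u y s)).
{ apply (derive_le_of_increments _ _ _ _ _ D Hd). intros h Hh.
  assert (Hh' : U (y + dir b * (- h)) (s + 1 * - h)) by (apply Hn; rewrite Rabs_Ropp, Rabs_pos_eq; lra).
  assert (B := bl_char _ _ _ _ _ HB b _ _ h (Rlt_le _ _ (proj1 Hh)) Hh').
  replace (y + dir b * - h + dir b * h) with y in B by ring.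
  replace (s + 1 * - h + h) with s in B by ring.
  rewrite !Rmult_0_r, !Rplus_0_r, !Rminus_0_l. apply B. exact H. }
lra.
Qed.

Lemma bl_slope b y s : U y s -> k * Rabs (vy b y s) <= vs b y s.
Proof.
intros H.
assert (E : forall a, Rabs a <= k -> 0 <= a * vy b y s + 1 * vs b y s).
{ intros a Ha. assert (D := bl_along0 b y s a 1 H).
  destruct (U_near y s a 1 H) as (d & Hd & Hn).
  apply (derive_ge_of_increments _ _ _ _ _ D Hd). intros h Hh.
  assert (Hh' : U (y + a * h) (s + 1 * h)) by (apply Hn; rewrite Rabs_pos_eq; lra).
  rewrite Rplus_0_l, !Rmult_0_r, !Rplus_0_r.
  assert (B := bl_mono _ _ _ _ _ HB b y s _ _ H Hh'). 
  cut (v b y s <= v b (y + a * h) (s + 1 * h)); [lra|]. apply B.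
  replace (y + a * h - y) with (a * h) by ring. rewrite Rabs_mult, (Rabs_pos_eq h) by lra. nra. }
destruct (bl_k _ _ _ _ _ HB) as [Hk _].
assert (E1 := E k). rewrite Rabs_pos_eq in E1 by lra. assert (E2 := E (- k)).
rewrite Rabs_Ropp, Rabs_pos_eq in E2 by lra.
unfold Rabs; destruct (Rcase_abs (vy b y s)); [specialize (E1 (Rle_refl _)) | specialize (E2 (Rle_refl _))]; lra.
Qed.

(** The equation reads [vs = src - dir b * vy], and |vy| <= vs / k by monotonicity. The second bound
    degenerates as k tends to 1. *)
Lemma bl_vs_bounds b y s : U y s ->
  src p (u y s) <= 2 * vs b y s /\ (k - 1) * vs b y s <= k * src p (u y s).
Proof.
intros H. generalize (bl_pde b y s H) (bl_slope b y s H).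
destruct (bl_k _ _ _ _ _ HB) as [Hk _].
assert (A := Rle_abs (vy b y s)). assert (B := Rle_abs (- vy b y s)). rewrite Rabs_Ropp in B.
assert (P := Rabs_pos (vy b y s)).
destruct b; simpl; intros; nra.
Qed.

Lemma src_pos x : 0 < src p x.
Proof. apply Rmult_lt_0_compat; apply Rpower_pos. Qed.

Lemma bl_vs_pos b y s : U y s -> 0 < vs b y s.
Proof. intros H. generalize (bl_vs_bounds b y s H) (src_pos (u y s)). lra. Qed.

Lemma is_derive_src x : 0 < x -> is_derive (src p) x (dsrc p x).
Proof. intros. apply (is_derive_scal (fun x => Rpower x p)). apply is_derive_Rpower; auto. Qed.

Lemma continuous_dsrc x : 0 < x -> continuous (dsrc p) x.
Proof.
intros. apply (ex_derive_continuous (dsrc p)). eexists. unfold dsrc.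
apply (is_derive_scal (fun x => p * Rpower x (p - 1))).
apply (is_derive_scal (fun x => Rpower x (p - 1))). apply is_derive_Rpower; auto.
Qed.

Let uy y s := vy false y s + vy true y s.
Let us y s := vs false y s + vs true y s.

Lemma bl_C1_src : C1_on U (fun y s => src p (u y s)) (fun y s => dsrc p (u y s) * uy y s)
   (fun y s => dsrc p (u y s) * us y s).
Proof.
apply (C1_comp U bl_open u uy us (src p) (dsrc p) bl_C1_u).
intros y s H. split; [apply is_derive_src | apply continuous_dsrc]; apply bl_u_pos; auto.
Qed.

(** [C3_at] gives s-derivatives only for the pure derivatives [pd 0 j]. The equation expresses [vy]
    through [src p u] and [vs], both already C1, and this supplies the derivative of [vy] in s. *)
Lemma bl_C1_vy b : C1_on U (vy b)
  (fun y s => dir b * (dsrc p (u y s) * uy y s - pd 1 1 (v b) y s))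
  (fun y s => dir b * (dsrc p (u y s) * us y s - pd 0 2 (v b) y s)).
Proof.
assert (E := C1_lincomb _ _ _ _ _ _ _ (dir b) (- dir b) bl_C1_src (bl_C1_vs b)).
intros y s H.
assert (E' : C1_on U (vy b) (fun y s => dir b * (dsrc p (u y s) * uy y s) + - dir b * pd 1 1 (v b) y s)
  (fun y s => dir b * (dsrc p (u y s) * us y s) + - dir b * pd 0 2 (v b) y s)).
{ apply (C1_ext U bl_open) with (2 := E). intros y' s' H'. simpl.
  rewrite <- (bl_pde b y' s' H'). generalize (dir_sqr b). intros Q.
  transitivity (dir b * dir b * vy b y' s'). ring. rewrite Q. ring. }
destruct (E' y s H) as (A1 & A2 & A3 & A4).
split; [|split; [|split]].
- evar_last. apply A1. simpl; ring.
- evar_last. apply A2. simpl; ring.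
- eapply continuity_2d_pt_ext; [|apply A3]. intros; simpl; ring.
- eapply continuity_2d_pt_ext; [|apply A4]. intros; simpl; ring.
Qed.

(** The left side differentiates first in s and then in y; the right side is the s-derivative of
    [vy] read off from the equation. Their equality is what closes the differentiated system. *)
Lemma bl_schwarz b y s : U y s ->
  pd 1 1 (v b) y s = dir b * (dsrc p (u y s) * us y s - pd 0 2 (v b) y s).
Proof.
intros H.
assert (Dm : forall y s, U y s -> Derive (fun z => Derive (fun t => v b t z) y) s =
   dir b * (dsrc p (u y s) * us y s - pd 0 2 (v b) y s)).
{ intros y' s' H'. apply is_derive_unique. apply (bl_C1_vy b y' s' H'). }
rewrite <- Dm by auto. apply (Schwarz (v b) y s).
- generalize (bl_open y s H). apply locally_2d_impl, locally_2d_forall.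
  intros y' s' H'. destruct (bl_C1 b y' s' H') as (A1 & A2 & _).
  destruct (bl_C1_vy b y' s' H') as (B1 & B2 & _).
  destruct (bl_C1_vs b y' s' H') as (C1 & C2 & _).
  split; [|split; [|split]]; eexists; eauto.
- apply (bl_C1_vs b y s H).
- eapply continuity_2d_pt_ext_loc; [|apply (bl_C1_vy b y s H)].
  generalize (bl_open y s H). apply locally_2d_impl, locally_2d_forall.
  intros y' s' H'. rewrite Dm; auto.
Qed.

(** * Directional derivatives and the linearised system *)

Definition grad (n1 n2 : R) b y s := n1 * vy b y s + n2 * vs b y s.

Lemma grad_C1 n1 n2 b : exists Gy Gs, C1_on U (grad n1 n2 b) Gy Gs.
Proof. do 2 eexists. exact (C1_lincomb _ _ _ _ _ _ _ n1 n2 (bl_C1_vy b) (bl_C1_vs b)). Qed.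

(** The coefficient is the same for both components and all directions, so every combination of d_y
    and d_s solves one and the same cooperative system. The second derivatives cancel through
    [bl_schwarz]. *)
Lemma grad_along n1 n2 b y s r :
  U (y + dir b * r) (s + 1 * r) ->
  is_derive (fun r => grad n1 n2 b (y + dir b * r) (s + 1 * r)) r
    (dsrc p (u (y + dir b * r) (s + 1 * r)) *
      (grad n1 n2 false (y + dir b * r) (s + 1 * r) + grad n1 n2 true (y + dir b * r) (s + 1 * r))).
Proof.
intros H. evar_last.
apply (C1_along U bl_open _ _ _ y s (dir b) 1 r
  (C1_lincomb _ _ _ _ _ _ _ n1 n2 (bl_C1_vy b) (bl_C1_vs b)) H).
simpl. assert (Q := dir_sqr b). assert (S := bl_schwarz b _ _ H).
set (y' := y + dir b * r) in *. set (s' := s + 1 * r) in *. unfold grad.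
fold (uy y' s') (us y' s').
rewrite S. unfold uy, us. destruct b; simpl; ring.
Qed.

(** * Two-sided bounds for u^(1-p) *)

Lemma Rpower_u_upper y s : U y s -> Rpower (u y s) (1 - p) <= C * (T0 y - s).
Proof.
intros H. assert (Hp := bl_p _ _ _ _ _ HB). assert (HC := bl_C _ _ _ _ _ HB).
assert (HT : 0 < C * (T0 y - s)) by (apply Rmult_lt_0_compat; auto; unfold U in H; lra).
rewrite <- (Rpower_1 (C * (T0 y - s))) by auto.
replace 1 with (- / (p - 1) * (1 - p)) at 2 by (field; lra).
rewrite <- Rpower_mult. apply Rpower_antitone. lra.
split. apply Rpower_pos. apply (bl_low _ _ _ _ _ HB y s H).
Qed.

(** Since [us] is at least the source, u^(1-p) decreases in s at rate at least (p - 1) 2^-p. As it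
    stays positive up to time T0 y, it cannot be smaller than this rate times the remaining time. *)
Lemma Rpower_u_lower y s : U y s -> (p - 1) * Rpower 2 (- p) * (T0 y - s) <= Rpower (u y s) (1 - p).
Proof.
intros H. assert (Hp := bl_p _ _ _ _ _ HB).
set (c0 := (p - 1) * Rpower 2 (- p)).
assert (Hc0 : 0 < c0). { apply Rmult_lt_0_compat. lra. apply Rpower_pos. }
assert (E : forall s', s <= s' < T0 y -> c0 * (s' - s) <= Rpower (u y s) (1 - p)).
{ intros s' Hs'.
  assert (M : - Rpower (u y s) (1 - p) - c0 * s <= - Rpower (u y s') (1 - p) - c0 * s').
  { apply (le_of_derive_nonneg (fun s => - Rpower (u y s) (1 - p) - c0 * s)
     (fun s => - (((1 - p) * Rpower (u y s) (1 - p - 1)) * us y s) - c0)).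
    lra.
    - intros x Hx. assert (Ux : U y x) by (unfold U; lra).
      apply (is_derive_minus (fun s => - Rpower (u y s) (1 - p)) (fun s => c0 * s) x
         (- (((1 - p) * Rpower (u y x) (1 - p - 1)) * us y x)) c0).
      + apply (is_derive_opp (fun s => Rpower (u y s) (1 - p))).
        rewrite Rmult_comm.
        apply (is_derive_comp (fun u => Rpower u (1 - p)) (fun s => u y s)).
        apply is_derive_Rpower, bl_u_pos; auto. apply (bl_C1_u y x Ux).
      + auto_derive; auto; ring.
    - intros x Hx. assert (Ux : U y x) by (unfold U; lra).
      assert (B1 := bl_vs_bounds false y x Ux). assert (B2 := bl_vs_bounds true y x Ux).
      assert (us y x >= src p (u y x)) by (unfold us; lra).
      assert (E : Rpower (u y x) (1 - p - 1) * src p (u y x) = Rpower 2 (- p)).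
      { unfold src. rewrite (Rmult_comm (Rpower 2 (- p))), <- Rmult_assoc, <- Rpower_plus.
        replace (1 - p - 1 + p) with 0 by ring. rewrite Rpower_O by (apply bl_u_pos; auto). ring. }
      assert (P := Rpower_pos (u y x) (1 - p - 1)).
      set (w := Rpower (u y x) (1 - p - 1)) in *. unfold c0. rewrite <- E.
      assert (0 <= (p - 1) * w * (us y x - src p (u y x))).
      { apply Rmult_le_pos; [apply Rmult_le_pos|]; lra. }
      lra. }
  generalize (Rpower_pos (u y s') (1 - p)). lra. }
apply Rnot_lt_le. intros Hlt.
set (w := Rpower (u y s) (1 - p)) in *.
assert (Hw : 0 < w) by apply Rpower_pos.
set (d := T0 y - s) in *. assert (0 < d) by (unfold d, U in *; lra).
assert (w / c0 < d) by (apply Rlt_div_l; lra).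
assert (0 < w / c0) by (apply Rdiv_lt_0_compat; auto).
(* A time before T0 y but after s + w / c0, when the decrease would have used up all of w. *)
specialize (E (s + (w / c0 + d) / 2)).
assert (c0 * (s + (w / c0 + d) / 2 - s) <= w) by (apply E; unfold d in *; lra).
replace (s + (w / c0 + d) / 2 - s) with ((w / c0 + d) / 2) in H3 by ring.
assert (w / c0 * c0 = w) by (field; lra). nra.
Qed.

Lemma dsrc_pos x : 0 < dsrc p x.
Proof.
assert (Hp := bl_p _ _ _ _ _ HB).
apply Rmult_lt_0_compat; [apply Rpower_pos|apply Rmult_lt_0_compat; [lra|apply Rpower_pos]].
Qed.

Lemma bl_T0_le y : T0 y <= Rabs y.
Proof.
destruct (bl_k _ _ _ _ _ HB) as [Hk _].
generalize (bl_lip _ _ _ _ _ HB 0 y). rewrite (bl_T0 _ _ _ _ _ HB), !Rminus_0_r.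
generalize (Rabs_pos y). nra.
Qed.

Let c1 := p * Rpower 2 (- p) / (5 * C).

Lemma c1_pos : 0 < c1.
Proof.
assert (Hp := bl_p _ _ _ _ _ HB). assert (HC := bl_C _ _ _ _ _ HB).
apply Rdiv_lt_0_compat. apply Rmult_lt_0_compat; [lra|apply Rpower_pos]. lra.
Qed.

(** N'(u) is p 2^-p divided by u^(1-p) <= C (T0 y - s), and T0 y <= |y|. The constant 5 belongs to
    the origin (0, -5 S) of the rays below; integrated over a characteristic of length S, the bound
    gives a gain independent of S. *)
Lemma dsrc_lower y s S : U y s -> Rabs y - s <= 5 * S -> c1 / S <= dsrc p (u y s).
Proof.
intros H HS. assert (Hp := bl_p _ _ _ _ _ HB). assert (HC := bl_C _ _ _ _ _ HB).
assert (B := Rpower_u_upper y s H). assert (T := bl_T0_le y).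
unfold U in H. assert (0 < S) by lra.
unfold dsrc. replace (p - 1) with (- (1 - p)) by ring. rewrite (Rpower_Ropp (u y s)).
set (w := Rpower (u y s) (1 - p)) in *. assert (0 < w) by apply Rpower_pos.
assert (w <= 5 * C * S) by nra.
replace (c1 / S) with (Rpower 2 (- p) * (p * / (5 * C * S))) by (unfold c1; field; lra).
apply Rmult_le_compat_l. left; apply Rpower_pos. apply Rmult_le_compat_l. lra.
apply Rinv_le_contravar; auto.
Qed.

Lemma backward_path b y s h r :
  0 <= r <= h -> U (y + dir b * h) (s + h) -> U (y + dir b * r) (s + r).
Proof.
intros Hr H. destruct (bl_k _ _ _ _ _ HB) as [Hk _].
apply (bl_backward _ _ _ _ H).
replace (y + dir b * h - (y + dir b * r)) with (dir b * (h - r)) by ring.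
rewrite Rabs_dir, Rabs_pos_eq by lra. nra.
Qed.

Lemma grad_step n1 n2 b y s h m :
  0 <= h -> U (y + dir b * h) (s + h) ->
  (forall r, 0 <= r <= h ->
     m <= dsrc p (u (y + dir b * r) (s + r)) *
          (grad n1 n2 false (y + dir b * r) (s + r) + grad n1 n2 true (y + dir b * r) (s + r))) ->
  grad n1 n2 b y s + m * h <= grad n1 n2 b (y + dir b * h) (s + h).
Proof.
intros Hh HU Hm.
assert (M := le_of_derive_nonneg (fun r => grad n1 n2 b (y + dir b * r) (s + 1 * r) - m * r)
  (fun r => dsrc p (u (y + dir b * r) (s + 1 * r)) *
      (grad n1 n2 false (y + dir b * r) (s + 1 * r) + grad n1 n2 true (y + dir b * r) (s + 1 * r)) - m) 0 h Hh).
cbv beta in M. rewrite !Rmult_0_r, !Rplus_0_r, !Rmult_1_l in M.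
cut (grad n1 n2 b y s - 0 <= grad n1 n2 b (y + dir b * h) (s + h) - m * h); [lra|]. apply M.
- intros r Hr. apply (is_derive_minus (fun r => grad n1 n2 b (y + dir b * r) (s + 1 * r)) (fun r => m * r) r).
  apply grad_along. rewrite Rmult_1_l. apply backward_path with h; auto.
  auto_derive; auto; ring.
- intros r Hr. rewrite Rmult_1_l. specialize (Hm r Hr). lra.
Qed.

Lemma grad_nondecr n1 n2 b y s h :
  (forall b y s, U y s -> 0 <= grad n1 n2 b y s) ->
  0 <= h -> U (y + dir b * h) (s + h) ->
  grad n1 n2 b y s <= grad n1 n2 b (y + dir b * h) (s + h).
Proof.
intros HG Hh HU. rewrite <- (Rplus_0_r (grad n1 n2 b y s)), <- (Rmult_0_l h).
apply grad_step; auto. intros r Hr.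
assert (Ur := backward_path b y s h r Hr HU).
apply Rmult_le_pos. left; apply dsrc_pos. apply Rplus_le_le_0_compat; auto.
Qed.

(** The ray [(x, -5 * S + x)] is a characteristic of psi. The characteristics of phi cross it, so
    values of the false component on it spread over a two-dimensional region. The range of x leaves
    room on both sides of [0, S]. *)
Lemma grad_ray_continuous n1 n2 S x : - S < x < 2 * S ->
  continuous (fun x => grad n1 n2 false x (-5 * S + x)) x.
Proof.
intros Hx. destruct (bl_k _ _ _ _ _ HB) as [Hk _].
assert (HU : U x (-5 * S + x)).
{ apply bl_below. apply Rabs_def1; nra. }
assert (HU' : U (0 + 1 * x) (-5 * S + 1 * x)) by (rewrite Rplus_0_l, Rmult_1_l; auto).
destruct (grad_C1 n1 n2 false) as (Gy & Gs & HG).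
assert (D := C1_along U bl_open _ _ _ 0 (-5 * S) 1 1 x HG HU').
apply (ex_derive_continuous (fun x => grad n1 n2 false x (-5 * S + x))).
eexists. eapply is_derive_ext; [|apply D]. intros t. cbv beta.
rewrite Rplus_0_l, Rmult_1_l. auto.
Qed.

(** u^p is the power -p / (p - 1) of u^(1-p), the quantity for which bounds linear in T0 y - s are
    available. *)
Lemma src_compare y s y' s' h : U y s -> U y' s' -> 0 < h ->
  Rpower (u y s) (1 - p) <= h * Rpower (u y' s') (1 - p) ->
  src p (u y' s') <= Rpower h (p / (p - 1)) * src p (u y s).
Proof.
intros H H' Hh HW. assert (Hp := bl_p _ _ _ _ _ HB).
assert (E : forall y s, U y s -> Rpower (Rpower (u y s) (1 - p)) (- (p / (p - 1))) = Rpower (u y s) p).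
{ intros y1 s1 H1. rewrite Rpower_mult. f_equal. field. lra. }
unfold src. rewrite <- (E y s H), <- (E y' s' H').
set (w := Rpower (u y s) (1 - p)) in *. set (w' := Rpower (u y' s') (1 - p)) in *.
assert (0 < w) by apply Rpower_pos. assert (0 < w') by apply Rpower_pos.
rewrite (Rmult_comm (Rpower h _)), Rmult_assoc.
apply Rmult_le_compat_l. left; apply Rpower_pos.
assert (A : Rpower (h * w') (- (p / (p - 1))) <= Rpower w (- (p / (p - 1)))).
{ apply Rpower_antitone; auto. cut (0 < p / (p - 1)); [lra|]. apply Rdiv_lt_0_compat; lra. }
rewrite <- Rpower_mult_distr in A by auto. rewrite (Rpower_Ropp h) in A.
assert (Q := Rpower_pos h (p / (p - 1))). set (hh := Rpower h (p / (p - 1))) in *.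
apply Rmult_le_compat_l with (r := hh) in A; [|lra].
rewrite <- Rmult_assoc, Rinv_r, Rmult_1_l in A by lra. lra.
Qed.

(* The integral of [grad n1 n2 false] over the initial ray is transported along the other family of
   characteristics, where it feeds [grad n1 n2 true]; the resulting two-dimensional lower bound for
   [grad n1 n2 true] feeds [grad n1 n2 false]. *)
Lemma harnack_slice : exists th, 0 < th /\ forall n1 n2 S a,
  (forall b y s, U y s -> 0 <= grad n1 n2 b y s) -> 0 < S -> 0 <= a ->
  a * RInt (fun x => grad 0 1 false x (-5 * S + x)) 0 S <=
    RInt (fun x => grad n1 n2 false x (-5 * S + x)) 0 S ->
  forall b y, Rabs y <= (1 + k) / 2 * S -> th * a * vs b y (- S) <= grad n1 n2 b y (- S).
Proof.
destruct (bl_k _ _ _ _ _ HB) as [Hk Hk2].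
assert (Hp := bl_p _ _ _ _ _ HB). assert (HC := bl_C _ _ _ _ _ HB).
assert (Hc1 := c1_pos).
set (c0 := (p - 1) * Rpower 2 (- p)).
assert (Hc0 : 0 < c0). { apply Rmult_lt_0_compat. lra. apply Rpower_pos. }
(* Half-width of the slice at time -S, in units of S. The choice r < k keeps the slice at least (1 -
   r / k) S below T0; r > 1 lets it contain the base of any backward characteristic cone once S is
   large. *)
set (r := (1 + k) / 2). assert (Hr : 1 < r < k) by (unfold r; lra).
assert (Hrk : r / k < 1) by (apply Rlt_div_l; lra).
(* Ratio of the upper bound 5 C S for u^(1-p) on the ray to its lower bound c0 (1 - r / k) S on the
   slice. *)
set (h := 5 * C / (c0 * (1 - r / k))).
assert (Hh : 0 < h). { apply Rdiv_lt_0_compat. lra. apply Rmult_lt_0_compat; lra. }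
(* Bounds [vs] on the slice by [vs] on the ray: k / (k - 1) passes from [vs] to the source, the
   power of h compares the sources, and 2 passes back to [vs]. *)
set (H := 2 * (k / (k - 1) * Rpower h (p / (p - 1)))).
assert (HH : 0 < H).
{ unfold H. apply Rmult_lt_0_compat. lra. apply Rmult_lt_0_compat. apply Rdiv_lt_0_compat; lra. apply Rpower_pos. }
exists (Rmin 1 c1 * (c1 / H)). split.
{ apply Rmult_lt_0_compat. apply Rmin_glb_lt; lra. apply Rdiv_lt_0_compat; lra. }
intros n1 n2 S a HG HS Ha HI b y Hy.
assert (Hy1 := Rle_abs y). assert (Hy2 := Rle_abs (- y)). rewrite Rabs_Ropp in Hy2.
assert (UP : U y (- S)). { apply bl_below. nra. }
assert (Hray : forall x, 0 <= x <= S -> U x (-5 * S + x)).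
{ intros x Hx. apply bl_below. apply Rabs_def1; nra. }
set (m := vs b y (- S) / H).
assert (Hm : forall x, 0 <= x <= S -> m <= grad 0 1 false x (-5 * S + x)).
{ intros x Hx. unfold grad. fold (vs false x (-5 * S + x)). rewrite Rmult_0_l, Rplus_0_l, Rmult_1_l.
  assert (Ux := Hray x Hx).
  assert (B1 := proj2 (bl_vs_bounds b y (- S) UP)).
  assert (B2 := proj1 (bl_vs_bounds false x _ Ux)).
  assert (W1 := Rpower_u_upper _ _ Ux). assert (W2 := Rpower_u_lower _ _ UP).
  assert (T1 := bl_T0_le x). rewrite Rabs_pos_eq in T1 by lra.
  assert (T2 := bl_lip _ _ _ _ _ HB y 0). rewrite (bl_T0 _ _ _ _ _ HB), Rabs_minus_sym, Rminus_0_r in T2.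
  assert (T3 : (1 - r / k) * S <= T0 y - - S).
  { assert (- (r / k * S) <= T0 y); [|lra].
    replace (r / k * S) with (r * S / k) by (field; lra).
    cut (r * S / k >= - T0 y); [lra|]. apply Rle_ge, Rle_div_r; lra. }
  assert (W3 : Rpower (u x (-5 * S + x)) (1 - p) <= h * Rpower (u y (- S)) (1 - p)).
  { apply Rle_trans with (5 * C * S). nra.
    apply Rle_trans with (h * (c0 * ((1 - r / k) * S))).
    - right. unfold h. field. lra.
    - apply Rmult_le_compat_l. lra. eapply Rle_trans; [|apply W2].
      fold c0. apply Rmult_le_compat_l. lra. apply T3. }
  assert (Sc := src_compare _ _ _ _ _ Ux UP Hh W3).
  unfold m. apply Rle_div_l; auto.
  assert (Hv : vs b y (- S) <= k / (k - 1) * src p (u y (- S))).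
  { replace (k / (k - 1) * src p (u y (- S))) with (k * src p (u y (- S)) / (k - 1)) by (field; lra).
    apply Rle_div_r; lra. }
  assert (Hkk : 0 < k / (k - 1)) by (apply Rdiv_lt_0_compat; lra).
  assert (Hpp := Rpower_pos h (p / (p - 1))).
  unfold H. set (hh := Rpower h _) in *. set (kk := k / (k - 1)) in *.
  assert (0 < kk * hh) by (apply Rmult_lt_0_compat; auto).
  assert (kk * src p (u y (- S)) <= kk * (hh * src p (u x (-5 * S + x)))) by (apply Rmult_le_compat_l; lra).
  nra. }
assert (Hm0 : 0 <= m).
{ unfold m. apply Rmult_le_pos. left; apply bl_vs_pos; auto. left; apply Rinv_0_lt_compat; auto. }
assert (Hint : m * S <= RInt (fun x => grad 0 1 false x (-5 * S + x)) 0 S).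
{ assert (E := RInt_const 0 S m). unfold scal in E; simpl in E; unfold mult in E; simpl in E.
  replace (m * S) with ((S - 0) * m) by ring. rewrite <- E.
  apply RInt_le. lra. apply ex_RInt_const.
  apply (ex_RInt_continuous (fun x => grad 0 1 false x (-5 * S + x))). intros z Hz.
  rewrite Rmin_left, Rmax_right in Hz by lra. apply grad_ray_continuous; lra.
  intros x Hx. apply Hm; lra. }
set (I := RInt (fun x => grad n1 n2 false x (-5 * S + x)) 0 S) in *.
assert (HIm : a * (m * S) <= I). { eapply Rle_trans; [|apply HI]. apply Rmult_le_compat_l; auto. }
(* Characteristic coordinates of the target seen from (0, -5 S): (y, -S) = (et - xi, -5 S + xi +
   et). Since k <= 2, |y| <= 3 S / 2, so both exceed S. *)
set (xi := (4 * S - y) / 2). set (et := (4 * S + y) / 2).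
assert (Hxi : S <= xi) by (unfold xi; nra). assert (Het : S <= et) by (unfold et; nra).
assert (HUU : forall x z, 0 <= x <= xi -> 0 <= z <= et -> U (z - x) (-5 * S + x + z)).
{ intros x z Hx Hz. apply (bl_backward _ _ _ _ UP).
  apply Rle_trans with (1 * (- S - (-5 * S + x + z))); unfold xi, et in *.
  rewrite Rmult_1_l; apply Rabs_le; lra. apply Rmult_le_compat_r; lra. }
assert (HD : forall x z, 0 <= x <= xi -> 0 <= z <= et -> c1 / S <= dsrc p (u (z - x) (-5 * S + x + z))).
{ intros x z Hx Hz. apply dsrc_lower. apply HUU; auto.
  unfold xi, et in *. assert (Rabs (z - x) <= x + z) by (apply Rabs_le; lra). lra. }
assert (HcS : 0 < c1 / S) by (apply Rdiv_lt_0_compat; auto).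
assert (Sa : forall x z, 0 <= x <= xi -> 0 <= z <= et ->
  grad n1 n2 false z (-5 * S + z) <= grad n1 n2 false (z - x) (-5 * S + x + z)).
{ intros x z Hx Hz. replace (z - x) with (z + dir false * x) by (simpl; ring).
  replace (-5 * S + x + z) with (-5 * S + z + x) by ring.
  apply grad_nondecr; auto. lra.
  replace (z + dir false * x) with (z - x) by (simpl; ring).
  replace (-5 * S + z + x) with (-5 * S + x + z) by ring. apply HUU; auto. }
(* While z runs over [0, S] the true component collects the false one, at rate at least c1 / S; by
   [Sa] the false component is no smaller than on the ray. The starting value is nonnegative and is
   dropped. *)
assert (Sb : forall x, 0 <= x <= xi -> c1 / S * I <= grad n1 n2 true (S - x) (-5 * S + x + S)).
{ intros x Hx.
  assert (M : RInt (fun z => c1 / S * grad n1 n2 false z (-5 * S + z)) 0 S <=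
     grad n1 n2 true (- x + dir true * S) (-5 * S + x + 1 * S) - grad n1 n2 true (- x + dir true * 0) (-5 * S + x + 1 * 0)).
  { apply (RInt_le_increment (fun z => grad n1 n2 true (- x + dir true * z) (-5 * S + x + 1 * z))
     (fun z => dsrc p (u (- x + dir true * z) (-5 * S + x + 1 * z)) *
       (grad n1 n2 false (- x + dir true * z) (-5 * S + x + 1 * z) +
        grad n1 n2 true (- x + dir true * z) (-5 * S + x + 1 * z)))
     (fun z => c1 / S * grad n1 n2 false z (-5 * S + z)) 0 S S); try lra.
    - intros z Hz. apply grad_along. simpl. rewrite !Rmult_1_l.
      replace (- x + z) with (z - x) by ring. apply HUU; lra.
    - intros z Hz. apply (continuous_mult (fun _ => c1 / S) (fun z => grad n1 n2 false z (-5 * S + z))).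
      apply continuous_const. apply grad_ray_continuous; lra.
    - intros z Hz. simpl. rewrite !Rmult_1_l. replace (- x + z) with (z - x) by ring.
      assert (Hz' : 0 <= z <= et) by lra.
      assert (V := HUU x z Hx Hz').
      apply Rmult_le_compat; try lra.
      + apply HG; auto.
      + apply HD; auto.
      + generalize (Sa x z Hx Hz') (HG true _ _ V). lra. }
  rewrite (RInt_scal (V := R_CompleteNormedModule)) in M.
  2:{ apply (ex_RInt_continuous (fun z => grad n1 n2 false z (-5 * S + z))). intros z Hz.
      rewrite Rmin_left, Rmax_right in Hz by lra. apply grad_ray_continuous; lra. }
  unfold scal in M; simpl in M; unfold mult in M; simpl in M. fold I in M.
  rewrite !Rmult_1_l, !Rplus_0_r in M. replace (- x + S) with (S - x) in M by ring.
  assert (V : U (- x) (-5 * S + x)).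
  { replace (- x) with (0 - x) by ring. rewrite <- (Rplus_0_r (-5 * S + x)). apply HUU; lra. }
  generalize (HG true _ _ V). lra. }
assert (Sc : forall x z, 0 <= x <= xi -> S <= z <= et -> c1 / S * I <= grad n1 n2 true (z - x) (-5 * S + x + z)).
{ intros x z Hx Hz. eapply Rle_trans; [apply (Sb x Hx)|].
  replace (z - x) with (S - x + dir true * (z - S)) by (simpl; ring).
  replace (-5 * S + x + z) with (-5 * S + x + S + (z - S)) by ring.
  apply grad_nondecr; auto. lra.
  replace (S - x + dir true * (z - S)) with (z - x) by (simpl; ring).
  replace (-5 * S + x + S + (z - S)) with (-5 * S + x + z) by ring. apply HUU; lra. }
assert (Hbeta : c1 * (a * m) <= c1 / S * I).
{ replace (c1 * (a * m)) with (c1 / S * (a * (m * S))) by (field; lra). apply Rmult_le_compat_l; lra. }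
set (be := c1 / S * I) in *.
assert (Ham : 0 <= a * m) by (apply Rmult_le_pos; auto).
assert (Hbe : 0 <= be) by (generalize (Rmult_le_pos _ _ (Rlt_le _ _ Hc1) Ham); lra).
(* Last leg, along z = et: the true component feeds the false one over a length xi >= S, which
   cancels the factor 1 / S. *)
assert (Sd : c1 * be <= grad n1 n2 false (et - xi) (-5 * S + xi + et)).
{ assert (M : grad n1 n2 false et (-5 * S + et) + c1 / S * be * xi <=
    grad n1 n2 false (et + dir false * xi) (-5 * S + et + xi)).
  { assert (EE : forall x, et + dir false * x = et - x) by (intros; simpl; ring).
    assert (EE2 : forall x, -5 * S + et + x = -5 * S + x + et) by (intros; ring).
    apply grad_step. lra. rewrite EE, EE2. apply HUU; lra.
    intros x Hx. rewrite EE, EE2. assert (Hz : 0 <= et <= et) by lra. assert (Hz' : S <= et <= et) by lra.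
    apply Rmult_le_compat; try lra. apply HD; auto.
    generalize (Sc x et Hx Hz') (HG false _ _ (HUU x et Hx Hz)). lra. }
  replace (et - xi) with (et + dir false * xi) by (simpl; ring).
  replace (-5 * S + xi + et) with (-5 * S + et + xi) by ring.
  assert (V : U et (-5 * S + et)).
  { replace et with (et - 0) at 1 by ring. replace (-5 * S + et) with (-5 * S + 0 + et) by ring. apply HUU; lra. }
  assert (G0 := HG false _ _ V).
  assert (c1 * be <= c1 / S * be * xi); [|lra].
  replace (c1 * be) with (c1 / S * be * S) by (field; lra).
  apply Rmult_le_compat_l; auto. apply Rmult_le_pos; lra. }
assert (Se := Sc xi et). 
replace (et - xi) with y in * by (unfold et, xi; field).
replace (-5 * S + xi + et) with (- S) in * by (unfold et, xi; field).
assert (Se' : be <= grad n1 n2 true y (- S)) by (apply Se; lra).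
assert (Fin : Rmin 1 c1 * be <= grad n1 n2 b y (- S)).
{ destruct b.
  - eapply Rle_trans; [|apply Se']. rewrite <- (Rmult_1_l be) at 2. apply Rmult_le_compat_r; auto. apply Rmin_l.
  - eapply Rle_trans; [|apply Sd]. apply Rmult_le_compat_r; auto. apply Rmin_r. }
eapply Rle_trans; [|apply Fin].
replace (Rmin 1 c1 * (c1 / H) * a * vs b y (- S)) with (Rmin 1 c1 * (c1 * (a * m))) by (unfold m; field; lra).
apply Rmult_le_compat_l; auto. apply Rmin_glb; lra.
Qed.

Lemma bl_u_mono y s y' s' : U y s -> U y' s' -> Rabs (y' - y) <= k * (s' - s) -> u y s <= u y' s'.
Proof. intros. apply Rplus_le_compat; apply (bl_mono _ _ _ _ _ HB); auto. Qed.

Lemma grad_shift n1 n2 b y s c : grad n1 (n2 - c) b y s = grad n1 n2 b y s - c * vs b y s.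
Proof. unfold grad, vs. ring. Qed.

(** Supplies the crude bound X of [linear_comparison] on a backward cone: both derivatives are
    controlled by the source, and the source by its value at the tip (y0, s0), because u is
    monotone. *)
Lemma grad_bound n1 n2 b y s y0 s0 : U y0 s0 -> U y s -> Rabs (y0 - y) <= k * (s0 - s) ->
  - ((Rabs n1 + Rabs n2) * (k / (k - 1) * src p (u y0 s0))) <= grad n1 n2 b y s.
Proof.
intros H0 H Hm. destruct (bl_k _ _ _ _ _ HB) as [Hk Hk2]. assert (Hp := bl_p _ _ _ _ _ HB).
assert (B := proj2 (bl_vs_bounds b y s H)). assert (Bs := bl_slope b y s H).
assert (Hs : src p (u y s) <= src p (u y0 s0)).
{ apply Rmult_le_compat_l. left; apply Rpower_pos. apply Rle_Rpower_l. lra.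
  split. apply bl_u_pos; auto. apply bl_u_mono; auto. }
set (M := k / (k - 1) * src p (u y0 s0)).
assert (HM : vs b y s <= M).
{ unfold M. replace (k / (k - 1) * src p (u y0 s0)) with (k * src p (u y0 s0) / (k - 1)) by (field; lra).
  apply Rle_div_r. lra. nra. }
assert (Hy : Rabs (vy b y s) <= M) by (generalize (Rabs_pos (vy b y s)); nra).
assert (Hv := bl_vs_pos b y s H).
unfold grad. fold (vy b y s) (vs b y s).
assert (E1 := Rabs_mult n1 (vy b y s)). assert (E2 := Rabs_mult n2 (vs b y s)).
rewrite (Rabs_pos_eq (vs b y s)) in E2 by lra.
assert (F1 := Rle_abs (- (n1 * vy b y s))). assert (F2 := Rle_abs (- (n2 * vs b y s))).
rewrite Rabs_Ropp in F1, F2. rewrite E1 in F1. rewrite E2 in F2.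
assert (Rabs n1 * Rabs (vy b y s) <= Rabs n1 * M) by (apply Rmult_le_compat_l; auto using Rabs_pos).
assert (Rabs n2 * vs b y s <= Rabs n2 * M) by (apply Rmult_le_compat_l; auto using Rabs_pos).
lra.
Qed.

(** The bound on the slice is a sign condition on [grad n1 (n2 - th * a)], which is again a
    solution, and [linear_comparison] carries the sign forward to the given point. As [th] does not
    depend on S, it is enough that the integral condition holds at arbitrarily large scales. *)
Lemma harnack_point : exists th, 0 < th /\ forall n1 n2 a,
  (forall b y s, U y s -> 0 <= grad n1 n2 b y s) -> 0 <= a ->
  (forall S0, exists S, S0 < S /\
    a * RInt (fun x => grad 0 1 false x (-5 * S + x)) 0 S <=
    RInt (fun x => grad n1 n2 false x (-5 * S + x)) 0 S) ->
  forall b y s, U y s -> th * a * vs b y s <= grad n1 n2 b y s.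
Proof.
destruct (bl_k _ _ _ _ _ HB) as [Hk Hk2]. assert (Hp := bl_p _ _ _ _ _ HB).
destruct harnack_slice as (th & Hth & HS). exists th. split; auto.
intros n1 n2 a HG Ha HI b y0 s0 H0.
assert (Py := Rabs_pos y0). assert (Ps := Rabs_pos s0).
(* S is so large that the base of the unit-speed cone of (y0, s0) at time -S, an interval of radius
   s0 + S around y0, lies in |y| <= (1 + k) / 2 * S. *)
destruct (HI (2 * (Rabs y0 + Rabs s0) / (k - 1))) as (S & HS0 & HI').
assert (HS1 : 2 * (Rabs y0 + Rabs s0) < S * (k - 1)) by (apply Rlt_div_l; lra).
assert (HS2 : 0 < S) by nra. assert (HS3 : Rabs s0 < S) by nra.
assert (Qs := Rle_abs s0). assert (Qs' := Rle_abs (- s0)). rewrite Rabs_Ropp in Qs'.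
set (n3 := n2 - th * a).
cut (0 <= grad n1 n3 b y0 s0); [unfold n3; rewrite grad_shift; lra|].
assert (HUc : forall y s, - S <= s /\ Rabs (y - y0) <= s0 - s -> U y s).
{ intros y s Hc. apply (bl_backward _ _ _ _ H0). rewrite Rabs_minus_sym.
  generalize (Rabs_pos (y - y0)). nra. }
apply (linear_comparison (grad n1 n3) (fun y s => dsrc p (u y s)) y0 s0 (- S) (dsrc p (u y0 s0))
  ((Rabs n1 + Rabs n3) * (k / (k - 1) * src p (u y0 s0)))).
- apply dsrc_pos.
- apply Rmult_le_pos. generalize (Rabs_pos n1) (Rabs_pos n3); lra.
  apply Rmult_le_pos; [|left; apply src_pos]. left; apply Rdiv_lt_0_compat; lra.
- intros y s Hc. split. left; apply dsrc_pos.
  assert (Uc := HUc y s Hc).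
  apply Rmult_le_compat_l. left; apply Rpower_pos. apply Rmult_le_compat_l. lra.
  apply Rle_Rpower_l. lra. split. apply bl_u_pos; auto.
  apply bl_u_mono; auto. rewrite Rabs_minus_sym. generalize (Rabs_pos (y - y0)). nra.
- intros b' y s r Hc. apply grad_along. apply HUc, Hc.
- intros b' y s Hc. apply grad_bound; auto.
  rewrite Rabs_minus_sym. generalize (Rabs_pos (y - y0)). nra.
- intros b' y [_ Hy]. unfold n3. rewrite grad_shift.
  cut (th * a * vs b' y (- S) <= grad n1 n2 b' y (- S)); [lra|].
  apply HS; auto. replace y with ((y - y0) + y0) by ring.
  eapply Rle_trans. apply Rabs_triang. lra.
- split; [lra|]. rewrite Rminus_diag, Rabs_R0; lra.
Qed.

(** Taken with sg = 1 and sg = -1, this gives the best lower and upper bounds for the ratio vy / vs.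
    The ratio is at most 1 / k in absolute value, whence the supremum exists and |m| < 1; it is
    admissible because the condition on m' is closed. *)
Lemma slope_lub (sg : R) : sg * sg = 1 -> exists m, -1 < m < 1 /\
  (forall b y s, U y s -> m * vs b y s <= sg * vy b y s) /\
  (forall m', (forall b y s, U y s -> m' * vs b y s <= sg * vy b y s) -> m' <= m).
Proof.
intros Hsg. destruct (bl_k _ _ _ _ _ HB) as [Hk Hk2].
assert (Asg : Rabs sg = 1).
{ assert (E := Rabs_pos sg). assert (Rabs sg * Rabs sg = 1). rewrite <- Rabs_mult, Hsg; apply Rabs_R1. nra. }
assert (Bd : forall b y s, U y s -> - vs b y s <= k * (sg * vy b y s) <= vs b y s).
{ intros b y s H. generalize (bl_slope b y s H). intros Q.
  replace (vy b y s) with (sg * (sg * vy b y s)) in Q by (rewrite <- Rmult_assoc, Hsg; ring).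
  rewrite Rabs_mult, Asg, Rmult_1_l in Q.
  assert (Q1 := Rle_abs (sg * vy b y s)). assert (Q2 := Rle_abs (- (sg * vy b y s))). rewrite Rabs_Ropp in Q2. nra. }
assert (U0 : U 0 (-1)) by (apply bl_below; rewrite Rabs_R0; lra).
destruct (completeness (fun m' => forall b y s, U y s -> m' * vs b y s <= sg * vy b y s)) as (m & Hub & Hlub).
- exists (/ k). intros m' Hm'. specialize (Hm' true _ _ U0). specialize (Bd true _ _ U0).
  assert (V := bl_vs_pos true _ _ U0). rewrite <- (Rmult_1_l (/ k)). apply Rle_div_r; nra.
- exists (- / k). intros b y s H. specialize (Bd b y s H).
  apply Rmult_le_reg_l with k. lra.
  replace (k * (- / k * vs b y s)) with (- vs b y s) by (field; lra). lra.
- exists m. split; [|split; auto].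
  + assert (L1 : - / k <= m).
    { apply Hub. intros b y s H. specialize (Bd b y s H).
      apply Rmult_le_reg_l with k. lra.
      replace (k * (- / k * vs b y s)) with (- vs b y s) by (field; lra). lra. }
    assert (L2 : m <= / k).
    { apply Hlub. intros m' Hm'. specialize (Hm' true _ _ U0). specialize (Bd true _ _ U0).
      assert (V := bl_vs_pos true _ _ U0). rewrite <- (Rmult_1_l (/ k)). apply Rle_div_r; nra. }
    assert (/ k < 1). { rewrite <- Rinv_1. apply Rinv_lt_contravar; lra. }
    lra.
  + intros b y s H. assert (V := bl_vs_pos b y s H).
    apply Rle_div_r; auto. apply Hlub. intros m' Hm'. apply Rle_div_r; auto.
Qed.

Lemma RInt_grad_lincomb n1 n2 m1 m2 S : 0 < S ->
  RInt (fun x => grad n1 n2 false x (-5 * S + x)) 0 S + RInt (fun x => grad m1 m2 false x (-5 * S + x)) 0 S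
  = RInt (fun x => grad (n1 + m1) (n2 + m2) false x (-5 * S + x)) 0 S.
Proof.
intros HS.
assert (E : forall n1 n2, ex_RInt (fun x => grad n1 n2 false x (-5 * S + x)) 0 S).
{ intros. apply (ex_RInt_continuous (fun x => grad n0 n3 false x (-5 * S + x))). intros z Hz.
  rewrite Rmin_left, Rmax_right in Hz by lra. apply grad_ray_continuous; lra. }
etransitivity; [symmetry; apply (RInt_plus (V := R_CompleteNormedModule)); apply E|].
apply RInt_ext. intros. unfold grad. simpl. unfold plus; simpl. ring.
Qed.

Lemma RInt_grad_scal c n1 n2 S : 0 < S ->
  RInt (fun x => grad (c * n1) (c * n2) false x (-5 * S + x)) 0 S
  = c * RInt (fun x => grad n1 n2 false x (-5 * S + x)) 0 S.
Proof.
intros HS.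
assert (E : ex_RInt (fun x => grad n1 n2 false x (-5 * S + x)) 0 S).
{ apply (ex_RInt_continuous (fun x => grad n1 n2 false x (-5 * S + x))). intros z Hz.
  rewrite Rmin_left, Rmax_right in Hz by lra. apply grad_ray_continuous; lra. }
etransitivity; [|apply (RInt_scal (V := R_CompleteNormedModule) _ 0 S c E)].
apply RInt_ext. intros. unfold grad. simpl. unfold scal; simpl; unfold mult; simpl. ring.
Qed.

(* If the best constants with [m vs <= vy <= M vs] were distinct, one of the two nonnegative
   solutions [vy - m vs], [M vs - vy] would carry half of the mass at arbitrarily large scales,
   and the Harnack inequality would improve the corresponding constant. *)
Lemma constant_slope : exists m, -1 < m < 1 /\ forall b y s, U y s -> vy b y s = m * vs b y s.
Proof.
destruct (slope_lub 1) as (m & Hm & Hlow & Hmax); [ring|].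
destruct (slope_lub (-1)) as (M & HM & Hup & Hmin); [ring|].
exists m. split; auto.
destruct (Rle_lt_dec (- M) m) as [Hle|Hlt].
{ intros b y s H. generalize (Hlow b y s H) (Hup b y s H) (bl_vs_pos b y s H). intros. nra. }
exfalso. destruct harnack_point as (th & Hth & HP).
(* Half the gap between the lower slope m and the upper slope -M. The two solutions below add up to
   2 a [vs], so on each ray one of them has at least a times the integral of [vs]. *)
set (a := (- M - m) / 2). assert (Ha : 0 < a) by (unfold a; lra).
assert (HS : forall S, 0 < S ->
   a * RInt (fun x => grad 0 1 false x (-5 * S + x)) 0 S <=
      RInt (fun x => grad 1 (- m) false x (-5 * S + x)) 0 S \/
   a * RInt (fun x => grad 0 1 false x (-5 * S + x)) 0 S <=
      RInt (fun x => grad (-1) (- M) false x (-5 * S + x)) 0 S).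
{ intros S HS. assert (E := RInt_grad_lincomb 1 (- m) (-1) (- M) S HS).
  replace (1 + -1) with ((2 * a) * 0) in E by ring. replace (- m + - M) with ((2 * a) * 1) in E by (unfold a; field).
  rewrite RInt_grad_scal in E by auto. lra. }
assert (N1 : forall b y s, U y s -> 0 <= grad 1 (- m) b y s).
{ intros b y s H. generalize (Hlow b y s H). unfold grad. fold (vy b y s) (vs b y s). lra. }
assert (N2 : forall b y s, U y s -> 0 <= grad (-1) (- M) b y s).
{ intros b y s H. generalize (Hup b y s H). unfold grad. fold (vy b y s) (vs b y s). lra. }
assert (Hta : 0 < th * a) by (apply Rmult_lt_0_compat; auto).
(* If the first solution is large only up to some scale S1, the second is large at every scale
   beyond S1. *)
destruct (classic (forall S0, exists S, S0 < S /\
    a * RInt (fun x => grad 0 1 false x (-5 * S + x)) 0 S <=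
    RInt (fun x => grad 1 (- m) false x (-5 * S + x)) 0 S)) as [Hf|Hf].
- assert (m + th * a <= m); [|lra]. apply Hmax. intros b y s H.
  generalize (HP 1 (- m) a N1 (Rlt_le _ _ Ha) Hf b y s H).
  unfold grad. fold (vy b y s) (vs b y s). lra.
- apply not_all_ex_not in Hf. destruct Hf as [S1 Hf].
  assert (Hf' : forall S0, exists S, S0 < S /\
    a * RInt (fun x => grad 0 1 false x (-5 * S + x)) 0 S <=
    RInt (fun x => grad (-1) (- M) false x (-5 * S + x)) 0 S).
  { intros S0. exists (Rmax 0 (Rmax S0 S1) + 1).
    assert (A1 := Rmax_l 0 (Rmax S0 S1)). assert (A2 := Rmax_r 0 (Rmax S0 S1)).
    assert (A3 := Rmax_l S0 S1). assert (A4 := Rmax_r S0 S1).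
    split. lra. destruct (HS (Rmax 0 (Rmax S0 S1) + 1)); [lra| |auto].
    exfalso. apply Hf. exists (Rmax 0 (Rmax S0 S1) + 1). split; auto. lra. }
  assert (M + th * a <= M); [|lra]. apply Hmin. intros b y s H.
  generalize (HP (-1) (- M) a N2 (Rlt_le _ _ Ha) Hf' b y s H).
  unfold grad. fold (vy b y s) (vs b y s). lra.
Qed.

(** Two points of the domain are joined by going down to a low level, across, and up again. The
    comparison points (0, s') may approach the origin or go to minus infinity, and both uses occur
    below. *)
Lemma C1_const F Fy Fs : C1_on U F Fy Fs ->
  (forall y s, U y s -> Fy y s = 0) -> (forall y s, U y s -> Fs y s = 0) ->
  forall y s s', U y s -> s' < 0 -> F y s = F 0 s'.
Proof.
intros HF Hy Hs. destruct (bl_k _ _ _ _ _ HB) as [Hk Hk2].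
assert (Z : forall f df x0 x1, (forall x, x0 <= x <= x1 -> is_derive f x (df x)) ->
  (forall x, x0 <= x <= x1 -> df x = 0) -> x0 <= x1 -> f x0 = f x1).
{ intros f df a b Hd H0 Hab. apply Rle_antisym.
  - apply (le_of_derive_nonneg f df); auto. intros x Hx; rewrite H0; auto; lra.
  - apply Ropp_le_cancel. apply (le_of_derive_nonneg (fun x => - f x) (fun x => - df x)); auto.
    + intros x Hx. apply (is_derive_opp f). auto.
    + intros x Hx; rewrite H0; auto; lra. }
assert (V : forall y s1 s2, s1 <= s2 -> U y s2 -> F y s1 = F y s2).
{ intros y s1 s2 H12 H2. apply Z with (fun x => Fs y x); auto.
  - intros x Hx. apply (HF y x). unfold U in *; lra.
  - intros x Hx. apply Hs. unfold U in *; lra. }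
assert (Hz : forall a b s, a <= b -> s < - Rabs a -> s < - Rabs b -> F a s = F b s).
{ intros a b s Hab Ha Hb. apply (Z (fun x => F x s) (fun x => Fy x s)); auto.
  - intros x Hx. apply (HF x s). apply bl_below. apply Rabs_def1; unfold Rabs in *; destruct (Rcase_abs a), (Rcase_abs b); nra.
  - intros x Hx. apply Hy. apply bl_below. apply Rabs_def1; unfold Rabs in *; destruct (Rcase_abs a), (Rcase_abs b); nra. }
intros y s s' H Hs'.
(* So low that the horizontal segment from 0 to y at this level lies in the domain by [bl_below]. *)
set (s1 := Rmin (- Rabs y - 1) (Rmin s s')).
assert (A1 : s1 <= - Rabs y - 1) by apply Rmin_l.
assert (A2 : s1 <= Rmin s s') by apply Rmin_r.
assert (A3 : Rmin s s' <= s) by apply Rmin_l. assert (A4 : Rmin s s' <= s') by apply Rmin_r.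
rewrite <- (V y s1 s) by (auto; lra).
rewrite <- (V 0 s1 s'); [|lra|apply bl_below; rewrite Rabs_R0; nra].
assert (P := Rabs_pos y).
destruct (Rle_lt_dec y 0).
- apply Hz; rewrite ?Rabs_R0; lra.
- symmetry; apply Hz; rewrite ?Rabs_R0; lra.
Qed.

(** With vy = m vs the equations become ordinary: [vs] is a constant multiple of the source, so
    u^(1-p) has the constant gradient -K (m, 1). Its additive constant is fixed near the origin,
    that of v b minus its share of u at s = minus infinity. *)
Theorem blowup_limit_self_similar : exists alpha, -1 < alpha < 1 /\
  (forall y, T0 y = alpha * y) /\
  (forall y s, s < T0 y -> v false y s = Vphi p alpha y s /\ v true y s = Vpsi p alpha y s).
Proof.
destruct constant_slope as (m & Hm & Hslope).
destruct (bl_k _ _ _ _ _ HB) as [Hk Hk2]. assert (Hp := bl_p _ _ _ _ _ HB). assert (HC := bl_C _ _ _ _ _ HB).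
exists (- m). split; [lra|].
assert (Hm2 : 0 < 1 - m ^ 2) by nra.
assert (Hvs : forall b y s, U y s -> vs b y s = src p (u y s) * ((1 - dir b * m) / (1 - m ^ 2))).
{ intros b y s H. rewrite <- (bl_pde b y s H), (Hslope b y s H).
  destruct b; simpl; field; nra. }
assert (Hus : forall y s, U y s -> us y s = src p (u y s) * (2 / (1 - m ^ 2))).
{ intros y s H. unfold us. rewrite !Hvs by auto. simpl. field. lra. }
assert (Huy : forall y s, U y s -> uy y s = m * us y s).
{ intros y s H. unfold uy, us. rewrite !Hslope by auto. ring. }
set (K := (p - 1) * Rpower 2 (- p) * (2 / (1 - m ^ 2))).
assert (HK : 0 < K).
{ unfold K. apply Rmult_lt_0_compat; [apply Rmult_lt_0_compat; [lra|apply Rpower_pos]|apply Rdiv_lt_0_compat; lra]. }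
assert (HWs : forall y s, U y s -> (1 - p) * Rpower (u y s) (1 - p - 1) * us y s = - K).
{ intros y s H. rewrite Hus by auto. unfold K, src.
  assert (E : Rpower (u y s) (1 - p - 1) * Rpower (u y s) p = 1).
  { rewrite <- Rpower_plus. replace (1 - p - 1 + p) with 0 by ring. apply Rpower_O, bl_u_pos; auto. }
  transitivity ((1 - p) * (Rpower (u y s) (1 - p - 1) * Rpower (u y s) p) * Rpower 2 (- p) * (2 / (1 - m ^ 2))).
  ring. rewrite E. ring. }
assert (HW1 : C1_on U (fun y s => Rpower (u y s) (1 - p))
   (fun y s => (1 - p) * Rpower (u y s) (1 - p - 1) * uy y s)
   (fun y s => (1 - p) * Rpower (u y s) (1 - p - 1) * us y s)).
{ apply (C1_comp U bl_open u uy us (fun u => Rpower u (1 - p)) (fun u => (1 - p) * Rpower u (1 - p - 1)) bl_C1_u).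
  intros y s H. assert (P := bl_u_pos y s H). split. apply is_derive_Rpower; auto.
  apply (continuous_mult (fun _ => 1 - p) (fun u => Rpower u (1 - p - 1))).
  apply continuous_const. apply continuous_Rpower; auto. }
assert (Hlin : C1_on U (fun y s => s + m * y) (fun y s => m) (fun y s => 1)).
{ intros y s H. split; [|split; [|split]]; auto using continuity_2d_pt_const; auto_derive; auto; ring. }
assert (HZ := C1_lincomb _ _ _ _ _ _ _ 1 K HW1 Hlin).
assert (HZc := C1_const _ _ _ HZ).
assert (HW : forall y s, U y s -> Rpower (u y s) (1 - p) = K * (- m * y - s)).
{ intros y s H.
  assert (E : forall s', s' < 0 -> 1 * Rpower (u y s) (1 - p) + K * (s + m * y) =
     1 * Rpower (u 0 s') (1 - p) + K * (s' + m * 0)).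
  { intros s' Hs'. apply HZc; auto; clear y s H; intros y s H.
    - rewrite Huy by auto. transitivity (m * ((1 - p) * Rpower (u y s) (1 - p - 1) * us y s) + K * m). ring.
      rewrite HWs by auto. ring.
    - rewrite HWs by auto. ring. }
  set (z := 1 * Rpower (u y s) (1 - p) + K * (s + m * y)) in *.
  assert (Hz : z = 0); [|unfold z in Hz; lra].
  (* Evaluation at (0, -t), where u^(1-p) lies between 0 and C t because T0 0 = 0; letting t tend to
     0 forces z = 0. *)
  assert (B : forall t, 0 < t -> - (K * t) <= z <= C * t).
  { intros t Ht. assert (U0 : U 0 (- t)) by (apply bl_below; rewrite Rabs_R0; nra).
    rewrite (E (- t)) by lra. generalize (Rpower_u_upper 0 (- t) U0) (Rpower_pos (u 0 (- t)) (1 - p)).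
    rewrite (bl_T0 _ _ _ _ _ HB). generalize (Rmult_lt_0_compat _ _ HK Ht). lra. }
  apply Rle_antisym; apply Rnot_lt_le; intros Hn.
  - specialize (B (z / (2 * C))). assert (0 < z / (2 * C)) by (apply Rdiv_lt_0_compat; lra).
    destruct (B H0) as [_ B2]. replace (C * (z / (2 * C))) with (z / 2) in B2 by (field; lra). lra.
  - specialize (B (- z / (2 * K))). assert (0 < - z / (2 * K)) by (apply Rdiv_lt_0_compat; lra).
    destruct (B H0) as [B2 _]. replace (K * (- z / (2 * K))) with (- z / 2) in B2 by (field; lra). lra. }
(* If T0 y exceeded -m y, u^(1-p) would become nonpositive below the graph. If T0 y were smaller,
   u^(1-p) would stay away from 0 at the graph, against its upper bound C (T0 y - s). *)
assert (HT : forall y, T0 y = - m * y).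
{ intros y. apply Rle_antisym; apply Rnot_lt_le; intros Hn.
  - assert (H : U y ((T0 y + - m * y) / 2)) by (unfold U; lra).
    assert (E := HW _ _ H). assert (P := Rpower_pos (u y ((T0 y + - m * y) / 2)) (1 - p)). nra.
  - set (d := - m * y - T0 y). assert (Hd : 0 < d) by (unfold d; lra).
    assert (Ht : 0 < K * d / (2 * C)) by (apply Rdiv_lt_0_compat; nra).
    assert (H : U y (T0 y - K * d / (2 * C))) by (unfold U; lra).
    assert (E := HW _ _ H). assert (B := Rpower_u_upper _ _ H).
    rewrite E in B. replace (C * (T0 y - (T0 y - K * d / (2 * C)))) with (K * d / 2) in B by (field; lra).
    assert (K * (- m * y - (T0 y - K * d / (2 * C))) = K * d + K * (K * d / (2 * C))) by (unfold d; ring).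
    assert (0 < K * (K * d / (2 * C))) by (apply Rmult_lt_0_compat; auto). nra. }
split; auto.
assert (HKA : Aconst p (- m) = Rpower K (- / (p - 1))).
{ unfold Aconst.
  transitivity (Rpower (Rpower K (- (1))) (/ (p - 1))).
  - f_equal. rewrite Rpower_Ropp, Rpower_1 by auto. unfold K.
    replace (- p) with (- (p - 1) + - (1)) by ring. rewrite Rpower_plus, (Rpower_Ropp 2 (p - 1)), (Rpower_Ropp 2 1), Rpower_1 by lra.
    assert (P := Rpower_pos 2 (p - 1)). field. nra.
  - rewrite Rpower_mult. f_equal. field. lra. }
assert (Hu : forall y s, U y s -> u y s = Rpower K (- / (p - 1)) * Rpower (- m * y - s) (- / (p - 1))).
{ intros y s H. assert (0 < - m * y - s) by (unfold U in H; rewrite HT in H; lra).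
  rewrite Rpower_mult_distr, <- HW, Rpower_mult by auto.
  replace ((1 - p) * - / (p - 1)) with 1 by (field; lra). rewrite Rpower_1; auto. apply bl_u_pos; auto. }
(* v b and (1 - dir b m) / 2 times u have the same gradient; their constant difference is 0 because
   both vanish as s' tends to minus infinity. *)
assert (Hsmall : forall eps, 0 < eps -> exists s', s' < 0 /\ u 0 s' < eps).
{ intros eps He. assert (P := Rpower_pos (eps / 2) (1 - p)).
  exists (- (Rpower (eps / 2) (1 - p) / K)).
  assert (0 < Rpower (eps / 2) (1 - p) / K) by (apply Rdiv_lt_0_compat; auto).
  split. lra. rewrite Hu by (apply bl_below; rewrite Rabs_R0; nra).
  rewrite Rpower_mult_distr by lra.
  replace (K * (- m * 0 - - (Rpower (eps / 2) (1 - p) / K))) with (Rpower (eps / 2) (1 - p)) by (field; lra).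
  rewrite Rpower_mult. replace ((1 - p) * - / (p - 1)) with 1 by (field; lra). rewrite Rpower_1; lra. }
assert (Hv : forall b y s, U y s -> v b y s = (1 - dir b * m) / 2 * u y s).
{ intros b y s H. set (c := (1 - dir b * m) / 2). assert (Hc : 0 <= c <= 1) by (unfold c; destruct b; simpl; lra).
  assert (HF := C1_lincomb _ _ _ _ _ _ _ 1 (- c) (bl_C1 b) bl_C1_u).
  assert (Hs0 : forall y s, U y s -> vs b y s - c * us y s = 0).
  { intros y' s' H'. rewrite Hvs, Hus by auto. unfold c. field. lra. }
  assert (HFc := C1_const _ _ _ HF).
  assert (E : forall s', s' < 0 -> 1 * v b y s + - c * u y s = 1 * v b 0 s' + - c * u 0 s').
  { intros s' Hs'. apply HFc; auto; intros y' s'' H'; assert (Q := Hs0 y' s'' H').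
    - rewrite Hslope by auto. fold (uy y' s''). rewrite Huy by auto.
      transitivity (m * (vs b y' s'' - c * us y' s'')). ring. rewrite Q. ring.
    - fold (us y' s''). lra. }
  set (z := 1 * v b y s + - c * u y s) in *.
  assert (Hz : Rabs z = 0).
  { apply Rle_antisym; [|apply Rabs_pos]. apply Rnot_lt_le. intros Hn.
    destruct (Hsmall _ Hn) as (s' & Hs' & Hs''). assert (U0 : U 0 s') by (apply bl_below; rewrite Rabs_R0; nra).
    specialize (E s' Hs'). assert (P := bl_u_pos 0 s' U0).
    assert (P1 := bl_pos _ _ _ _ _ HB false 0 s' U0). assert (P2 := bl_pos _ _ _ _ _ HB true 0 s' U0).
    assert (P3 : 0 <= v b 0 s' <= u 0 s') by (unfold u; destruct b; lra).
    assert (Rabs z <= u 0 s'); [|lra]. rewrite E. apply Rabs_le. nra. }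
  assert (z = 0) by (destruct (Req_dec z 0); auto; apply Rabs_no_R0 in H0; lra).
  unfold z in H0. lra. }
intros y s H. split.
- rewrite Hv, Hu by auto. unfold Vphi. rewrite HKA. simpl. field.
- rewrite Hv, Hu by auto. unfold Vpsi. rewrite HKA. simpl. field.
Qed.

End BlowupLimit.

(** * The iteration and its blow-up curve *)

Lemma abs_RInt_le_const_swap (h : R -> R) a b M :
  (forall t, Rmin a b <= t <= Rmax a b -> continuous h t) ->
  (forall t, Rmin a b <= t <= Rmax a b -> Rabs (h t) <= M) ->
  Rabs (RInt h a b) <= M * Rabs (b - a).
Proof.
intros Hc HM. assert (E : ex_RInt h a b) by (apply (ex_RInt_continuous h); auto).
destruct (Rle_lt_dec a b) as [Hab|Hab].
- rewrite Rmin_left, Rmax_right in HM by lra. rewrite (Rabs_pos_eq (b - a)), Rmult_comm by lra.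
  apply abs_RInt_le_const; auto.
- rewrite Rmin_right, Rmax_left in HM by lra.
  rewrite <- (opp_RInt_swap h b a) by (apply ex_RInt_swap; auto).
  unfold opp; simpl. rewrite Rabs_Ropp, (Rabs_left (b - a)), Rmult_comm by lra.
  replace (- (b - a)) with (a - b) by ring.
  apply abs_RInt_le_const; auto. lra. apply ex_RInt_swap; auto.
Qed.

Lemma continuity_2d_snd h c s : continuity_2d_pt h c s -> continuous (h c) s.
Proof.
intros H. apply continuity_pt_filterlim. intros eps He.
destruct (H (mkposreal _ He)) as [d Hd]. exists d. split. apply cond_pos.
intros x [_ Hx]. apply Hd. rewrite Rminus_diag, Rabs_R0; apply cond_pos. auto.
Qed.

(** The integral is split at t0: the piece over [t0, t] is short, and on [0, t0] the integrands are
    close by uniform continuity on a compact rectangle. The sign of t0 is free, hence [Rmin] and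
    [Rmax]. *)
Lemma continuity_2d_RInt (h : R -> R -> R) c0 t0 d :
  0 < d ->
  (forall c s, Rabs (c - c0) <= d -> Rmin 0 t0 - d <= s <= Rmax 0 t0 + d -> continuity_2d_pt h c s) ->
  continuity_2d_pt (fun c t => RInt (h c) 0 t) c0 t0.
Proof.
intros Hd Hh eps.
assert (He := cond_pos eps).
assert (P0 := Rabs_pos t0).
set (e1 := Rmin 1 (eps / (4 * (Rabs t0 + 1)))).
assert (He1 : 0 < e1).
{ apply Rmin_glb_lt. lra. apply Rdiv_lt_0_compat; lra. }
destruct (uniform_continuity_2d h (c0 - d) (c0 + d) (Rmin 0 t0 - d) (Rmax 0 t0 + d)) with (eps := mkposreal _ He1)
  as [del Hdel].
{ intros x y Hx Hy. apply Hh; auto. apply Rabs_le; lra. }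
simpl in Hdel. assert (Hdp := cond_pos del).
set (B := Rabs (h c0 t0) + 1). assert (HB : 1 <= B) by (unfold B; generalize (Rabs_pos (h c0 t0)); lra).
set (e2 := Rmin (Rmin d del) (eps / (4 * B))).
assert (He2 : 0 < e2).
{ apply Rmin_glb_lt. apply Rmin_glb_lt; auto. apply Rdiv_lt_0_compat; lra. }
assert (E2a : e2 <= d) by (eapply Rle_trans; [apply Rmin_l|apply Rmin_l]).
assert (E2b : e2 <= del) by (eapply Rle_trans; [apply Rmin_l|apply Rmin_r]).
assert (E2c : e2 <= eps / (4 * B)) by apply Rmin_r.
assert (E1a : e1 <= 1) by apply Rmin_l. assert (E1b : e1 <= eps / (4 * (Rabs t0 + 1))) by apply Rmin_r.
exists (mkposreal _ He2). simpl. intros c t Hc Ht. apply Rabs_def2 in Ht.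
assert (Hc2 := Rabs_def2 _ _ Hc).
assert (M1 := Rmin_l 0 t0). assert (M2 := Rmin_r 0 t0). assert (M3 := Rmax_l 0 t0). assert (M4 := Rmax_r 0 t0).
assert (Cs : forall c s, Rabs (c - c0) <= d -> Rmin 0 t0 - d <= s <= Rmax 0 t0 + d -> continuous (h c) s).
{ intros; apply continuity_2d_snd; auto. }
assert (Hin0 : forall s, Rmin 0 t0 <= s <= Rmax 0 t0 -> Rmin 0 t0 - d <= s <= Rmax 0 t0 + d) by (intros; lra).
assert (Hin1 : forall s, Rmin t0 t <= s <= Rmax t0 t -> Rabs (s - t0) < e2).
{ intros s Hs. apply Rabs_def1; unfold Rmin, Rmax in Hs; destruct (Rle_dec t0 t); lra. }
assert (Hc0 : Rabs (c0 - c0) <= d) by (rewrite Rminus_diag, Rabs_R0; lra).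
assert (Hcd : Rabs (c - c0) <= d) by lra.
assert (X1 : ex_RInt (h c) 0 t0) by (apply (ex_RInt_continuous (h c)); intros; apply Cs; auto).
assert (X0 : ex_RInt (h c0) 0 t0) by (apply (ex_RInt_continuous (h c0)); intros; apply Cs; auto).
assert (Hin2 : forall s, Rmin t0 t <= s <= Rmax t0 t -> Rmin 0 t0 - d <= s <= Rmax 0 t0 + d).
{ intros s Hs. specialize (Hin1 s Hs). apply Rabs_def2 in Hin1. lra. }
assert (X2 : ex_RInt (h c) t0 t) by (apply (ex_RInt_continuous (h c)); intros; apply Cs; auto).
rewrite <- (RInt_Chasles (h c) 0 t0 t X1 X2). unfold plus; simpl.
replace (RInt (h c) 0 t0 + RInt (h c) t0 t - RInt (h c0) 0 t0) with
  (RInt (h c) t0 t + (RInt (h c) 0 t0 - RInt (h c0) 0 t0)) by ring.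
assert (Y1 : Rabs (RInt (h c) t0 t) <= B * Rabs (t - t0)).
{ apply abs_RInt_le_const_swap. intros; apply Cs; auto.
  intros s Hs. replace (h c s) with ((h c s - h c0 t0) + h c0 t0) by ring.
  eapply Rle_trans. apply Rabs_triang. unfold B.
  cut (Rabs (h c s - h c0 t0) < e1); [lra|].
  assert (Q := Hin1 s Hs). assert (Q2 := Hin2 s Hs). apply Hdel; try lra. }
assert (Y2 : Rabs (RInt (h c) 0 t0 - RInt (h c0) 0 t0) <= e1 * Rabs (t0 - 0)).
{ assert (E := RInt_minus (V := R_CompleteNormedModule) _ _ 0 t0 X1 X0). unfold minus, plus, opp in E; simpl in E.
  unfold Rminus. rewrite <- E. apply abs_RInt_le_const_swap.
  - intros s Hs. apply (continuous_minus (h c) (h c0)); apply Cs; auto.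
  - intros s Hs. left. specialize (Hin0 s Hs). apply Hdel; try lra. rewrite Rminus_diag, Rabs_R0; auto. }
rewrite Rminus_0_r in Y2.
eapply Rle_lt_trans. apply Rabs_triang.
assert (Z1 : B * Rabs (t - t0) <= eps / 4).
{ replace (eps / 4) with (B * (eps / (4 * B))) by (field; lra). apply Rmult_le_compat_l. lra.
  apply Rabs_le; lra. }
assert (Z2 : e1 * Rabs t0 <= eps / 4).
{ replace (eps / 4) with (eps / (4 * (Rabs t0 + 1)) * (Rabs t0 + 1)) by (field; lra).
  apply Rmult_le_compat; lra. }
lra.
Qed.

Lemma continuity_2d_lin (h : R -> R -> R) a b x t :
  continuity_2d_pt h (a * x + b * t) t -> continuity_2d_pt (fun x t => h (a * x + b * t) t) x t.
Proof.
intros H eps. destruct (H eps) as [d Hd].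
assert (Pa := Rabs_pos a). assert (Pb := Rabs_pos b). assert (Pd := cond_pos d).
assert (Q : 0 < d / (1 + Rabs a + Rabs b)) by (apply Rdiv_lt_0_compat; lra).
exists (mkposreal _ Q). simpl. intros u v Hu Hv.
apply Rlt_div_r in Hu; [|lra]. apply Rlt_div_r in Hv; [|lra].
assert (Pu := Rabs_pos (u - x)). assert (Pv := Rabs_pos (v - t)).
apply Hd; [|nra].
replace (a * u + b * v - (a * x + b * t)) with (a * (u - x) + b * (v - t)) by ring.
eapply Rle_lt_trans. apply Rabs_triang. rewrite !Rabs_mult.
destruct (Rle_lt_dec (Rabs (u - x)) (Rabs (v - t))); nra.
Qed.

Lemma continuous_rpow_abs p x : 0 < p -> continuous (fun u => rpow (Rabs u) p) x.
Proof.
intros Hp. destruct (Req_dec x 0) as [->|Hx].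
- apply continuity_pt_filterlim. intros eps He.
  exists (Rpower eps (/ p)). split. apply Rpower_pos.
  intros y [_ Hy]. simpl in *. unfold Rdist in *. rewrite Rabs_R0. rewrite Rminus_0_r in Hy.
  unfold rpow. destruct (Rlt_dec 0 0); [lra|]. rewrite Rminus_0_r.
  destruct (Rlt_dec 0 (Rabs y)); [|rewrite Rabs_R0; auto].
  rewrite Rabs_pos_eq by (left; apply Rpower_pos).
  rewrite <- (Rpower_1 eps) by auto. replace 1 with (/ p * p) by (field; lra).
  rewrite <- Rpower_mult. apply Rlt_Rpower_l; auto.
- assert (Px : 0 < Rabs x) by (apply Rabs_pos_lt; auto).
  apply (continuous_ext_loc _ (fun u => Rpower (Rabs u) p)).
  + exists (mkposreal _ Px). intros y Hy. unfold rpow. destruct (Rlt_dec 0 (Rabs y)); auto.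
    exfalso. unfold ball in Hy; simpl in Hy; unfold AbsRing_ball, abs, minus, plus, opp in Hy; simpl in Hy.
    assert (Rabs y = 0) by (generalize (Rabs_pos y); lra).
    assert (Rabs x <= Rabs (y + - x) + Rabs y).
    { replace x with (- (y + - x) + y) at 1 by ring. eapply Rle_trans. apply Rabs_triang. rewrite Rabs_Ropp; lra. }
    lra.
  + apply (continuous_comp Rabs (fun u => Rpower u p)). apply continuous_Rabs.
    apply continuous_Rpower; auto.
Qed.

Section Iterates.
Variables (p mu g1 g2 rho k : R) (f g : R -> R).

Definition dat (b : bool) : R -> R := if b then g else f.
Definition gam (b : bool) : R := if b then g2 else g1.
Definition iter (b : bool) (n : nat) : R -> R -> R :=
  if b then snd (iterates p mu g1 g2 f g n) else fst (iterates p mu g1 g2 f g n).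
Definition isum n x t := iter false n x t + iter true n x t.
Definition inl n x t := Nl p mu (isum n x t) t.

(** One formula for both components. Later arguments fix the foot c = x - dir b t and let r vary
    along the characteristic [c + dir b * r]. *)
Lemma iter_S b n x t :
  iter b (S n) x t = dat b (x - dir b * t) + RInt (fun s => inl n (x - dir b * t + dir b * s) s) 0 t.
Proof.
unfold inl, isum, iter, dat. cbn [iterates]. destruct (iterates p mu g1 g2 f g n) as [ph ps].
destruct b; simpl; f_equal; try (f_equal; ring); apply RInt_ext; intros s _.
- replace (x - 1 * t + 1 * s) with (x - t + s) by ring. auto.
- replace (x - -1 * t + -1 * s) with (x + t - s) by ring. auto.
Qed.

Hypothesis Hp : 1 < p.
Hypothesis Hmu : 0 < mu.
Hypothesis Hg1 : 0 < g1.
Hypothesis Hg2 : 0 < g2.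
Hypothesis Hbig : g1 + g2 > Rmax 1 (Rpower (mu * p * Rpower 2 p) (/ (p - 1))).
Hypothesis Hk : 1 < k.
Hypothesis Hlow : forall b x, Rabs x < rho -> gam b <= dat b x.
(** (A4) in integrated form; 1 + k is the largest relative speed between a characteristic and a
    direction (c, 1) with |c| <= k. *)
Hypothesis Hlip : forall b x x', Rabs x < rho -> Rabs x' < rho ->
  (1 + k) * Rabs (dat b x' - dat b x) <= Nl p mu (g1 + g2) 0 * Rabs (x' - x).

Let gm := g1 + g2.

(** * Monotonicity of the damped nonlinearity *)

Lemma gm_gt_1 : 1 < gm.
Proof. unfold gm. generalize (Rmax_l 1 (Rpower (mu * p * Rpower 2 p) (/ (p - 1)))). lra. Qed.

Lemma gm_power : mu * p * Rpower 2 p < Rpower gm (p - 1).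
Proof.
assert (P : 0 < mu * p * Rpower 2 p).
{ apply Rmult_lt_0_compat; [nra|apply Rpower_pos]. }
rewrite <- (Rpower_inv_exp (mu * p * Rpower 2 p) (/ (p - 1))) by (auto; apply Rinv_neq_0_compat; lra).
rewrite Rinv_inv. apply Rlt_Rpower_l. lra. split. apply Rpower_pos.
unfold gm. generalize (Rmax_r 1 (Rpower (mu * p * Rpower 2 p) (/ (p - 1)))). lra.
Qed.

Lemma Nl_pos u s : 0 < u -> Nl p mu u s = src p u - mu / (1 + s) * (u / 2).
Proof.
intros Hu. unfold Nl, src, rpow. rewrite Rabs_pos_eq by lra.
destruct (Rlt_dec 0 u); auto; lra.
Qed.

Lemma two_power_opp : Rpower 2 (- p) * Rpower 2 p = 1.
Proof. rewrite <- Rpower_plus. replace (- p + p) with 0 by ring. apply Rpower_O; lra. Qed.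

Lemma damping_le s : 0 <= s -> 0 <= mu / (1 + s) <= mu.
Proof.
intros Hs. split. left; apply Rdiv_lt_0_compat; lra. apply Rle_div_l; nra.
Qed.

(** The threshold on [g1 + g2] gives N' >= mu p^2 above [gm], and p > 1. *)
Lemma dsrc_gt u : gm <= u -> mu < dsrc p u.
Proof.
intros Hu. assert (G := gm_power). assert (G1 := gm_gt_1).
assert (Rpower gm (p - 1) <= Rpower u (p - 1)) by (apply Rle_Rpower_l; lra).
unfold dsrc. assert (T := two_power_opp). assert (P := Rpower_pos 2 (- p)).
assert (Rpower 2 (- p) * p * (mu * p * Rpower 2 p) <= Rpower 2 (- p) * p * Rpower u (p - 1)).
{ apply Rmult_le_compat_l. left; apply Rmult_lt_0_compat; lra. lra. }
replace (Rpower 2 (- p) * p * (mu * p * Rpower 2 p)) with (mu * (p * p) * (Rpower 2 (- p) * Rpower 2 p)) in H0 by ring.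
rewrite T in H0. assert (mu * 1 < mu * (p * p)) by (apply Rmult_lt_compat_l; nra). lra.
Qed.

(** Growth in u: N' exceeds mu, which dominates the damping coefficient at all times. Growth in s:
    the damping decays. *)
Lemma Nl_mono u u' s s' : gm <= u <= u' -> 0 <= s <= s' -> Nl p mu u s <= Nl p mu u' s'.
Proof.
intros Hu Hs. assert (G1 := gm_gt_1). rewrite !Nl_pos by lra.
assert (D := damping_le s (proj1 Hs)).
assert (mu / (1 + s') <= mu / (1 + s)).
{ apply Rmult_le_compat_l. lra. apply Rinv_le_contravar; lra. }
assert (mu / (1 + s') * (u' / 2) <= mu / (1 + s) * (u' / 2)) by (apply Rmult_le_compat_r; lra).
set (c := mu / (1 + s)) in *.
assert (M : src p u - c * (u / 2) <= src p u' - c * (u' / 2)); [|lra].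
apply (le_of_derive_nonneg (fun u => src p u - c * (u / 2)) (fun u => dsrc p u - c * / 2)). lra.
- intros x Hx. apply (is_derive_minus (src p) (fun u => c * (u / 2)) x (dsrc p x) (c * / 2)).
  apply is_derive_src; lra. auto_derive; auto; field.
- intros x Hx. generalize (dsrc_gt x). lra.
Qed.

Lemma Nl_gm_pos : 0 < Nl p mu gm 0.
Proof.
assert (G1 := gm_gt_1). rewrite Nl_pos by lra. assert (D := dsrc_gt gm (Rle_refl _)).
unfold dsrc in D. unfold src.
assert (E : Rpower gm p = Rpower gm (p - 1) * gm).
{ rewrite <- (Rpower_1 gm) at 3 by lra. rewrite <- Rpower_plus. f_equal; ring. }
rewrite E. assert (G := gm_power). assert (T := two_power_opp). assert (P := Rpower_pos 2 (- p)).
assert (mu * p < Rpower 2 (- p) * Rpower gm (p - 1)).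
{ replace (mu * p) with (Rpower 2 (- p) * (mu * p * Rpower 2 p)).
  apply Rmult_lt_compat_l; lra. transitivity (mu * p * (Rpower 2 (- p) * Rpower 2 p)). ring. rewrite T; ring. }
replace (mu / (1 + 0)) with mu by field. nra.
Qed.

Lemma Nl_le_src u s : 0 < u -> 0 <= s -> Nl p mu u s <= src p u.
Proof.
intros Hu Hs. rewrite Nl_pos by auto. generalize (damping_le s Hs). nra.
Qed.

Lemma Nl_ge u s : 0 < u -> 0 <= s -> src p u - mu / 2 * u <= Nl p mu u s.
Proof.
intros Hu Hs. rewrite Nl_pos by auto. generalize (damping_le s Hs). nra.
Qed.

(* Open, so that continuity can be stated on it; [t > -1] keeps [mu / (1 + t)] continuous. *)
Definition dom x t := Rabs x + Rabs t < rho /\ -1 < t.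
Definition cone x t := 0 <= t /\ Rabs x + t < rho.

Lemma cone_dom x t : cone x t -> dom x t.
Proof. intros [H1 H2]. split. rewrite (Rabs_pos_eq t); auto. lra. Qed.

Lemma cone_sub x t x' t' : cone x t -> 0 <= t' -> Rabs (x - x') <= t - t' -> cone x' t'.
Proof.
intros [H1 H2] H3 H4. split; auto.
replace x' with (x + - (x - x')) by ring.
assert (Q := Rabs_triang x (- (x - x'))). rewrite Rabs_Ropp in Q. lra.
Qed.

(** * Continuity of the iterates *)

Lemma dat_continuous b x : Rabs x < rho -> continuous (dat b) x.
Proof.
intros Hx. apply continuity_pt_filterlim. intros eps He.
assert (N0 := Nl_gm_pos). fold gm in Hlip.
set (L := Nl p mu gm 0 / (1 + k)). assert (HL : 0 < L) by (apply Rdiv_lt_0_compat; lra).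
exists (Rmin (rho - Rabs x) (eps / L)). split.
{ apply Rmin_glb_lt. lra. apply Rdiv_lt_0_compat; auto. }
intros y [_ Hy]. simpl in *. unfold Rdist in *.
assert (A1 := Rmin_l (rho - Rabs x) (eps / L)). assert (A2 := Rmin_r (rho - Rabs x) (eps / L)).
assert (Rabs y < rho).
{ replace y with (x + (y - x)) by ring. eapply Rle_lt_trans. apply Rabs_triang. lra. }
assert (Q := Hlip b x y Hx H).
assert (Rabs (dat b y - dat b x) <= L * Rabs (y - x)).
{ unfold L. replace (Nl p mu gm 0 / (1 + k) * Rabs (y - x)) with (Nl p mu gm 0 * Rabs (y - x) / (1 + k)) by (field; lra).
  apply Rle_div_r. lra. lra. }
assert (Rabs (y - x) < eps / L) by lra. apply Rlt_div_r in H1; auto. lra.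
Qed.

Lemma char_seg_dom b x0 t0 : dom x0 t0 -> exists d, 0 < d /\
  forall c s, Rabs (c - (x0 - dir b * t0)) <= d -> Rmin 0 t0 - d <= s <= Rmax 0 t0 + d ->
    dom (c + dir b * s) s.
Proof.
intros [H1 H2]. set (d := Rmin ((rho - Rabs x0 - Rabs t0) / 4) (Rmin ((1 + t0) / 2) (/ 2))).
assert (D1 : d <= (rho - Rabs x0 - Rabs t0) / 4) by apply Rmin_l.
assert (D2 : d <= (1 + t0) / 2) by (eapply Rle_trans; [apply Rmin_r|apply Rmin_l]).
assert (D3 : d <= / 2) by (eapply Rle_trans; [apply Rmin_r|apply Rmin_r]).
assert (Hd : 0 < d) by (repeat apply Rmin_glb_lt; lra).
exists d. split; auto. intros c s Hc Hs. split.
(* Projection of s onto the segment between 0 and t0, where |t0 - s'| + |s'| = |t0| holds for either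
   sign of t0. *)
- set (s' := Rmax (Rmin 0 t0) (Rmin s (Rmax 0 t0))).
  assert (S1 : Rabs (s - s') <= d /\ Rabs (t0 - s') + Rabs s' = Rabs t0).
  { unfold s', Rmax, Rmin in *. split; unfold Rabs;
    repeat match goal with
    | |- context [Rle_dec ?a ?b] => destruct (Rle_dec a b)
    | |- context [Rcase_abs ?a] => destruct (Rcase_abs a)
    | H : context [Rle_dec ?a ?b] |- _ => destruct (Rle_dec a b) end; lra. }
  destruct S1 as [S1 S2].
  replace (c + dir b * s) with ((c - (x0 - dir b * t0)) + (x0 + dir b * (s - s') + - (dir b * (t0 - s')))) by ring.
  assert (Q1 := Rabs_triang (c - (x0 - dir b * t0)) (x0 + dir b * (s - s') + - (dir b * (t0 - s')))).
  assert (Q2 := Rabs_triang (x0 + dir b * (s - s')) (- (dir b * (t0 - s')))).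
  assert (Q3 := Rabs_triang x0 (dir b * (s - s'))).
  rewrite Rabs_Ropp, Rabs_dir in Q2. rewrite Rabs_dir in Q3.
  assert (Q4 : Rabs s <= Rabs (s - s') + Rabs s').
  { replace s with ((s - s') + s') at 1 by ring. apply Rabs_triang. }
  lra.
- unfold Rmin in Hs. destruct (Rle_dec 0 t0); lra.
Qed.

Lemma inl_continuity n x t : (forall b, continuity_2d_pt (iter b n) x t) -> -1 < t -> continuity_2d_pt (inl n) x t.
Proof.
intros H Ht. unfold inl, Nl.
assert (Hs : continuity_2d_pt (isum n) x t) by (apply continuity_2d_pt_plus; auto).
apply continuity_2d_pt_minus.
- apply continuity_2d_pt_mult. apply continuity_2d_pt_const.
  apply (continuity_1d_2d_pt_comp (fun u => rpow (Rabs u) p)); auto.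
  apply continuity_pt_filterlim, continuous_rpow_abs; lra.
- apply continuity_2d_pt_mult.
  + apply (continuity_2d_pt_mult (fun _ _ => mu) (fun _ t => / (1 + t))). apply continuity_2d_pt_const.
    apply continuity_2d_pt_inv. apply continuity_2d_pt_plus. apply continuity_2d_pt_const. apply continuity_2d_pt_id2. lra.
  + apply (continuity_2d_pt_mult (isum n) (fun _ _ => / 2)); auto. apply continuity_2d_pt_const.
Qed.

Lemma iter_continuity n : forall b x t, dom x t -> continuity_2d_pt (iter b n) x t.
Proof.
induction n as [|n IH]; intros b x t Hd.
- destruct b; simpl; apply continuity_2d_pt_const.
- destruct (char_seg_dom b x t Hd) as (d & Hd0 & Hseg).
  apply (continuity_2d_pt_ext (fun x t => dat b (1 * x + (- dir b) * t) +
     (fun c t => RInt (fun s => inl n (c + dir b * s) s) 0 t) (1 * x + (- dir b) * t) t)).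
  { intros x' t'. rewrite iter_S. replace (1 * x' + - dir b * t') with (x' - dir b * t') by ring. auto. }
  assert (E : 1 * x + - dir b * t = x - dir b * t) by ring.
  apply continuity_2d_pt_plus.
  + apply (continuity_1d_2d_pt_comp (dat b) (fun x t => 1 * x + - dir b * t)).
    * apply continuity_pt_filterlim, dat_continuous. rewrite E. destruct Hd as [Hd _].
      eapply Rle_lt_trans; [|apply Hd]. unfold Rminus. eapply Rle_trans. apply Rabs_triang.
      rewrite Rabs_Ropp, Rabs_dir. lra.
    * apply continuity_2d_pt_plus; apply continuity_2d_pt_mult;
      auto using continuity_2d_pt_const, continuity_2d_pt_id1, continuity_2d_pt_id2.
  + apply (continuity_2d_lin (fun c t => RInt (fun s => inl n (c + dir b * s) s) 0 t)). rewrite E.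
    apply (continuity_2d_RInt (fun c s => inl n (c + dir b * s) s)) with d; auto.
    intros c s Hc Hs. specialize (Hseg c s Hc Hs).
    apply (continuity_2d_pt_ext (fun c s => inl n (1 * c + dir b * s) s)).
    { intros; rewrite Rmult_1_l; auto. }
    apply continuity_2d_lin. rewrite Rmult_1_l. apply inl_continuity; [|apply Hseg]. intros; apply IH; auto.
Qed.

(** * Monotone iteration along characteristics *)

Lemma cone_path b c r r' : 0 <= r' <= r -> cone (c + dir b * r) r -> cone (c + dir b * r') r'.
Proof.
intros Hr Hc. apply (cone_sub _ _ _ _ Hc). lra.
replace (c + dir b * r - (c + dir b * r')) with (dir b * (r - r')) by ring.
rewrite Rabs_dir, Rabs_pos_eq; lra.
Qed.

Lemma inl_path_continuous b n c r : dom (c + dir b * r) r -> continuous (fun r => inl n (c + dir b * r) r) r.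
Proof.
intros Hd. apply (continuity_2d_snd (fun c r => inl n (c + dir b * r) r)).
apply (continuity_2d_pt_ext (fun c s => inl n (1 * c + dir b * s) s)).
{ intros; rewrite Rmult_1_l; auto. }
apply continuity_2d_lin. rewrite Rmult_1_l. apply inl_continuity; [|apply Hd]. intros; apply iter_continuity; auto.
Qed.

(** The only derivative established for an iterate is the one along its own family of
    characteristics; the monotonicity and growth estimates below are integrated from it. *)
Lemma iter_path_derive b n c r : cone (c + dir b * r) r ->
  is_derive (fun r => iter b (S n) (c + dir b * r) r) r (inl n (c + dir b * r) r).
Proof.
intros Hc. apply (is_derive_ext (fun r => dat b c + RInt (fun s => inl n (c + dir b * s) s) 0 r)).
{ intros t. rewrite iter_S. replace (c + dir b * t - dir b * t) with c by ring. auto. }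
rewrite <- (Rplus_0_l (inl n _ _)).
apply (is_derive_plus (fun _ => dat b c) (fun r => RInt (fun s => inl n (c + dir b * s) s) 0 r) r 0).
auto_derive; auto.
destruct (char_seg_dom b _ _ (cone_dom _ _ Hc)) as (d & Hd0 & Hseg).
replace (c + dir b * r - dir b * r) with c in Hseg by ring.
assert (Hseg' : forall s, Rmin 0 r - d <= s <= Rmax 0 r + d -> dom (c + dir b * s) s).
{ intros. apply Hseg; auto. rewrite Rminus_diag, Rabs_R0; lra. }
clear Hseg. destruct Hc as [Hr _]. rewrite Rmin_left, Rmax_right in Hseg' by lra.
apply (is_derive_RInt (fun s => inl n (c + dir b * s) s) _ 0).
- exists (mkposreal _ Hd0). intros z Hz.
  unfold ball in Hz; simpl in Hz; unfold AbsRing_ball, abs, minus, plus, opp in Hz; simpl in Hz.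
  apply Rabs_def2 in Hz.
  apply (RInt_correct (fun s => inl n (c + dir b * s) s)), (ex_RInt_continuous (fun s => inl n (c + dir b * s) s)). intros w Hw. apply inl_path_continuous, Hseg'.
  unfold Rmin, Rmax in Hw; destruct (Rle_dec 0 z); lra.
- apply inl_path_continuous, Hseg'; lra.
Qed.

Lemma iter_path_0 b n c : iter b (S n) (c + dir b * 0) 0 = dat b c.
Proof.
rewrite iter_S, RInt_point. unfold zero; simpl.
replace (c + dir b * 0 - dir b * 0) with c by ring. ring.
Qed.

Lemma cone_0 b c r : cone (c + dir b * r) r -> Rabs c < rho.
Proof.
intros H. assert (H0 := cone_path b c r 0 (conj (Rle_refl _) (proj1 H)) H).
destruct H0 as [_ H0]. rewrite Rmult_0_r, !Rplus_0_r in H0. auto.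
Qed.

Lemma iter_path_ge b n c r1 r2 m : 0 <= r1 <= r2 -> cone (c + dir b * r2) r2 ->
  (forall r, r1 <= r <= r2 -> m <= inl n (c + dir b * r) r) ->
  iter b (S n) (c + dir b * r1) r1 + m * (r2 - r1) <= iter b (S n) (c + dir b * r2) r2.
Proof.
intros Hr Hc Hm.
cut (iter b (S n) (c + dir b * r1) r1 - m * r1 <= iter b (S n) (c + dir b * r2) r2 - m * r2); [lra|].
apply (le_of_derive_nonneg (fun r => iter b (S n) (c + dir b * r) r - m * r) (fun r => inl n (c + dir b * r) r - m)).
lra.
- intros r Hr'. apply (is_derive_minus (fun r => iter b (S n) (c + dir b * r) r) (fun r => m * r) r).
  apply iter_path_derive. apply cone_path with r2; auto; lra. auto_derive; auto; ring.
- intros r Hr'. specialize (Hm r Hr'). lra.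
Qed.

Lemma iter_path_le b n c r1 r2 m : 0 <= r1 <= r2 -> cone (c + dir b * r2) r2 ->
  (forall r, r1 <= r <= r2 -> inl n (c + dir b * r) r <= m) ->
  iter b (S n) (c + dir b * r2) r2 <= iter b (S n) (c + dir b * r1) r1 + m * (r2 - r1).
Proof.
intros Hr Hc Hm.
cut (m * r1 - iter b (S n) (c + dir b * r1) r1 <= m * r2 - iter b (S n) (c + dir b * r2) r2); [lra|].
apply (le_of_derive_nonneg (fun r => m * r - iter b (S n) (c + dir b * r) r) (fun r => m - inl n (c + dir b * r) r)).
lra.
- intros r Hr'. apply (is_derive_minus (fun r => m * r) (fun r => iter b (S n) (c + dir b * r) r) r).
  auto_derive; auto; ring. apply iter_path_derive. apply cone_path with r2; auto; lra.
- intros r Hr'. specialize (Hm r Hr'). lra.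
Qed.

Lemma at_path b x t : x = (x - dir b * t) + dir b * t.
Proof. ring. Qed.

Lemma isum_ge n x t : (forall b, gam b <= iter b n x t) -> gm <= isum n x t.
Proof. intros H. generalize (H false) (H true). unfold isum, gm, gam. lra. Qed.

Lemma iter_ge_gam n : forall b x t, cone x t -> gam b <= iter b n x t.
Proof.
induction n as [|n IH]; intros b x t Hc.
- destruct b; simpl; lra.
- rewrite (at_path b x t) in Hc |- *. set (c := x - dir b * t) in *.
  eapply Rle_trans; [|apply (iter_path_ge b n c 0 t 0)]; auto; try (split; [lra|apply Hc]).
  + rewrite iter_path_0. generalize (Hlow b c (cone_0 _ _ _ Hc)). lra.
  + intros r Hr. assert (Hcr := cone_path b c t r Hr Hc).
    assert (G := isum_ge n _ _ (fun b => IH b _ _ Hcr)).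
    eapply Rle_trans; [left; apply Nl_gm_pos|]. apply Nl_mono; lra.
Qed.

Lemma isum_ge_gm n x t : cone x t -> gm <= isum n x t.
Proof. intros H. apply isum_ge. intros; apply iter_ge_gam; auto. Qed.

Lemma inl_ge n x t : cone x t -> Nl p mu gm 0 <= inl n x t.
Proof. intros H. assert (G := isum_ge_gm n x t H). destruct H. apply Nl_mono; lra. Qed.

Lemma iter_incr n : forall b x t, cone x t -> iter b n x t <= iter b (S n) x t.
Proof.
induction n as [|n IH]; intros b x t Hc.
- eapply Rle_trans; [|apply iter_ge_gam; auto]. destruct b; simpl; lra.
- rewrite (at_path b x t) in Hc |- *. set (c := x - dir b * t) in *.
  assert (M := le_of_derive_nonneg (fun r => iter b (S (S n)) (c + dir b * r) r - iter b (S n) (c + dir b * r) r)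
    (fun r => inl (S n) (c + dir b * r) r - inl n (c + dir b * r) r) 0 t (proj1 Hc)).
  cbv beta in M. rewrite !iter_path_0 in M.
  cut (dat b c - dat b c <= iter b (S (S n)) (c + dir b * t) t - iter b (S n) (c + dir b * t) t); [lra|].
  apply M.
  + intros r Hr. assert (Hcr := cone_path b c t r Hr Hc).
    apply (is_derive_minus (fun r => iter b (S (S n)) (c + dir b * r) r) (fun r => iter b (S n) (c + dir b * r) r));
    apply iter_path_derive; auto.
  + intros r Hr. assert (Hcr := cone_path b c t r Hr Hc).
    cut (inl n (c + dir b * r) r <= inl (S n) (c + dir b * r) r); [lra|].
    apply Nl_mono; [|lra]. split. apply isum_ge_gm; auto.
    apply Rplus_le_compat; apply IH; auto.
Qed.

(* Along parallel characteristics the difference is nondecreasing; initially, by (A4), the source on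
   [0, t' - t] makes up for the shift in the data. *)
Lemma iter_mono n : forall b x t x' t', cone x t -> cone x' t' -> Rabs (x' - x) <= k * (t' - t) ->
  iter b n x t <= iter b n x' t'.
Proof.
induction n as [|n IH]; intros b x t x' t' Hc Hc' Hd.
- destruct b; simpl; lra.
- assert (Hh : 0 <= t' - t) by (generalize (Rabs_pos (x' - x)); nra).
  rewrite (at_path b x t) in Hc |- *. rewrite (at_path b x' t') in Hc' |- *.
  set (c := x - dir b * t) in *. set (c' := x' - dir b * t') in *. set (h := t' - t) in *.
  assert (N0 := Nl_gm_pos). assert (Ht : 0 <= t) by apply Hc.
  assert (P0 : dat b c' + Nl p mu gm 0 * h <= iter b (S n) (c' + dir b * h) h).
  { rewrite <- (iter_path_0 b n c'). replace (Nl p mu gm 0 * h) with (Nl p mu gm 0 * (h - 0)) by ring.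
    assert (Hch : cone (c' + dir b * h) h) by (apply cone_path with t'; auto; unfold h in *; lra).
    apply iter_path_ge; auto. lra. intros r Hr. apply inl_ge.
    apply cone_path with h; auto. }
  assert (Hcc : Rabs (c' - c) <= (1 + k) * h).
  { unfold c', c. replace (x' - dir b * t' - (x - dir b * t)) with ((x' - x) + - (dir b * h)) by (unfold h; ring).
    eapply Rle_trans. apply Rabs_triang. rewrite Rabs_Ropp, Rabs_dir, (Rabs_pos_eq h) by auto. lra. }
  assert (P1 := Hlip b c c' (cone_0 _ _ _ Hc) (cone_0 _ _ _ Hc')). fold gm in P1.
  assert (P2 : dat b c <= dat b c' + Nl p mu gm 0 * h).
  { assert (Q := Rle_abs (- (dat b c' - dat b c))). rewrite Rabs_Ropp in Q.
    assert (Nl p mu gm 0 * Rabs (c' - c) <= Nl p mu gm 0 * ((1 + k) * h)) by (apply Rmult_le_compat_l; lra). nra. }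
  assert (Hpt : forall r, 0 <= r <= t -> cone (c + dir b * r) r /\ cone (c' + dir b * (r + h)) (r + h) /\
     inl n (c + dir b * r) r <= inl n (c' + dir b * (r + h)) (r + h)).
  { intros r Hr. assert (A1 : cone (c + dir b * r) r) by (apply cone_path with t; auto).
    assert (A2 : cone (c' + dir b * (r + h)) (r + h)) by (apply cone_path with t'; auto; unfold h in *; lra).
    split; [auto|split; auto]. apply Nl_mono; [|unfold h in *; lra]. split. apply isum_ge_gm; auto.
    assert (E : Rabs (c' + dir b * (r + h) - (c + dir b * r)) <= k * (r + h - r)).
    { replace (c' + dir b * (r + h) - (c + dir b * r)) with (x' - x) by (unfold c, c', h; ring).
      replace (r + h - r) with h by ring. auto. }
    apply Rplus_le_compat; apply IH; auto. }
  assert (M := le_of_derive_nonneg (fun r => iter b (S n) (c' + dir b * (r + h)) (r + h) - iter b (S n) (c + dir b * r) r)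
    (fun r => inl n (c' + dir b * (r + h)) (r + h) - inl n (c + dir b * r) r) 0 t Ht).
  cbv beta in M. rewrite iter_path_0, Rplus_0_l in M. replace (t + h) with t' in M by (unfold h; ring).
  cut (iter b (S n) (c' + dir b * h) h - dat b c <=
    iter b (S n) (c' + dir b * t') t' - iter b (S n) (c + dir b * t) t); [lra|].
  apply M.
  + intros r Hr. destruct (Hpt r Hr) as (A1 & A2 & _).
    apply (is_derive_minus (fun r => iter b (S n) (c' + dir b * (r + h)) (r + h)) (fun r => iter b (S n) (c + dir b * r) r) r).
    * evar_last. apply (is_derive_comp (fun r => iter b (S n) (c' + dir b * r) r) (fun r => r + h)).
      apply iter_path_derive; auto. auto_derive; auto.
      unfold scal; simpl; unfold mult; simpl; ring.
    * apply iter_path_derive; auto.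
  + intros r Hr. destruct (Hpt r Hr) as (_ & _ & A3). lra.
Qed.

(** * The supremum of the iterates *)

Definition sol b x t : Rbar := Lub_Rbar (fun r => exists n, r = iter b n x t).
Definition bdd x t := exists M, forall b n, iter b n x t <= M.
(** [real] turns an infinite supremum into 0, so statements about [val] carry [bdd]. *)
Definition val b x t : R := real (sol b x t).
Definition usum x t := val false x t + val true x t.

Lemma iter_le_val b n x t : bdd x t -> iter b n x t <= val b x t.
Proof.
intros [M HM]. unfold val, sol.
destruct (Lub_Rbar_correct (fun r => exists n, r = iter b n x t)) as [H1 H2].
assert (A : Rbar_le (iter b n x t) (Lub_Rbar (fun r => exists n, r = iter b n x t))) by (apply H1; eauto).
assert (B : Rbar_le (Lub_Rbar (fun r => exists n, r = iter b n x t)) M).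
{ apply H2. intros r [m ->]. simpl; auto. }
destruct (Lub_Rbar _); simpl in *; try contradiction; auto.
Qed.

Lemma val_le b x t M : bdd x t -> (forall n, iter b n x t <= M) -> val b x t <= M.
Proof.
intros Hb HM. generalize (iter_le_val b 0%nat x t Hb). unfold val, sol.
destruct (Lub_Rbar_correct (fun r => exists n, r = iter b n x t)) as [H1 H2].
assert (A : Rbar_le (iter b 0 x t) (Lub_Rbar (fun r => exists n, r = iter b n x t))) by (apply H1; eauto).
assert (B : Rbar_le (Lub_Rbar (fun r => exists n, r = iter b n x t)) M).
{ apply H2. intros r [m ->]. simpl; auto. }
destruct (Lub_Rbar _); simpl in *; try contradiction; auto.
Qed.

Lemma iter_lim b x t : cone x t -> bdd x t -> is_lim_seq (fun n => iter b n x t) (val b x t).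
Proof.
intros Hc Hb. apply is_lim_seq_spec. intros eps.
destruct (classic (exists n, val b x t - eps < iter b n x t)) as [[N HN]|Hn].
- exists N. intros n Hn. assert (A := iter_le_val b n x t Hb).
  assert (B : iter b N x t <= iter b n x t).
  { clear A. induction Hn. lra. eapply Rle_trans; [apply IHHn|apply iter_incr; auto]. }
  apply Rabs_def1; generalize (cond_pos eps); lra.
- exfalso. assert (val b x t <= val b x t - eps).
  { apply val_le; auto. intros n. apply Rnot_lt_le. intros Hlt. apply Hn. exists n; auto. }
  generalize (cond_pos eps); lra.
Qed.

(** [Rbar_plus] returns 0 on opposite infinities; the lower bounds [gam b] exclude minus infinity,
    so the sum is finite exactly when both suprema are. *)
Lemma finite_iff_bdd x t : cone x t ->
  (Rbar_lt (Rbar_plus (sol false x t) (sol true x t)) p_infty <-> bdd x t).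
Proof.
intros Hc.
assert (L : forall b, Rbar_le (gam b) (sol b x t)).
{ intros b. apply Rbar_le_trans with (iter b 0 x t). apply iter_ge_gam; auto.
  apply (proj1 (Lub_Rbar_correct (fun r => exists n, r = iter b n x t))). eauto. }
split.
- intros H. assert (E : forall b, exists r, sol b x t = Finite r).
  { generalize (L false) (L true). destruct (sol false x t) eqn:E1, (sol true x t) eqn:E2; simpl in *; try contradiction; intros;
    destruct b; rewrite ?E1, ?E2; eauto. }
  destruct (E false) as [r1 E1]. destruct (E true) as [r2 E2].
  exists (Rmax r1 r2). intros b n.
  assert (B : Rbar_le (iter b n x t) (sol b x t)).
  { apply (proj1 (Lub_Rbar_correct (fun r => exists n, r = iter b n x t))). eauto. }
  destruct b; [rewrite E2 in B|rewrite E1 in B]; simpl in B; eapply Rle_trans; eauto; [apply Rmax_r|apply Rmax_l].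
- intros [M HM].
  assert (B : forall b, Rbar_le (sol b x t) M).
  { intros b. apply (proj2 (Lub_Rbar_correct (fun r => exists n, r = iter b n x t))). intros r [n ->]. simpl; auto. }
  generalize (L false) (L true) (B false) (B true).
  destruct (sol false x t), (sol true x t); simpl; try contradiction; auto.
Qed.

Lemma bdd_mono x t x' t' : cone x t -> cone x' t' -> Rabs (x' - x) <= k * (t' - t) -> bdd x' t' -> bdd x t.
Proof.
intros Hc Hc' Hd [M HM]. exists M. intros b n. eapply Rle_trans; [|apply HM]. apply iter_mono; auto.
Qed.

Lemma val_mono b x t x' t' : cone x t -> cone x' t' -> Rabs (x' - x) <= k * (t' - t) -> bdd x' t' ->
  val b x t <= val b x' t'.
Proof.
intros Hc Hc' Hd Hb. apply val_le. apply bdd_mono with x' t'; auto.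
intros n. eapply Rle_trans; [|apply iter_le_val; eauto]. apply iter_mono; auto.
Qed.

Lemma val_ge b x t : cone x t -> bdd x t -> gam b <= val b x t.
Proof. intros Hc Hb. eapply Rle_trans; [|apply (iter_le_val b 0%nat); auto]. apply iter_ge_gam; auto. Qed.

Lemma usum_ge x t : cone x t -> bdd x t -> gm <= usum x t.
Proof. intros Hc Hb. generalize (val_ge false x t Hc Hb) (val_ge true x t Hc Hb). unfold usum, gm, gam; lra. Qed.

Lemma inl_lim x t : cone x t -> bdd x t -> is_lim_seq (fun n => inl n x t) (Nl p mu (usum x t) t).
Proof.
intros Hc Hb. assert (G := usum_ge x t Hc Hb). assert (G1 := gm_gt_1).
apply (is_lim_seq_continuous (fun u => Nl p mu u t)).
- apply continuity_pt_filterlim. unfold Nl.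
  apply (continuous_minus (fun u => Rpower 2 (- p) * rpow (Rabs u) p) (fun u => mu / (1 + t) * (u / 2))).
  + apply (continuous_mult (fun _ => Rpower 2 (- p)) (fun u => rpow (Rabs u) p)).
    apply continuous_const. apply continuous_rpow_abs; lra.
  + apply (ex_derive_continuous (fun u => mu / (1 + t) * (u / 2))). auto_derive; auto.
- apply is_lim_seq_plus'; apply iter_lim; auto.
Qed.

(** Since k > 1, characteristics are themselves directions of monotonicity: the source of each
    iterate is nondecreasing along them, and the increment lies between h times its end values. Such
    bounds pass to the limit in n without exchanging limit and integral. *)
Lemma val_char b x t h : 0 <= t -> 0 <= h -> cone (x + dir b * h) (t + h) -> bdd (x + dir b * h) (t + h) ->
  Nl p mu (usum x t) t * h <= val b (x + dir b * h) (t + h) - val b x t <=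
  Nl p mu (usum (x + dir b * h) (t + h)) (t + h) * h.
Proof.
intros Ht Hh Hc' Hb'.
set (c := x - dir b * t). assert (Ex : x = c + dir b * t) by (unfold c; ring).
assert (Ex' : x + dir b * h = c + dir b * (t + h)) by (unfold c; ring).
assert (Hc : cone x t). { rewrite Ex. rewrite Ex' in Hc'. apply cone_path with (t + h); auto; lra. }
assert (Hd : forall r r', r <= r' -> Rabs (c + dir b * r' - (c + dir b * r)) <= k * (r' - r)).
{ intros r r' Hr. replace (c + dir b * r' - (c + dir b * r)) with (dir b * (r' - r)) by ring.
  rewrite Rabs_dir, Rabs_pos_eq by lra. nra. }
assert (Hm : forall n r r', 0 <= r <= r' -> r' <= t + h ->
   inl n (c + dir b * r) r <= inl n (c + dir b * r') r').
{ intros n r r' Hr Hr'. rewrite Ex' in Hc'.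
  assert (A1 : cone (c + dir b * r) r) by (apply cone_path with (t + h); auto; lra).
  assert (A2 : cone (c + dir b * r') r') by (apply cone_path with (t + h); auto; lra).
  apply Nl_mono; [|lra]. split. apply isum_ge_gm; auto.
  apply Rplus_le_compat; apply iter_mono; auto; apply Hd; lra. }
assert (Hb : bdd x t).
{ apply bdd_mono with (x + dir b * h) (t + h); auto. replace (x + dir b * h - x) with (dir b * h) by ring.
  rewrite Rabs_dir, Rabs_pos_eq by lra. nra. }
assert (L1 := iter_lim b _ _ Hc' Hb'). assert (L0 := iter_lim b _ _ Hc Hb).
apply is_lim_seq_incr_1 in L1. apply is_lim_seq_incr_1 in L0.
assert (N1 := inl_lim _ _ Hc' Hb'). assert (N0 := inl_lim _ _ Hc Hb).
assert (LD := is_lim_seq_minus' _ _ _ _ L1 L0).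
split.
- apply (is_lim_seq_le (fun n => inl n x t * h) (fun n => iter b (S n) (x + dir b * h) (t + h) - iter b (S n) x t)
    (Nl p mu (usum x t) t * h) (val b (x + dir b * h) (t + h) - val b x t)); auto.
  + intros n. rewrite Ex', Ex. rewrite Ex' in Hc'.
    generalize (iter_path_ge b n c t (t + h) (inl n (c + dir b * t) t)). replace (t + h - t) with h by ring. intros Q.
    cut (iter b (S n) (c + dir b * t) t + inl n (c + dir b * t) t * h <= iter b (S n) (c + dir b * (t + h)) (t + h)); [lra|].
    apply Q; auto. lra. intros r Hr. apply Hm; lra.
  + apply is_lim_seq_mult'; auto. apply is_lim_seq_const.
- apply (is_lim_seq_le (fun n => iter b (S n) (x + dir b * h) (t + h) - iter b (S n) x t) (fun n => inl n (x + dir b * h) (t + h) * h)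
    (val b (x + dir b * h) (t + h) - val b x t) (Nl p mu (usum (x + dir b * h) (t + h)) (t + h) * h)); auto.
  + intros n. rewrite Ex', Ex. rewrite Ex' in Hc'.
    generalize (iter_path_le b n c t (t + h) (inl n (c + dir b * (t + h)) (t + h))). replace (t + h - t) with h by ring. intros Q.
    cut (iter b (S n) (c + dir b * (t + h)) (t + h) <= iter b (S n) (c + dir b * t) t + inl n (c + dir b * (t + h)) (t + h) * h); [lra|].
    apply Q; auto. lra. intros r Hr. apply Hm; lra.
  + apply is_lim_seq_mult'; auto. apply is_lim_seq_const.
Qed.

(** Induction on n keeps the iterates below 2 M on the backward cone: their sum is then at most 4 M,
    and over a time at most r the source adds at most r src(4 M) <= M to the bound M at time s0. *)
Lemma local_existence x s0 r M : 0 <= s0 -> 0 <= r -> 0 < M -> r * src p (4 * M) <= M ->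
  cone x (s0 + r) ->
  (forall b n y, Rabs (y - x) <= r -> iter b n y s0 <= M) -> bdd x (s0 + r).
Proof.
intros Hs0 Hr HM Hs Hc H0.
assert (Hcy : forall y s, s0 <= s -> Rabs (y - x) <= r - (s - s0) -> cone y s).
{ intros y s Hs' Hy. apply (cone_sub _ _ _ _ Hc). lra. rewrite Rabs_minus_sym. lra. }
assert (E : forall n b y s, s0 <= s -> Rabs (y - x) <= r - (s - s0) -> iter b n y s <= 2 * M).
{ induction n as [|n IH]; intros b y s Hs' Hy.
  - assert (Hxx : Rabs (x - x) <= r) by (rewrite Rminus_diag, Rabs_R0; auto).
    generalize (H0 b 0%nat x Hxx). destruct b; simpl; lra.
  - assert (Hcys := Hcy y s Hs' Hy). assert (Py := Rabs_pos (y - x)).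
    set (c := y - dir b * s). assert (Ey : y = c + dir b * s) by (unfold c; ring).
    rewrite Ey in Hcys |- *.
    assert (Q : iter b (S n) (c + dir b * s) s <= iter b (S n) (c + dir b * s0) s0 + src p (4 * M) * (s - s0)).
    { apply iter_path_le; auto. intros r' Hr'.
      assert (Hy' : Rabs (c + dir b * r' - x) <= r - (r' - s0)).
      { replace (c + dir b * r' - x) with ((y - x) + - (dir b * (s - r'))) by (unfold c; ring).
        eapply Rle_trans. apply Rabs_triang. rewrite Rabs_Ropp, Rabs_dir, (Rabs_pos_eq (s - r')) by lra. lra. }
      assert (Hc' := Hcy _ r' (proj1 Hr') Hy'). assert (G := isum_ge_gm n _ _ Hc'). assert (G1 := gm_gt_1).
      eapply Rle_trans. apply Nl_le_src; lra.
      apply Rmult_le_compat_l. left; apply Rpower_pos. apply Rle_Rpower_l. lra. split. lra.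
      assert (I1 := IH false _ r' (proj1 Hr') Hy'). assert (I2 := IH true _ r' (proj1 Hr') Hy').
      unfold isum; lra. }
    assert (B : iter b (S n) (c + dir b * s0) s0 <= M).
    { apply H0. replace (c + dir b * s0 - x) with ((y - x) + - (dir b * (s - s0))) by (unfold c; ring).
      eapply Rle_trans. apply Rabs_triang. rewrite Rabs_Ropp, Rabs_dir, (Rabs_pos_eq (s - s0)) by lra. lra. }
    assert (src p (4 * M) * (s - s0) <= src p (4 * M) * r).
    { apply Rmult_le_compat_l; [left; apply src_pos|lra]. }
    lra. }
exists (2 * M). intros b n. apply E. lra. rewrite Rminus_diag, Rabs_R0. lra.
Qed.

(** An autonomous minorant of the nonlinearity: the damping coefficient is frozen at mu, its largest
    value for s >= 0. *)
Definition nbar u := src p u - mu / 2 * u.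

Lemma is_derive_nbar u : 0 < u -> is_derive nbar u (dsrc p u - mu / 2).
Proof.
intros Hu. apply (is_derive_minus (src p) (fun u => mu / 2 * u) u (dsrc p u) (mu / 2)).
apply is_derive_src; auto. auto_derive; auto; ring.
Qed.

(** No upper bound on u is at hand, so the constant refers only to X >= w; when u is above w,
    monotonicity of [nbar] suffices. *)
Lemma nbar_lip u w X : gm <= u -> gm <= w <= X -> nbar w - nbar u <= dsrc p X * Rmax 0 (w - u).
Proof.
intros Hu Hw. assert (G1 := gm_gt_1).
assert (PX : 0 < dsrc p X) by (generalize (dsrc_gt X); lra).
destruct (Rle_lt_dec w u) as [H|H].
- assert (nbar w <= nbar u).
  { apply (le_of_derive_nonneg nbar (fun u => dsrc p u - mu / 2)); auto.
    intros x Hx; apply is_derive_nbar; lra. intros x Hx. generalize (dsrc_gt x); lra. }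
  rewrite Rmax_left by lra. lra.
- rewrite Rmax_right by lra.
  assert (dsrc p X * u - nbar u <= dsrc p X * w - nbar w); [|lra].
  apply (le_of_derive_nonneg (fun u => dsrc p X * u - nbar u) (fun u => dsrc p X - (dsrc p u - mu / 2))). lra.
  + intros x Hx. apply (is_derive_minus (fun u => dsrc p X * u) nbar x (dsrc p X)). auto_derive; auto; ring.
    apply is_derive_nbar; lra.
  + intros x Hx. assert (dsrc p x <= dsrc p X); [|lra].
    unfold dsrc. apply Rmult_le_compat_l. left; apply Rpower_pos. apply Rmult_le_compat_l. lra.
    apply Rle_Rpower_l; lra.
Qed.

(** The halving device of [linear_comparison], now measuring how far the iterates lag behind the ODE
    solution w. Each component receives half of the growth of w, so the two bounds add up to w. *)
Lemma ode_comparison (w : R -> R) sg X : 0 <= sg -> w 0 = gm ->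
  (forall s, 0 <= s <= sg -> gm <= w s <= X) ->
  (forall s, 0 <= s <= sg -> is_derive w s (2 * nbar (w s))) ->
  forall n b y s, cone y s -> s <= sg ->
  gam b + (w s - gm) / 2 - (X / 2 ^ n) * exp (4 * dsrc p X * s) <= iter b n y s.
Proof.
intros Hsg Hw0 HwX Hwd. assert (G1 := gm_gt_1).
assert (HX : 0 < X) by (generalize (HwX 0 (conj (Rle_refl 0) Hsg)); lra).
assert (PX : 0 < dsrc p X).
{ generalize (dsrc_gt X) (HwX 0 (conj (Rle_refl 0) Hsg)); lra. }
set (L := dsrc p X) in *.
induction n as [|n IH]; intros b y s Hc Hs.
- assert (1 <= exp (4 * L * s)).
  { generalize (exp_ineq1_le (4 * L * s)). destruct Hc. nra. }
  assert (E : iter b 0 y s = gam b) by (destruct b; reflexivity). rewrite E.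
  assert (Q := HwX s (conj (proj1 Hc) Hs)). simpl. rewrite Rdiv_1_r. nra.
- set (c := y - dir b * s). assert (Ey : y = c + dir b * s) by (unfold c; ring). rewrite Ey in Hc |- *.
  set (Z := X / 2 ^ S n).
  assert (HZ : 0 < Z) by (apply Rdiv_lt_0_compat; auto; apply pow_lt; lra).
  assert (HZ2 : X / 2 ^ n = 2 * Z) by (unfold Z; simpl; field; apply pow_nonzero; lra).
  assert (M := le_of_derive_nonneg
    (fun r => iter b (S n) (c + dir b * r) r - w r / 2 + Z * exp (4 * L * r))
    (fun r => inl n (c + dir b * r) r - nbar (w r) + Z * (4 * L * exp (4 * L * r))) 0 s (proj1 Hc)).
  cbv beta in M. rewrite iter_path_0, Hw0, Rmult_0_r, exp_0 in M.
  cut (dat b c - gm / 2 + Z * 1 <= iter b (S n) (c + dir b * s) s - w s / 2 + Z * exp (4 * L * s)).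
  { generalize (Hlow b c (cone_0 _ _ _ Hc)). lra. }
  apply M.
  + intros r Hr.
    apply (is_derive_plus (fun r => iter b (S n) (c + dir b * r) r - w r / 2) (fun r => Z * exp (4 * L * r)) r
      (inl n (c + dir b * r) r - nbar (w r))).
    apply (is_derive_minus (fun r => iter b (S n) (c + dir b * r) r) (fun r => w r / 2) r).
    apply iter_path_derive. apply cone_path with s; auto.
    evar_last. apply (is_derive_scal_l w r (2 * nbar (w r)) (/ 2)). apply Hwd; lra.
    unfold scal; simpl; unfold mult; simpl. field.
    auto_derive; auto; ring.
  + intros r Hr. assert (Hcr : cone (c + dir b * r) r) by (apply cone_path with s; auto).
    assert (G := isum_ge_gm n _ _ Hcr).
    assert (Hin : nbar (isum n (c + dir b * r) r) <= inl n (c + dir b * r) r) by (apply Nl_ge; lra).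
    assert (Hr' : r <= sg) by lra.
    assert (I1 := IH false _ r Hcr Hr'). assert (I2 := IH true _ r Hcr Hr'). rewrite HZ2 in I1, I2.
    set (ex := exp (4 * L * r)) in *. assert (0 < ex) by apply exp_pos.
    assert (Q := nbar_lip (isum n (c + dir b * r) r) (w r) X G (HwX r (conj (proj1 Hr) Hr'))). fold L in Q.
    assert (W : w r - isum n (c + dir b * r) r <= 4 * Z * ex).
    { unfold isum. change gm with (gam false + gam true) in I1, I2. lra. }
    assert (0 < 4 * Z * ex) by (apply Rmult_lt_0_compat; lra).
    assert (Rmax 0 (w r - isum n (c + dir b * r) r) <= 4 * Z * ex) by (apply Rmax_lub; lra).
    assert (L * Rmax 0 (w r - isum n (c + dir b * r) r) <= L * (4 * Z * ex)) by (apply Rmult_le_compat_l; lra).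
    nra.
Qed.

(* [w = V^(-1/(p-1))] solves the Bernoulli equation [w' = 2^(1-p) w^p - mu w], since [V' = -(p-1) mu (D - V)]. *)
Lemma bdd_before_T1 x t : cone x t -> bdd x t -> t < T1 p mu g1 g2.
Proof.
intros Hc Hb. apply Rnot_le_lt. intros HT1.
assert (G1 := gm_gt_1). assert (G := gm_power).
set (D := Rpower 2 (1 - p) / mu). set (gg := Rpower gm (1 - p)).
assert (Hgg : 0 < gg) by apply Rpower_pos.
(* The threshold on [g1 + g2] makes the logarithm in [T1] meaningful: the function V below then
   decreases and vanishes exactly at T1. *)
assert (HD : gg < D).
{ unfold gg, D. replace (1 - p) with (- (p - 1)) at 1 by ring. rewrite Rpower_Ropp.
  assert (P2 := Rpower_pos 2 p). assert (T := two_power_opp). assert (P2' := Rpower_pos 2 (- p)).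
  apply Rlt_trans with (/ (mu * p * Rpower 2 p)).
  - apply Rinv_lt_contravar; auto. apply Rmult_lt_0_compat. apply Rmult_lt_0_compat; nra. apply Rpower_pos.
  - replace (1 - p) with (1 + - p) by ring. rewrite Rpower_plus, Rpower_1 by lra.
    replace (Rpower 2 (- p)) with (/ Rpower 2 p) by (field_simplify_eq; [lra|lra]).
    replace (2 * / Rpower 2 p / mu) with (2 * p * / (mu * p * Rpower 2 p)) by (field; lra).
    assert (0 < / (mu * p * Rpower 2 p)).
    { apply Rinv_0_lt_compat. apply Rmult_lt_0_compat; nra. }
    nra. }
set (a := (p - 1) * mu). assert (Ha : 0 < a) by (apply Rmult_lt_0_compat; lra).
set (V := fun s => D - (D - gg) * exp (a * s)).
set (w := fun s => Rpower (V s) (- / (p - 1))).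
(* A level so high that gam false + (Z - gm) / 2 exceeds [val false x t], which contradicts the
   comparison once w has reached Z. *)
set (Z := Rmax gm (2 * Rmax (val false x t) (val true x t) + gm + 1)).
assert (HZ1 : gm <= Z) by apply Rmax_l.
assert (HZ2 : 2 * Rmax (val false x t) (val true x t) + gm + 1 <= Z) by apply Rmax_r.
set (del := Rpower Z (1 - p)). assert (Hdel : 0 < del) by apply Rpower_pos.
assert (Hdg : del <= gg) by (apply Rpower_antitone; lra).
(* The time at which V has come down to del, that is w = Z; it is before T1 because del > 0. *)
set (sg := ln ((D - del) / (D - gg)) / a).
assert (Hq1 : 1 <= (D - del) / (D - gg)) by (apply Rle_div_r; lra).
assert (Hsg0 : 0 <= sg).
{ apply Rmult_le_pos. rewrite <- ln_1. apply Rcomplements.ln_le; lra. left; apply Rinv_0_lt_compat; auto. }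
assert (Hsg1 : sg < T1 p mu g1 g2).
{ unfold T1, sg. fold a gm gg. unfold Rdiv at 1. rewrite Rmult_comm. apply Rmult_lt_compat_l.
  apply Rinv_0_lt_compat; auto. apply ln_increasing. lra. fold D. apply Rmult_lt_compat_r; [|lra].
  apply Rinv_0_lt_compat; lra. }
assert (Hexp : exp (a * sg) = (D - del) / (D - gg)).
{ unfold sg. replace (a * (ln ((D - del) / (D - gg)) / a)) with (ln ((D - del) / (D - gg))) by (field; lra).
  apply exp_ln. lra. }
assert (HVsg : V sg = del). { unfold V. rewrite Hexp. field. lra. }
assert (HV : forall s, 0 <= s <= sg -> del <= V s <= gg).
{ intros s Hs. unfold V. rewrite <- HVsg. unfold V. split.
  - apply Rplus_le_compat_l, Ropp_le_contravar, Rmult_le_compat_l. lra.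
    destruct (Rle_lt_or_eq_dec _ _ (proj2 Hs)) as [Hl| ->]; [left; apply exp_increasing; nra|lra].
  - assert (1 <= exp (a * s)) by (generalize (exp_ineq1_le (a * s)); nra). nra. }
assert (Hpow : forall z, 0 < z -> Rpower (Rpower z (1 - p)) (- / (p - 1)) = z).
{ intros z Hz. rewrite Rpower_mult. replace ((1 - p) * - / (p - 1)) with 1 by (field; lra). apply Rpower_1; auto. }
assert (Hip : 0 < / (p - 1)) by (apply Rinv_0_lt_compat; lra).
assert (Hwsg : w sg = Z). { unfold w. rewrite HVsg. apply Hpow; lra. }
assert (Cmp := ode_comparison w sg Z Hsg0).
assert (Hw0 : w 0 = gm).
{ unfold w, V. rewrite Rmult_0_r, exp_0. replace (D - (D - gg) * 1) with gg by ring. apply Hpow; lra. }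
assert (HwX : forall s, 0 <= s <= sg -> gm <= w s <= Z).
{ intros s Hs. assert (Q := HV s Hs). unfold w. rewrite <- (Hpow gm), <- (Hpow Z) by lra. fold gg del.
  split; apply Rpower_antitone; lra. }
assert (Hwd : forall s, 0 <= s <= sg -> is_derive w s (2 * nbar (w s))).
{ intros s Hs. assert (Q := HV s Hs).
  assert (DV : is_derive V s (- (a * (D - V s)))).
  { unfold V. auto_derive; auto. ring. }
  evar_last. apply (is_derive_comp (fun v => Rpower v (- / (p - 1))) V s).
  apply is_derive_Rpower; lra. apply DV.
  unfold scal; simpl; unfold mult; simpl. unfold nbar, src, w.
  set (v := V s) in *. assert (Hv : 0 < v) by lra.
  rewrite Rpower_mult. replace (- / (p - 1) * p) with (- / (p - 1) - 1) by (field; lra).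
  assert (E1 : Rpower v (- / (p - 1) - 1) * v = Rpower v (- / (p - 1))).
  { rewrite <- (Rpower_1 v) at 2 by auto. rewrite <- Rpower_plus. f_equal; ring. }
  rewrite <- E1. unfold a, D. replace (1 - p) with (1 + - p) by ring. rewrite Rpower_plus, Rpower_1 by lra.
  field. lra. }
specialize (Cmp Hw0 HwX Hwd).
assert (Hcs : cone x sg).
{ apply (cone_sub _ _ _ _ Hc); auto. rewrite Rminus_diag, Rabs_R0. lra. }
assert (Fin : 0 <= Rmax (val false x t) (val true x t) - (gam false + (w sg - gm) / 2)).
{ apply pow_half_limit_nonneg with (Z * exp (4 * dsrc p Z * sg)). intros n.
  assert (B := Cmp n false x sg Hcs (Rle_refl _)).
  assert (B2 : iter false n x sg <= iter false n x t).
  { apply iter_mono; auto. rewrite Rminus_diag, Rabs_R0. nra. }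
  assert (B3 := iter_le_val false n x t Hb). assert (B4 := Rmax_l (val false x t) (val true x t)).
  replace (Z * exp (4 * dsrc p Z * sg) / 2 ^ n) with (Z / 2 ^ n * exp (4 * dsrc p Z * sg)) by (field; apply pow_nonzero; lra).
  lra. }
rewrite Hwsg in Fin. unfold gam in Fin. lra.
Qed.

(** * The blow-up curve *)

Variables (Rst Tst : R).
Hypothesis Hrho : rho = Rst + Tst.
Hypothesis HTst : 0 < Tst.
Hypothesis HA1 : T1 p mu g1 g2 < Tst.
Let T x := Tblow p mu g1 g2 f g Tst x.

Lemma cone_in x t : Rabs x < Rst -> 0 <= t <= Tst -> cone x t.
Proof. intros. split. lra. rewrite Hrho. lra. Qed.

(** Local existence from the initial line; it makes the set whose supremum is T(x) nonempty. *)
Lemma bdd_early x : Rabs x < Rst -> exists t, 0 < t < Tst /\ bdd x t.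
Proof.
intros Hx. assert (N0 := Nl_gm_pos). set (M := Rmax (dat false x) (dat true x) + 1).
assert (Hxr : Rabs x < rho) by lra.
assert (HM : 0 < M).
{ generalize (Hlow false x Hxr) (Rmax_l (dat false x) (dat true x)). unfold M, gam. lra. }
assert (Hs := src_pos p (4 * M)).
(* The first bound keeps the data within 1 of their value at x, by [Hlip]; the second is the
   smallness condition of [local_existence]. *)
set (r := Rmin (/ Nl p mu gm 0) (Rmin (M / src p (4 * M)) (Tst / 2))).
assert (R1 : r <= / Nl p mu gm 0) by apply Rmin_l.
assert (R2 : r <= M / src p (4 * M)) by (eapply Rle_trans; [apply Rmin_r|apply Rmin_l]).
assert (R3 : r <= Tst / 2) by (eapply Rle_trans; [apply Rmin_r|apply Rmin_r]).
assert (Hr : 0 < r).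
{ repeat apply Rmin_glb_lt. apply Rinv_0_lt_compat; auto. apply Rdiv_lt_0_compat; auto. lra. }
exists r. split. lra. rewrite <- (Rplus_0_l r). apply (local_existence x 0 r M); try lra.
- apply Rle_div_r in R2; auto.
- apply cone_in; auto; lra.
- intros b n y Hy.
  assert (Hyr : Rabs y < rho).
  { replace y with (x + (y - x)) by ring. eapply Rle_lt_trans. apply Rabs_triang. lra. }
  assert (HD : dat b y <= M).
  { assert (Q := Hlip b x y Hxr Hyr). fold gm in Q.
    assert (Q1 : Nl p mu gm 0 * Rabs (y - x) <= 1).
    { apply Rle_trans with (Nl p mu gm 0 * / Nl p mu gm 0). apply Rmult_le_compat_l; lra.
      right; apply Rinv_r; lra. }
    assert (Q2 := Rle_abs (dat b y - dat b x)). assert (Q3 := Rabs_pos (dat b y - dat b x)).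
    assert (dat b x <= Rmax (dat false x) (dat true x)) by (destruct b; [apply Rmax_r|apply Rmax_l]).
    unfold M. nra. }
  destruct n as [|n].
  + eapply Rle_trans; [|apply HD]. eapply Rle_trans; [|apply Hlow; auto]. destruct b; simpl; lra.
  + assert (E := iter_path_0 b n y). rewrite Rmult_0_r, Rplus_0_r in E. rewrite E; auto.
Qed.

(** Boundedness is inherited by earlier times, so T(x) separates the two regimes. As T(x) <= T1 <
    T*, the truncation at T* in its definition never takes effect. *)
Lemma T_spec x : Rabs x < Rst ->
  0 < T x <= T1 p mu g1 g2 /\
  (forall t, 0 <= t < T x -> bdd x t) /\ (forall t, 0 < t < Tst -> bdd x t -> t <= T x).
Proof.
intros Hx. set (E := fun t => 0 < t < Tst /\ Rbar_lt (Rbar_plus (sol false x t) (sol true x t)) p_infty).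
change (T x) with (real (Lub_Rbar E)).
destruct (Lub_Rbar_correct E) as [H1 H2].
assert (HE : forall t, E t <-> 0 < t < Tst /\ bdd x t).
{ intros t; split; intros [A B]; split; auto; apply finite_iff_bdd; auto; apply cone_in; auto; lra. }
destruct (bdd_early x Hx) as (t0 & Ht0 & Hb0).
assert (B0 : Rbar_le t0 (Lub_Rbar E)) by (apply H1, HE; auto).
assert (B1 : Rbar_le (Lub_Rbar E) (T1 p mu g1 g2)).
{ apply H2. intros t Ht. apply HE in Ht. destruct Ht as [Ht Hb]. simpl. left. apply (bdd_before_T1 x); auto.
  apply cone_in; auto; lra. }
destruct (Lub_Rbar E) as [l| |]; simpl in *; try contradiction.
split; [lra|split].
- intros t Ht. destruct (classic (exists t', t < t' /\ E t')) as [(t' & Ht' & He)|Hn].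
  + apply HE in He. destruct He as [He Hb]. apply bdd_mono with x t'; auto; try (apply cone_in; auto; lra).
    rewrite Rminus_diag, Rabs_R0. nra.
  + exfalso. assert (l <= t); [|lra]. apply (H2 t). intros t' Ht'. simpl. apply Rnot_lt_le. intros Hl.
    apply Hn. exists t'; auto.
- intros t Ht Hb. apply (H1 t). apply HE; auto.
Qed.

(** Boundedness at (x', t') descends to the whole backward cone of slope k; a steeper T would place
    a point beyond T(x) in such a cone. *)
Lemma T_lip x x' : Rabs x < Rst -> Rabs x' < Rst -> k * (T x' - T x) <= Rabs (x' - x).
Proof.
intros Hx Hx'. destruct (T_spec x Hx) as (A1 & A2 & A3). destruct (T_spec x' Hx') as (B1 & B2 & B3).
apply Rnot_lt_le. intros Hlt.
assert (Hd : Rabs (x' - x) / k < T x' - T x) by (apply Rlt_div_l; lra).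
assert (P := Rabs_pos (x' - x)). set (d := Rabs (x' - x) / k) in *.
assert (Pd : 0 <= d) by (apply Rmult_le_pos; auto; left; apply Rinv_0_lt_compat; lra).
set (t' := (T x' + T x + d) / 2).
assert (Ht' : 0 <= t' < T x') by (unfold t'; lra).
assert (t' - d <= T x); [|unfold t' in *; lra].
apply A3. unfold t'; lra. apply bdd_mono with x' t'; auto; try (apply cone_in; auto; unfold t'; lra).
unfold d. right. field. lra.
Qed.

(* Monotonicity bounds the solution by [usum x t] on the base of a backward cone of slope k > 1, so
   local existence carries it beyond time t. *)
Lemma T_lower tm : 0 < tm -> exists C, 0 < C /\ forall x t, Rabs x < Rst -> tm <= t < T x ->
  Rpower (C * (T x - t)) (- / (p - 1)) <= usum x t.
Proof.
intros Htm. assert (G1 := gm_gt_1). assert (P2 := Rpower_pos 2 (- p)).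
(* With tau <= c, the first bound keeps t - tau nonnegative, the second keeps t + (k - 1) tau below
   T*, and the third is the smallness condition of [local_existence] for the bound M and the time k
   tau. *)
set (c := Rmin tm (Rmin ((Tst - T1 p mu g1 g2) / (2 * (k - 1))) (Rpower 2 (- p) / k))).
assert (C1 : c <= tm) by apply Rmin_l.
assert (C2 : c <= (Tst - T1 p mu g1 g2) / (2 * (k - 1))) by (eapply Rle_trans; [apply Rmin_r|apply Rmin_l]).
assert (C3 : c <= Rpower 2 (- p) / k) by (eapply Rle_trans; [apply Rmin_r|apply Rmin_r]).
assert (Hc : 0 < c).
{ repeat apply Rmin_glb_lt; auto; apply Rdiv_lt_0_compat; lra. }
apply Rle_div_r in C2; [|lra]. apply Rle_div_r in C3; [|lra].
exists (/ ((k - 1) * c)). assert (Hkc : 0 < (k - 1) * c) by (apply Rmult_lt_0_compat; lra).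
split. apply Rinv_0_lt_compat; auto.
intros x t Hx Ht. destruct (T_spec x Hx) as (A1 & A2 & A3).
assert (Hb : bdd x t) by (apply A2; lra).
assert (Hct : cone x t) by (apply cone_in; auto; lra).
assert (HM := usum_ge x t Hct Hb). set (M := usum x t) in *.
assert (PM : 0 < Rpower M (1 - p) <= 1).
{ split. apply Rpower_pos. apply Rle_trans with (Rpower M 0). apply Rle_Rpower; lra. right; apply Rpower_O; lra. }
set (tau := c * Rpower M (1 - p)).
assert (Htau : 0 < tau <= c). { unfold tau. split. apply Rmult_lt_0_compat; lra. nra. }
assert (Key : bdd x (t - tau + k * tau)).
{ apply (local_existence x (t - tau) (k * tau) M); try lra.
  - nra.
  - unfold tau, src. replace 4 with (2 * 2) by ring. rewrite <- !Rpower_mult_distr by lra.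
    assert (E : Rpower M (1 - p) * Rpower M p = M).
    { rewrite <- Rpower_plus. replace (1 - p + p) with 1 by ring. apply Rpower_1; lra. }
    assert (T2 := two_power_opp). assert (P2' := Rpower_pos 2 p).
    replace (k * (c * Rpower M (1 - p)) * (Rpower 2 (- p) * (Rpower 2 p * Rpower 2 p * Rpower M p)))
      with ((c * k) * Rpower 2 p * (Rpower 2 (- p) * Rpower 2 p) * (Rpower M (1 - p) * Rpower M p)) by ring.
    rewrite E, T2, Rmult_1_r. rewrite <- (Rmult_1_l M) at 2. apply Rmult_le_compat_r. lra.
    rewrite <- T2. apply Rmult_le_compat_r; lra.
  - apply cone_in; auto. nra.
  - intros b n y Hy. assert (Py := Rabs_pos (y - x)).
    assert (Hcy : cone y (t - tau)).
    { split. lra. rewrite Hrho. replace y with (x + (y - x)) by ring.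
      assert (Q := Rabs_triang x (y - x)). nra. }
    eapply Rle_trans. apply (iter_mono n b y (t - tau) x t); auto.
    rewrite Rabs_minus_sym. replace (t - (t - tau)) with tau by ring. auto.
    eapply Rle_trans. apply iter_le_val; auto.
    generalize (val_ge false x t Hct Hb) (val_ge true x t Hct Hb). unfold M, usum, gam. destruct b; lra. }
assert (Hle : t - tau + k * tau <= T x) by (apply A3; auto; nra).
assert (HW : Rpower M (1 - p) <= / ((k - 1) * c) * (T x - t)).
{ rewrite Rmult_comm. apply Rle_div_r; auto. unfold tau in Hle. lra. }
replace M with (Rpower (Rpower M (1 - p)) (- / (p - 1))).
- apply Rpower_antitone. assert (0 < / (p - 1)) by (apply Rinv_0_lt_compat; lra). lra. lra.
- rewrite Rpower_mult. replace ((1 - p) * - / (p - 1)) with 1 by (field; lra). apply Rpower_1; lra.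
Qed.

(** * Passage to the limit *)

Variables (x0 : R) (lam : nat -> R) (T0 : R -> R) (v : bool -> R -> R -> R).
Hypothesis Hk2 : k <= 2.
Hypothesis Hx0 : Rabs x0 < Rst.
Hypothesis Hlam : forall n, 0 < lam n.
Hypothesis Hlam0 : is_lim_seq lam 0.

Definition resc b n y s :=
  Rpower (lam n) (/ (p - 1)) * val b (x0 + lam n * y) (Tblow p mu g1 g2 f g Tst x0 + lam n * s).

Hypothesis HT0 : forall y, is_lim_seq (fun n => T_resc p mu g1 g2 f g Tst x0 (lam n) y) (T0 y).
Hypothesis Hv : forall b y s, s < T0 y -> is_lim_seq (fun n => resc b n y s) (v b y s).
Hypothesis Hreg : forall b y s, s < T0 y -> C3_at (v b) y s.

Let pt n y := x0 + lam n * y.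
Let tim n s := T x0 + lam n * s.

(** The floor T(x0) / 2 serves as the [tm] of [T_lower], so that one constant works for all n. *)
Definition good n y s := Rabs (pt n y) < Rst /\ T x0 / 2 <= tim n s < T (pt n y).

Lemma lin_lim a y : is_lim_seq (fun n => a + lam n * y) a.
Proof.
evar_last. apply is_lim_seq_plus'. apply is_lim_seq_const. apply is_lim_seq_mult'. apply Hlam0. apply is_lim_seq_const.
f_equal; ring.
Qed.

Lemma eventually_in a y l r : l < a < r -> eventually (fun n => l < a + lam n * y < r).
Proof.
intros H. assert (L := lin_lim a y). apply is_lim_seq_spec in L.
assert (He : 0 < Rmin (a - l) (r - a)) by (apply Rmin_glb_lt; lra).
destruct (L (mkposreal _ He)) as [N HN]. exists N. intros n Hn. specialize (HN n Hn). simpl in HN.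
apply Rabs_def2 in HN. generalize (Rmin_l (a - l) (r - a)) (Rmin_r (a - l) (r - a)). lra.
Qed.

Lemma eventually_close y : eventually (fun n => Rabs (pt n y) < Rst).
Proof.
assert (Q := Rabs_def2 _ _ Hx0). destruct (eventually_in x0 y (- Rst) Rst) as [N HN]. lra.
exists N. intros n Hn. specialize (HN n Hn). apply Rabs_def1; unfold pt; lra.
Qed.

Lemma eventually_good y s : s < T0 y -> eventually (fun n => good n y s).
Proof.
intros Hs. destruct (T_spec x0 Hx0) as ((TP & _) & _).
assert (E1 : eventually (fun n => T x0 / 2 < tim n s < T x0 + 1)) by (apply eventually_in; lra).
assert (L := HT0 y). apply is_lim_seq_spec in L.
assert (He : 0 < T0 y - s) by lra. assert (E2 := L (mkposreal _ He)).
generalize (filter_and _ _ (eventually_close y) (filter_and _ _ E1 E2)).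
apply filter_imp. intros n (A & B & D). simpl in D. apply Rabs_def2 in D. destruct D as [_ D].
split; auto. split; [lra|].
assert (D' : s < T_resc p mu g1 g2 f g Tst x0 (lam n) y) by lra. unfold T_resc in D'.
apply Rlt_div_r in D'; [|apply Hlam]. unfold tim, pt, T. lra.
Qed.

Lemma good_cone n y s : good n y s -> cone (pt n y) (tim n s) /\ bdd (pt n y) (tim n s).
Proof.
intros (A & B). destruct (T_spec x0 Hx0) as ((TP & _) & _).
destruct (T_spec _ A) as (D1 & D2 & D3). split. apply cone_in; auto; lra. apply D2; lra.
Qed.

Lemma good_tim_pos n y s : good n y s -> 0 < tim n s.
Proof. intros (A & B). destruct (T_spec x0 Hx0) as ((TP & _) & _). lra. Qed.

Lemma resc_nonneg b n y s : good n y s -> 0 <= resc b n y s.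
Proof.
intros H. destruct (good_cone _ _ _ H) as [A B].
apply Rmult_le_pos. left; apply Rpower_pos. eapply Rle_trans; [|apply (val_ge b _ _ A B)]. destruct b; simpl; lra.
Qed.

Lemma sum_lim y s : s < T0 y -> is_lim_seq (fun n => resc false n y s + resc true n y s) (v false y s + v true y s).
Proof. intros H. apply is_lim_seq_plus'; auto. Qed.

Lemma limit_low : exists C, 0 < C /\ forall y s, s < T0 y ->
  Rpower (C * (T0 y - s)) (- / (p - 1)) <= v false y s + v true y s.
Proof.
destruct (T_spec x0 Hx0) as ((TP & _) & _).
destruct (T_lower (T x0 / 2)) as (C & HC & HL). lra.
exists C. split; auto. intros y s Hs.
assert (Le : is_lim_seq (fun n => Rpower (C * (T_resc p mu g1 g2 f g Tst x0 (lam n) y - s)) (- / (p - 1)))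
   (Rpower (C * (T0 y - s)) (- / (p - 1)))).
{ apply (is_lim_seq_continuous (fun z => Rpower z (- / (p - 1)))).
  - apply continuity_pt_filterlim. apply (continuous_Rpower (C * (T0 y - s))). apply Rmult_lt_0_compat; lra.
  - apply is_lim_seq_mult'. apply is_lim_seq_const. apply is_lim_seq_minus'; auto using is_lim_seq_const. }
refine (is_lim_seq_le_loc (fun n => Rpower (C * (T_resc p mu g1 g2 f g Tst x0 (lam n) y - s)) (- / (p - 1)))
  (fun n => resc false n y s + resc true n y s) _ _ _ Le (sum_lim y s Hs)).
generalize (eventually_good y s Hs). apply filter_imp. intros n Hg.
assert (HLn := HL (pt n y) (tim n s) (proj1 Hg) (proj2 Hg)).
assert (Hl := Hlam n).
unfold resc. fold (T x0) (pt n y) (tim n s). rewrite <- Rmult_plus_distr_l.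
apply Rle_trans with (Rpower (lam n) (/ (p - 1)) * Rpower (C * (T (pt n y) - tim n s)) (- / (p - 1))).
2:{ apply Rmult_le_compat_l; auto. left; apply Rpower_pos. }
(* lam^q cancels against the factor lam^(-q) from T - t: the rate is scale invariant. *)
right.
assert (E : C * (T (pt n y) - tim n s) = lam n * (C * (T_resc p mu g1 g2 f g Tst x0 (lam n) y - s))).
{ unfold T_resc, tim, pt, T. field. lra. }
rewrite E. assert (Hg2' := proj2 Hg).
assert (0 < C * (T_resc p mu g1 g2 f g Tst x0 (lam n) y - s)).
{ apply Rmult_lt_reg_l with (lam n); auto. rewrite <- E, Rmult_0_r. apply Rmult_lt_0_compat; lra. }
rewrite <- (Rpower_mult_distr (lam n)) by auto. rewrite <- Rmult_assoc, <- Rpower_plus.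
replace (/ (p - 1) + - / (p - 1)) with 0 by ring. rewrite Rpower_O by auto. ring.
Qed.

Lemma limit_pos b y s : s < T0 y -> 0 <= v b y s.
Proof.
intros Hs. apply (is_lim_seq_le_loc (fun _ => 0) (fun n => resc b n y s) 0 (v b y s)); auto using is_lim_seq_const.
generalize (eventually_good y s Hs). apply filter_imp. intros n Hg. apply resc_nonneg; auto.
Qed.

Lemma limit_mono b y s y' s' : s < T0 y -> s' < T0 y' -> Rabs (y' - y) <= k * (s' - s) -> v b y s <= v b y' s'.
Proof.
intros Hs Hs' Hd.
apply (is_lim_seq_le_loc (fun n => resc b n y s) (fun n => resc b n y' s') (v b y s) (v b y' s')); auto.
generalize (filter_and _ _ (eventually_good y s Hs) (eventually_good y' s' Hs')). apply filter_imp. intros n [Hg Hg'].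
destruct (good_cone _ _ _ Hg) as [A B]. destruct (good_cone _ _ _ Hg') as [A' B'].
apply Rmult_le_compat_l. left; apply Rpower_pos. apply val_mono; auto.
replace (x0 + lam n * y' - (x0 + lam n * y)) with (lam n * (y' - y)) by ring.
replace (tim n s' - tim n s) with (lam n * (s' - s)) by (unfold tim; ring).
assert (Hl := Hlam n). rewrite Rabs_mult, (Rabs_pos_eq (lam n)) by lra. nra.
Qed.

(** With q = 1 / (p - 1) one has q p = q + 1, so the source and the derivative scale alike. *)
Lemma src_scale l u : 0 < l -> 0 < u ->
  Rpower l (/ (p - 1)) * src p u * l = src p (Rpower l (/ (p - 1)) * u).
Proof.
intros Hl Hu. unfold src. rewrite <- Rpower_mult_distr by (auto; apply Rpower_pos).
rewrite Rpower_mult. replace (/ (p - 1) * p) with (/ (p - 1) + 1) by (field; lra).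
rewrite Rpower_plus, Rpower_1 by auto. ring.
Qed.

(** [val_char] is rescaled before the limit is taken. In the lower bound the damping carries a
    factor lam n and vanishes; in the upper bound it has the good sign and is dropped. *)
Lemma limit_char b y s h : 0 <= h -> s < T0 y -> s + h < T0 (y + dir b * h) ->
  src p (v false y s + v true y s) * h <= v b (y + dir b * h) (s + h) - v b y s /\
  v b (y + dir b * h) (s + h) - v b y s <=
    src p (v false (y + dir b * h) (s + h) + v true (y + dir b * h) (s + h)) * h.
Proof.
intros Hh Hs Hs'. set (y' := y + dir b * h) in *. set (s' := s + h) in *.
destruct limit_low as (C & HC & HL).
assert (Hsrc : forall y s, s < T0 y -> is_lim_seq (fun n => src p (resc false n y s + resc true n y s)) (src p (v false y s + v true y s))).
{ intros y1 s1 H1. apply (is_lim_seq_continuous (src p)); [|apply sum_lim; auto].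
  apply continuity_pt_filterlim. apply (ex_derive_continuous (src p)). eexists. apply is_derive_src.
  eapply Rlt_le_trans; [|apply HL; auto]. apply Rpower_pos. }
assert (LD := is_lim_seq_minus' _ _ _ _ (Hv b y' s' Hs') (Hv b y s Hs)).
assert (Ev : eventually (fun n =>
   (src p (resc false n y s + resc true n y s) - lam n * (mu / 2 * (resc false n y s + resc true n y s))) * h <=
   resc b n y' s' - resc b n y s <= src p (resc false n y' s' + resc true n y' s') * h)).
{ generalize (filter_and _ _ (eventually_good y s Hs) (eventually_good y' s' Hs')). apply filter_imp. intros n [Hg Hg'].
  destruct (good_cone _ _ _ Hg) as [A B]. destruct (good_cone _ _ _ Hg') as [A' B'].
  assert (Hl := Hlam n). assert (G1 := gm_gt_1).
  assert (W := usum_ge _ _ A B). assert (W' := usum_ge _ _ A' B').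
  assert (Ht := good_tim_pos _ _ _ Hg). assert (Ht' := good_tim_pos _ _ _ Hg').
  assert (Ey : pt n y' = pt n y + dir b * (lam n * h)) by (unfold pt, y'; ring).
  assert (Es : tim n s' = tim n s + lam n * h) by (unfold tim, s'; ring).
  assert (Hc := val_char b (pt n y) (tim n s) (lam n * h)). rewrite <- Ey, <- Es in Hc.
  assert (Hlh : 0 <= lam n * h) by (apply Rmult_le_pos; lra).
  specialize (Hc (Rlt_le _ _ Ht) Hlh A' B'). destruct Hc as [Hc1 Hc2].
  assert (N1 := Nl_ge (usum (pt n y) (tim n s)) (tim n s)). assert (N2 := Nl_le_src (usum (pt n y') (tim n s')) (tim n s')).
  specialize (N1 ltac:(lra) ltac:(lra)). specialize (N2 ltac:(lra) ltac:(lra)).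
  assert (E : forall y s, resc false n y s + resc true n y s = Rpower (lam n) (/ (p - 1)) * usum (pt n y) (tim n s)).
  { intros. unfold resc, usum. fold (T x0) (pt n y0) (tim n s0). ring. }
  rewrite !E, <- !src_scale by lra. unfold resc. fold (T x0) (pt n y) (tim n s) (pt n y') (tim n s').
  assert (PL := Rpower_pos (lam n) (/ (p - 1))). set (L := Rpower (lam n) (/ (p - 1))) in *.
  set (a := usum (pt n y) (tim n s)) in *. set (a' := usum (pt n y') (tim n s')) in *.
  set (d := val b (pt n y') (tim n s')) in *. set (d' := val b (pt n y) (tim n s)) in *.
  assert (F1 : (src p a - mu / 2 * a) * (lam n * h) <= d - d') by (eapply Rle_trans; [apply Rmult_le_compat_r; eauto|auto]).
  assert (F2 : d - d' <= src p a' * (lam n * h)) by (eapply Rle_trans; [|apply Rmult_le_compat_r; eauto]; auto).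
  apply Rmult_le_compat_l with (r := L) in F1; [|lra]. apply Rmult_le_compat_l with (r := L) in F2; [|lra].
  split; lra. }
split.
- apply (is_lim_seq_le_loc (fun n => (src p (resc false n y s + resc true n y s) - lam n * (mu / 2 * (resc false n y s + resc true n y s))) * h)
    (fun n => resc b n y' s' - resc b n y s) (src p (v false y s + v true y s) * h) (v b y' s' - v b y s)); auto.
  + revert Ev. apply filter_imp. tauto.
  + apply is_lim_seq_mult'; [|apply is_lim_seq_const].
    replace (src p (v false y s + v true y s)) with (src p (v false y s + v true y s) - 0 * (mu / 2 * (v false y s + v true y s))) by ring.
    apply is_lim_seq_minus'; auto. apply is_lim_seq_mult'; auto. apply is_lim_seq_mult'. apply is_lim_seq_const. apply sum_lim; auto.
- apply (is_lim_seq_le_loc (fun n => resc b n y' s' - resc b n y s) (fun n => src p (resc false n y' s' + resc true n y' s') * h)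
    (v b y' s' - v b y s) (src p (v false y' s' + v true y' s') * h)); auto.
  + revert Ev. apply filter_imp. tauto.
  + apply is_lim_seq_mult'; auto using is_lim_seq_const.
Qed.

Lemma limit_lip y y' : k * (T0 y' - T0 y) <= Rabs (y' - y).
Proof.
apply (is_lim_seq_le_loc
  (fun n => k * (T_resc p mu g1 g2 f g Tst x0 (lam n) y' - T_resc p mu g1 g2 f g Tst x0 (lam n) y))
  (fun _ => Rabs (y' - y)) (k * (T0 y' - T0 y)) (Rabs (y' - y))); auto using is_lim_seq_const.
- generalize (filter_and _ _ (eventually_close y) (eventually_close y')). apply filter_imp. intros n [Hy Hy'].
  assert (Q := T_lip _ _ Hy Hy'). assert (Hl := Hlam n).
  replace (pt n y' - pt n y) with (lam n * (y' - y)) in Q by (unfold pt; ring).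
  rewrite Rabs_mult, (Rabs_pos_eq (lam n)) in Q by lra.
  apply Rmult_le_reg_l with (lam n); auto. eapply Rle_trans; [|apply Q]. right.
  unfold T_resc, pt, T. field. lra.
- apply is_lim_seq_mult'. apply is_lim_seq_const. apply is_lim_seq_minus'; auto.
Qed.

Lemma limit_T0 : T0 0 = 0.
Proof.
assert (L : is_lim_seq (fun n => T_resc p mu g1 g2 f g Tst x0 (lam n) 0) 0).
{ apply (is_lim_seq_ext (fun _ => 0)); [|apply is_lim_seq_const].
  intros n. unfold T_resc. rewrite Rmult_0_r, Rplus_0_r. field. generalize (Hlam n); lra. }
apply is_lim_seq_unique in L. assert (L' := is_lim_seq_unique _ _ (HT0 0)). rewrite L in L'. congruence.
Qed.

Lemma limit_blowup : exists C, blowup_limit p k C T0 v.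
Proof.
destruct limit_low as (C & HC & HL). exists C. split; auto.
- apply limit_T0.
- apply limit_lip.
- apply limit_pos.
- apply limit_mono.
- intros. apply limit_char; auto.
Qed.

End Iterates.

(** * From the stated hypotheses to those of the iteration *)

Lemma conv_locunif_pointwise Gn G y : conv_locunif Gn G -> is_lim_seq (fun n => Gn n y) (G y).
Proof.
intros H. apply is_lim_seq_spec. intros eps. destruct (H (Rabs y) eps (cond_pos eps)) as [N HN].
exists N. intros n Hn. apply HN; auto. lra.
Qed.

Lemma conv_C3loc_pointwise Fn F W y s : conv_C3loc Fn F W -> W y s -> is_lim_seq (fun n => Fn n y s) (F y s).
Proof.
intros [_ H] Hu. apply is_lim_seq_spec. intros eps.
destruct (H (fun y' s' => y' = y /\ s' = s)) as [_ H2].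
- split.
  + exists (Rmax (Rabs y) (Rabs s)). intros y' s' [-> ->]. split; [apply Rmax_l|apply Rmax_r].
  + intros y' s' Hc.
    assert (E : forall eps, 0 < eps -> Rabs (y - y') < eps /\ Rabs (s - s') < eps).
    { intros e He. destruct (Hc e He) as (a & b & [-> ->] & Ha). auto. }
    assert (Z : forall z, (forall e, 0 < e -> Rabs z < e) -> z = 0).
    { intros z Hz. destruct (Req_dec z 0) as [|Hn]; auto. generalize (Hz _ (Rabs_pos_lt z Hn)). lra. }
    split; apply Rminus_diag_uniq_sym, Z; intros e He; apply E; auto.
- intros y' s' [-> ->]; auto.
- destruct (H2 eps (cond_pos eps)) as [N HN]. exists N. intros n Hn.
  apply (HN n Hn y s (conj eq_refl eq_refl) 0%nat 0%nat). lia.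
Qed.

(** From 0 to x one moves by steps of length del / 2, each changing F by less than 1; boundedness of
    the interval bounds their number. *)
Lemma Derive_bounded_of_unif_cont (F : R -> R) a : 0 < a ->
  (forall eps, 0 < eps -> exists del, 0 < del /\
     forall x x', -a < x < a -> -a < x' < a -> Rabs (x' - x) < del -> Rabs (F x' - F x) < eps) ->
  exists M, forall x, -a < x < a -> Rabs (F x) <= M.
Proof.
intros Ha H. destruct (H 1) as (del & Hd & Hdel). lra.
assert (E : forall n x, -a < x < a -> Rabs x <= INR n * (del / 2) -> Rabs (F x) <= Rabs (F 0) + INR n).
{ induction n as [|n IH]; intros x Hx Hn.
  - simpl in Hn. rewrite Rmult_0_l in Hn. assert (x = 0).
    { destruct (Req_dec x 0) as [|Hne]; auto. generalize (Rabs_pos_lt x Hne). lra. }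
    subst x. simpl. lra.
  - rewrite S_INR in *.
    destruct (Rle_lt_dec (Rabs x) (del / 2)) as [Hs|Hs].
    + assert (Q : Rabs (F x - F 0) < 1).
      { apply Hdel; try lra. rewrite Rminus_0_r; lra. }
      assert (T := Rabs_triang (F x - F 0) (F 0)). replace (F x - F 0 + F 0) with (F x) in T by ring.
      generalize (pos_INR n). lra.
    + assert (exists x', -a < x' < a /\ Rabs x' <= INR n * (del / 2) /\ Rabs (x - x') < del) as (x' & X1 & X2 & X3).
      { destruct (Rle_lt_dec 0 x).
        - rewrite Rabs_pos_eq in Hn, Hs by lra. exists (x - del / 2). split; [lra|].
          rewrite !Rabs_pos_eq by lra. lra.
        - rewrite Rabs_left in Hn, Hs by lra. exists (x + del / 2). split; [lra|].
          rewrite !Rabs_left by lra. lra. }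
      specialize (IH x' X1 X2). assert (Q := Hdel x' x X1 Hx X3).
      assert (T := Rabs_triang (F x - F x') (F x')). replace (F x - F x' + F x') with (F x) in T by ring. lra. }
destruct (nfloor_ex (a / (del / 2))) as [N HN].
{ left. apply Rdiv_lt_0_compat; lra. }
exists (Rabs (F 0) + INR (S N)). intros x Hx. apply E; auto.
rewrite S_INR. destruct HN as [_ HN]. apply Rlt_div_l in HN; [|lra].
left. eapply Rle_lt_trans; [|apply HN]. apply Rabs_le; lra.
Qed.

(** [real] would turn an infinite supremum into 0 and empty (A4) of content; bounded derivatives
    rule this out. *)
Lemma maxder_ge f g a x : 0 < a -> Ck_closed 4 f a -> Ck_closed 4 g a -> -a < x < a ->
  Rabs (Derive f x) + Rabs (Derive g x) <= maxder f g a.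
Proof.
intros Ha (_ & _ & Hf) (_ & _ & Hg) Hx.
destruct (Derive_bounded_of_unif_cont (Derive f) a Ha) as [Mf HMf]. { apply (Hf 1%nat); lia. }
destruct (Derive_bounded_of_unif_cont (Derive g) a Ha) as [Mg HMg]. { apply (Hg 1%nat); lia. }
unfold maxder. set (E := fun r => exists x, -a < x < a /\ r = Rabs (Derive f x) + Rabs (Derive g x)).
destruct (Lub_Rbar_correct E) as [H1 H2].
assert (A : Rbar_le (Rabs (Derive f x) + Rabs (Derive g x)) (Lub_Rbar E)) by (apply H1; exists x; auto).
assert (B : Rbar_le (Lub_Rbar E) (Mf + Mg)).
{ apply H2. intros r (z & Hz & ->). simpl. apply Rplus_le_compat; auto. }
destruct (Lub_Rbar E); simpl in *; try contradiction; auto.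
Qed.

Lemma lipschitz_of_Derive_bound f a M : (forall x, -a < x < a -> ex_derive f x) ->
  (forall x, -a < x < a -> Rabs (Derive f x) <= M) ->
  forall x x', -a < x < a -> -a < x' < a -> Rabs (f x' - f x) <= M * Rabs (x' - x).
Proof.
intros Hf HM x x' Hx Hx'.
assert (Hin : forall c, Rmin x x' <= c <= Rmax x x' -> -a < c < a).
{ intros c Hc. unfold Rmin, Rmax in Hc. destruct (Rle_dec x x'); lra. }
destruct (MVT_gen f x x' (Derive f)) as (c & Hc & E).
- intros z Hz. apply Derive_correct, Hf, Hin; lra.
- intros z Hz. apply continuity_pt_filterlim, (ex_derive_continuous f), Hf, Hin; auto.
- rewrite E, Rabs_mult. apply Rmult_le_compat_r. apply Rabs_pos. auto.
Qed.

Theorem theorem3p4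
  (p mu Rst Tst g1 g2 : R) (f g : R -> R) (eps0 eps1 : R)
  (x0 : R) (lam : nat -> R) (T0 : R -> R) (vphi vpsi : R -> R -> R) :
  1 < p -> 0 < mu -> p < 1 + 2 / mu -> 0 < Rst -> 0 < Tst ->
  0 < g1 -> 0 < g2 ->
  g1 + g2 > Rmax 1 (Rpower (mu * p * Rpower 2 p) (/ (p - 1))) ->
  (* (A1) *)
  T1 p mu g1 g2 < Tst ->
  (* (A2) *)
  (forall x, Rabs x < Rst + Tst -> f x >= g1 /\ g x >= g2) ->
  (* (A3) *)
  Ck_closed 4 f (Rst + Tst) -> Ck_closed 4 g (Rst + Tst) ->
  (* (A4) *)
  0 < eps0 ->
  Rpower 2 (- p) * Rpower (g1 + g2) p - mu / 2 * (g1 + g2)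
    >= (2 + eps0) * maxder f g (Rst + Tst) ->
  (* (A5) *)
  eps1 <> -1 ->
  Rpower 2 (- p) * (2 * p - 1) * (1 + eps1 / (2 * (1 + eps1))) * (1 - 1 / (2 * p))
    - Rpower 2 (- p + 1) * p - mu > 0 ->
  Rpower 2 (- p) * Rpower (g1 + g2) p - mu / 2 * (g1 + g2)
    >= (2 + eps1) * maxder f g (Rst + Tst) ->
  (* x0 and the blow-up sequence *)
  Rabs x0 < Rst ->
  (forall n, 0 < lam n) -> (forall n, lam (S n) <= lam n) -> is_lim_seq lam 0 ->
  conv_locunif (fun n => T_resc p mu g1 g2 f g Tst x0 (lam n)) T0 ->
  conv_C3loc (fun n => phi_resc p mu g1 g2 f g Tst x0 (lam n)) vphi
             (fun y s => s < T0 y) ->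
  conv_C3loc (fun n => psi_resc p mu g1 g2 f g Tst x0 (lam n)) vpsi
             (fun y s => s < T0 y) ->
  exists alpha, -1 < alpha < 1 /\
    (forall y, T0 y = alpha * y) /\
    (forall y s, s < T0 y -> vphi y s = Vphi p alpha y s /\ vpsi y s = Vpsi p alpha y s).
Proof.
intros Hp Hmu _ HR HT Hg1 Hg2 Hbig HA1 HA2 Hf Hg Heps HA4 _ _ _ Hx0 Hlam _ Hlam0 HcT Hcphi Hcpsi.
(* 1 + k <= 2 + eps0 is what (A4) allows; the cap 2 is the one that keeps the Harnack slice within
   reach of the ray. *)
set (k := Rmin (1 + eps0) 2).
assert (Hk1 : k <= 1 + eps0) by apply Rmin_l. assert (Hk2 : k <= 2) by apply Rmin_r.
assert (Hk : 1 < k) by (apply Rmin_glb_lt; lra).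
set (v := fun b : bool => if b then vpsi else vphi).
assert (HN0 : Nl p mu (g1 + g2) 0 = Rpower 2 (- p) * Rpower (g1 + g2) p - mu / 2 * (g1 + g2)).
{ rewrite Nl_pos by lra. unfold src. field. }
assert (Hm := maxder_ge f g (Rst + Tst) ).
assert (Hm0 : 0 <= maxder f g (Rst + Tst)).
{ eapply Rle_trans; [|apply (Hm 0)]; auto; try lra. apply Rplus_le_le_0_compat; apply Rabs_pos. }
assert (Hlip : forall b x x', Rabs x < Rst + Tst -> Rabs x' < Rst + Tst ->
  (1 + k) * Rabs (dat f g b x' - dat f g b x) <= Nl p mu (g1 + g2) 0 * Rabs (x' - x)).
{ intros b x x' Hx Hx'. apply Rabs_def2 in Hx. apply Rabs_def2 in Hx'.
  apply Rle_trans with ((1 + k) * (maxder f g (Rst + Tst) * Rabs (x' - x))).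
  - apply Rmult_le_compat_l. lra. apply (lipschitz_of_Derive_bound _ (Rst + Tst)); try lra.
    + intros z Hz. destruct b; simpl; [apply (proj1 (proj2 Hg) 1%nat)|apply (proj1 (proj2 Hf) 1%nat)]; auto; lia.
    + intros z Hz. assert (Q : Rabs (Derive f z) + Rabs (Derive g z) <= maxder f g (Rst + Tst)) by (apply Hm; auto; lra).
      generalize (Rabs_pos (Derive f z)) (Rabs_pos (Derive g z)). destruct b; simpl; lra.
  - rewrite HN0, <- Rmult_assoc. apply Rmult_le_compat_r. apply Rabs_pos. nra. }
destruct (limit_blowup p mu g1 g2 (Rst + Tst) k f g) with (Rst := Rst) (Tst := Tst) (x0 := x0) (lam := lam) (T0 := T0) (v := v)
  as [C HB]; auto.
- intros b x Hx. destruct (HA2 x Hx). destruct b; simpl; lra.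
- intros y. apply (conv_locunif_pointwise _ _ y HcT).
- intros b y s Hs. destruct b.
  + apply (conv_C3loc_pointwise _ _ _ y s Hcpsi Hs).
  + apply (conv_C3loc_pointwise _ _ _ y s Hcphi Hs).
- intros b y s Hs. destruct b; [apply Hcpsi|apply Hcphi]; auto.
- apply (blowup_limit_self_similar _ _ _ _ _ HB).
Qed.
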